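(* Let $m\ge1$. Let $X$ be a smooth vector field on $\mathbb{S}^1$ and assume that for any $v\in C^\infty(\mathbb{S}^1,\mathbb{R}^m)$ its flow $\phi_t$ satisfies $$v(\phi_t(x))\cdot(-\Delta)^{\frac12}(v\circ\phi_t)(x)=v(\phi_t(x))\cdot\big((-\Delta)^{\frac12}v\big)(\phi_t(x))\,\phi_t'(x)$$ for $x\in\mathbb{S}^1$ and $t$ in a neighbourhood of the origin. Assume that $u\in H^{\frac12}(\mathbb{S}^1,\mathbb{R}^m)$ is a stationary point of $E_{\frac12}$. Then, as distributions on $\mathbb{S}^1$, $$\frac{d}{dx}\left((-\Delta)^{\frac12}u\cdot u\,X\right)=D_{\frac12}(u'X,u).$$
   Context: $\mathbb{S}^1\simeq\mathbb{R}/2\pi\mathbb{Z}$; smooth vector fields on $\mathbb{S}^1$ are identified with smooth functions $X:\mathbb{S}^1\to\mathbb{R}$, and $'$ denotes the derivative in the angular variable $x$. For a distribution $f$ on $\mathbb{S}^1$, $\widehat f(n)=\frac1{2\pi}\langle f,e^{-inx}\rangle$, and $(-\Delta)^s f$ is defined by $\widehat{(-\Delta)^s f}(n)=|n|^{2s}\widehat f(n)$, $n\in\mathbb{Z}$. The half Dirichlet energy is $E_{\frac12}(u)=\int_{\mathbb{S}^1}|(-\Delta)^{\frac14}u|^2\,dx$ for $u\in H^{\frac12}(\mathbb{S}^1,\mathbb{R}^m)$. A map $u\in H^{\frac12}(\mathbb{S}^1,\mathbb{R}^m)$ is a stationary point of $E_{\frac12}$ if $\frac{d}{dt}\big|_{t=0}E_{\frac12}(u\circ\psi_t)=0$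 for every smooth vector field $Z$ on $\mathbb{S}^1$ with flow $\psi_t$. For smooth $a,b:\mathbb{S}^1\to\mathbb{R}^m$ set $D_{\frac12}(a,b)=(-\Delta)^{\frac12}a\cdot b-(-\Delta)^{\frac12}b\cdot a$. For $a\in H^{-\frac12}$, $b\in H^{\frac12}$, $D_{\frac12}(a,b)$ denotes the distribution obtained by continuous extension from smooth maps, i.e. the limit in $\mathscr{D}'(\mathbb{S}^1)$ of $D_{\frac12}(a_n,b_n)$ for smooth $a_n\to a$ in $H^{-\frac12}$ and $b_n\to b$ in $H^{\frac12}$. The distribution $(-\Delta)^{\frac12}u\cdot u\,X$ is understood via the duality of $H^{-\frac12}$ and $H^{\frac12}$: $\varphi\mapsto\langle(-\Delta)^{\frac12}u,\,uX\varphi\rangle$ for $\varphi\in C^\infty(\mathbb{S}^1)$. *)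

(* Defs.v *)
From HB Require Import structures.
From mathcomp Require Import all_boot all_order all_algebra.
From mathcomp Require Import all_classical all_reals all_analysis.
From mathcomp Require Import complex.

Set Implicit Arguments.
Unset Strict Implicit.
Unset Printing Implicit Defensive.

Import Order.TTheory GRing.Theory Num.Theory.
Import numFieldNormedType.Exports.

Local Open Scope classical_set_scope.
Local Open Scope ring_scope.
Local Open Scope complex_scope.

(* The circle is R / 2 pi Z: functions on it are 2pi-periodic functions on R,
   self-maps of it are represented by lifts to R, and maps into R^m are
   families of components indexed by 'I_m. *)

Definition periodicS {R : realType} (f : R -> R) : Prop :=
  forall x, f (x + 2 * pi) = f x.

Definition smooth {R : realType} (f : R -> R) : Prop :=
  forall (k : nat) (x : R), derivable (derive1n k f) x 1.

Definition smoothS {R : realType} (f : R -> R) : Prop :=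
  periodicS f /\ smooth f.

Definition intcirc {R : realType} (f : R -> R) : R :=
  Rintegral (@lebesgue_measure R) `[0, 2 * pi] f.

Definition L2S {R : realType} (f : R -> R) : Prop :=
  [/\ periodicS f, measurable_fun setT f &
    (\int[@lebesgue_measure R]_(x in `[0%R, (2 * pi)%R]) ((f x) ^+ 2)%:E
       < +oo)%E].

(* Real distributions are functionals on all functions R -> R of which only
   the values on smooth periodic functions are meaningful; accordingly they
   are compared with [eq_distr], not with Leibniz equality. *)
Definition distr (R : realType) : Type := (R -> R) -> R.

(* Continuity is expressed by an estimate of finite order. *)
Definition is_distr {R : realType} (T : distr R) : Prop :=
  (forall (a : R) (f g : R -> R), smoothS f -> smoothS g ->
     T (fun x => a * f x + g x) = a * T f + T g) /\
  (exists (N : nat) (C : R), forall (f : R -> R) (M : R), smoothS f ->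
     (forall (k : nat) (x : R), (k <= N)%N -> `|derive1n k f x| <= M) ->
     `|T f| <= C * M).

Definition eq_distr {R : realType} (S T : distr R) : Prop :=
  forall f : R -> R, smoothS f -> S f = T f.

Definition dfun {R : realType} (f : R -> R) : distr R :=
  fun g => intcirc (fun x => f x * g x).

Definition dderiv {R : realType} (T : distr R) : distr R :=
  fun g => - T (derive1 g).

Definition dmul {R : realType} (T : distr R) (h : R -> R) : distr R :=
  fun g => T (fun x => h x * g x).

(* <T, e^{-inx}> / 2pi, where T is extended complex linearly to complex test
   functions: e^{-inx} = cos (nx) - i sin (nx). *)
Definition fourier {R : realType} (T : distr R) (n : int) : R[i] :=
  (T (fun x => cos (n%:~R * x)) / (2 * pi))
  -i* (T (fun x => sin (n%:~R * x)) / (2 * pi)).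

Definition Hnorm2 {R : realType} (s : R) (T : distr R) : \bar R :=
  \esum_(n in [set: int])
    ((1 + n%:~R ^+ 2) `^ s * (Normc.normc (fourier T n)) ^+ 2)%:E.

(* [get P] is an element of [P] if there is one; here it is unique up to
   [eq_distr]. *)
Definition lapl {R : realType} (s : R) (T : distr R) : distr R :=
  get [set S : distr R | is_distr S /\
    forall n : int, fourier S n = (`|n%:~R : R| `^ (2 * s))%:C * fourier T n].

(* (-Delta)^s f as a smooth function, for smooth f. *)
Definition laplC {R : realType} (s : R) (f : R -> R) : R -> R :=
  get [set w : R -> R | smoothS w /\ eq_distr (dfun w) (lapl s (dfun f))].

(* (-Delta)^s f as a square integrable function (unique almost everywhere),
   for f in H^{2s}. *)
Definition laplL2 {R : realType} (s : R) (f : R -> R) : R -> R :=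
  get [set w : R -> R | L2S w /\ eq_distr (dfun w) (lapl s (dfun f))].

(* As H^{1/2} is contained in L^2, its elements are given as functions. *)
Definition H12 {R : realType} (m : nat) (u : 'I_m -> R -> R) : Prop :=
  forall i, L2S (u i) /\ (Hnorm2 2^-1 (dfun (u i)) < +oo)%E.

Definition energy {R : realType} (m : nat) (u : 'I_m -> R -> R) : R :=
  intcirc (fun x => \sum_(i < m) (laplL2 4^-1 (u i) x) ^+ 2).

Definition is_flow {R : realType} (X : R -> R) (phi : R -> R -> R) : Prop :=
  [/\ forall x, phi 0 x = x,
      forall t x : R, is_derive t (1 : R) (fun s => phi s x) (X (phi t x)),
      forall t, smooth (phi t) &
      forall t x, phi t (x + 2 * pi) = phi t x + 2 * pi].

Definition stationary {R : realType} (m : nat) (u : 'I_m -> R -> R) : Prop :=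
  forall (Z : R -> R) (psi : R -> R -> R), smoothS Z -> is_flow Z psi ->
    is_derive (0 : R) (1 : R) (fun t => energy (fun i => u i \o psi t)) 0.

Definition cvgH {R : realType} (s : R) (f : nat -> R -> R) (T : distr R) :
    Prop :=
  Hnorm2 s (fun g => dfun (f k) g - T g) @[k --> \oo] --> (0 : \bar R).

(* The H^{-1/2}-H^{1/2} duality: the extension by continuity of
   f |-> <T, f> from smooth f to g in H^{1/2}. *)
Definition pairing {R : realType} (T S : distr R) : R :=
  get [set l : R | forall f : nat -> R -> R,
    (forall k, smoothS (f k)) -> cvgH 2^-1 f S -> T (f k) @[k --> \oo] --> l].

Definition DhalfC {R : realType} (m : nat) (a b : 'I_m -> R -> R) : R -> R :=
  fun x => \sum_(i < m)
    (laplC 2^-1 (a i) x * b i x - laplC 2^-1 (b i) x * a i x).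

(* Extension of [DhalfC] by continuity to a in H^{-1/2} and b in H^{1/2}. *)
Definition Dhalf {R : realType} (m : nat) (a b : 'I_m -> distr R) : distr R :=
  get [set T : distr R | is_distr T /\
    forall an bn : 'I_m -> nat -> R -> R,
      (forall i k, smoothS (an i k)) -> (forall i k, smoothS (bn i k)) ->
      (forall i, cvgH (- 2^-1) (an i) (a i)) ->
      (forall i, cvgH 2^-1 (bn i) (b i)) ->
      forall f : R -> R, smoothS f ->
        dfun (DhalfC (fun i => an i k) (fun i => bn i k)) f @[k --> \oo]
          --> T f].

(* The distribution (-Delta)^{1/2} u . u X. *)
Definition lapl_dot {R : realType} (m : nat) (u : 'I_m -> R -> R)
    (X : R -> R) : distr R :=
  fun f => \sum_(i < m)
    pairing (lapl 2^-1 (dfun (u i))) (dfun (fun x => u i x * X x * f x)).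

(* Main.v *)
Require Import Defs.
From HB Require Import structures.
From mathcomp Require Import all_boot all_order all_algebra.
From mathcomp Require Import all_classical all_reals all_analysis.
From mathcomp Require Import complex measurable_realfun.
From mathcomp Require Import ring lra zify.

Set Implicit Arguments.
Unset Strict Implicit.
Unset Printing Implicit Defensive.

Import Order.TTheory GRing.Theory Num.Theory.
Import numFieldNormedType.Exports.

Local Open Scope classical_set_scope.
Local Open Scope ring_scope.

(* Write L for (-Delta)^{1/2} and En(v) for the integral of v . L v. Two first
   variations are combined.
   - Along the flow of a vector field Z, En(v o psi_t) has derivative
     2 Q_Z(v), where Q_Z(v) is the integral of L v . v' Z. As
     L(v' Z) - (L v Z)' is of order zero in v, the form Q_Z is bounded on L^2,
     so the expansion of En(v o psi_t) at t = 0 is uniform over the Fourier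
     partial sums v_N of u. With the lower semicontinuity of the energy and
     both signs of t, stationarity of u gives Q_Z(v_N) -> 0. Stationarity is
     only used for Z = cos(kx - th), whose flows are explicit; the other Z
     follow by linearity and boundedness.
   - Polarized at 1 + w, the invariance hypothesis says that
     L(w o phi_t) = (L w)(phi_t) phi_t'. Differentiating at t = 0 against a
     test function g gives int X (w' L g + L w g') = 0.
   Choosing w = v_N and g = v_N f in the second identity,
     int D(v_N' X, v_N) f = - int L v_N . v_N X f' - 2 Q_{X f}(v_N),
   and N -> oo yields the theorem. The Sobolev estimates (multiplication by
   smooth functions, commutators with L) all come from one weighted bound on
   convolutions of Fourier coefficients, [symbol_bound]. *)

(** Nothing can be differentiated along a flow at [u] itself, which is only in H^{1/2}: stationarity
    is one derivative at [t = 0], known to vanish, while each partial sum has a computable variation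
    that need not vanish. The link between them is one-sided: the energy of [u] moved by the flow is
    at most the lower limit of the energies of the moved partial sums, with equality at [t = 0]. A
    one-sided comparison suffices because the error of the expansion is o(t) uniformly in [N]; that
    uniformity is what the L^2 bound on Q_Z buys, although neither L v nor v' Z is controlled by the
    L^2 norm of v. The neighbourhood of [t = 0] in the invariance hypothesis depends on the test
    map, so the hypothesis is differentiated for one trigonometric function at a time and then
    extended linearly. The operators of the statement are selected by [get] and mean something only
    once a witness is exhibited. The witnesses are rapidly convergent series for smooth functions,
    the Riesz-Fischer theorem for (-Delta)^{1/4} u, and limits along partial sums for the pairing
    and for D; uniqueness of Fourier coefficients identifies the operators applied to functions. *)

(** * Calculus of smooth functions and of smooth periodic functions *)

Section SmoothFunctions.
Variable R : realType.
Implicit Types (f g : R -> R) (x y l a b c : R).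

Lemma is_derive1E f x l : is_derive x 1 f l -> derive1 f x = l.
Proof. by move=> h; rewrite derive1E; exact: derive_val. Qed.

Lemma is_derive1_derivable f x l : is_derive x 1 f l -> derivable f x 1.
Proof. by move=> h; exact: ex_derive. Qed.

Lemma derivable_is_derive1 f x : derivable f x 1 -> is_derive x 1 f (derive1 f x).
Proof. by move=> h; rewrite derive1E; exact/derivableP. Qed.

Lemma derive1_funE f df : (forall x, is_derive x 1 f (df x)) -> derive1 f = df.
Proof. by move=> h; apply/funext => x; exact: is_derive1E. Qed.

(* [smooth], [smoothS] and bounds on derivatives are wrapped in inductive types
   so that failing unification problems do not unfold the derivatives. *)
Variant Smooth f : Prop := MkSmooth of smooth f.

Lemma smoothP f :
  Smooth f <-> (forall x, derivable f x 1) /\ Smooth (derive1 f).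
Proof.
split=> [[h]|[h0 [h]]].
  split=> [x|]; first exact: (h 0%N).
  by split=> k x; rewrite -derive1Sn; exact: h.
by split; case=> [|k] x; [exact: h0|rewrite derive1Sn; exact: h].
Qed.

Lemma smooth_derivable f x : Smooth f -> derivable f x 1.
Proof. by move=> /smoothP[]. Qed.

Lemma smooth_derive1 f : Smooth f -> Smooth (derive1 f).
Proof. by move=> /smoothP[]. Qed.

Lemma smooth_is_derive f x : Smooth f -> is_derive x 1 f (derive1 f x).
Proof. by move=> /smooth_derivable h; exact/derivable_is_derive1/h. Qed.

Lemma smooth_continuous f : Smooth f -> continuous f.
Proof.
move=> h x; apply: differentiable_continuous.
exact/derivable1_diffP/smooth_derivable.
Qed.

(** No formula for the [k]-th derivative is ever needed: it is enough to find a class stable under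
    [derive1], such as [elementary] below or the trigonometric series with rapidly decreasing
    coefficients. *)
Lemma smooth_coind (P : (R -> R) -> Prop) :
  (forall f, P f -> (forall x, derivable f x 1) /\ P (derive1 f)) ->
  forall f, P f -> Smooth f.
Proof.
move=> h f Pf; split=> k; elim: k f Pf => [|k IH] f /h[df Pf] x; first exact: df.
by rewrite derive1Sn; exact: IH.
Qed.

(** A class whose derivatives can be written in the class itself. [Elem_base] admits arbitrary
    smooth functions, so that closure of [Smooth] under sums, products and composition is a special
    case; [Elem_atan] and [Elem_inv] also serve the explicit flow formula. *)
Inductive elementary : (R -> R) -> Prop :=
| Elem_base f : Smooth f -> elementary f
| Elem_cst c : elementary (fun=> c)
| Elem_id : elementary (fun x => x)
| Elem_cos : elementary (fun x => cos x)
| Elem_sin : elementary (fun x => sin x)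
| Elem_exp : elementary (fun x => expR x)
| Elem_atan : elementary (fun x => atan x)
| Elem_add f g : elementary f -> elementary g -> elementary (fun x => f x + g x)
| Elem_mul f g : elementary f -> elementary g -> elementary (fun x => f x * g x)
| Elem_inv f : elementary f -> (forall x, f x != 0) ->
    elementary (fun x => (f x)^-1)
| Elem_comp f g : elementary f -> elementary g -> elementary (fun x => f (g x)).

Lemma elementary_smooth f : elementary f -> Smooth f.
Proof.
move: f; apply: smooth_coind => f.
suff : elementary f -> exists2 df, elementary df & forall x, is_derive x 1 f (df x).
  move=> h /h[df edf dfE]; rewrite (derive1_funE dfE); split => //.
elim=> {f}.
- move=> f sf; exists (derive1 f); first exact/Elem_base/smooth_derive1.
  by move=> x; exact: smooth_is_derive.
- by move=> c; exists (fun=> 0) => [|x]; [exact: Elem_cst|exact: is_derive_cst].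
- by exists (fun=> 1) => [|x]; [exact: Elem_cst|exact: is_derive_id].
- exists (fun x => - 1 * sin x) => [|x].
    by apply: Elem_mul; [exact: Elem_cst|exact: Elem_sin].
  by rewrite mulN1r; exact: is_derive_cos.
- by exists (fun x => cos x) => [|x]; [exact: Elem_cos|exact: is_derive_sin].
- by exists (fun x => expR x) => [|x]; [exact: Elem_exp|exact: is_derive_expR].
- exists (fun x => (1 + x * x)^-1) => [|x].
    apply: Elem_inv => [|x]; last by rewrite -expr2; have := sqr_ge0 x; lra.
    apply: Elem_add; first exact: Elem_cst.
    by apply: Elem_mul; exact: Elem_id.
  by rewrite -expr2; exact: is_derive1_atan.
- move=> f g _ [df edf dfE] _ [dg edg dgE].
  by exists (fun x => df x + dg x) => [|x]; [exact: Elem_add|exact: is_deriveD].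
- move=> f g ef [df edf dfE] eg [dg edg dgE].
  exists (fun x => f x * dg x + g x * df x) => [|x]; last exact: is_deriveM.
  by apply: Elem_add; exact: Elem_mul.
- move=> f ef [df edf dfE] f0.
  exists (fun x => - 1 * ((f x)^-1 * (f x)^-1) * df x) => [|x].
    apply: Elem_mul => //; apply: Elem_mul; first exact: Elem_cst.
    by apply: Elem_mul; exact: Elem_inv.
  have /is_derive_eq := is_deriveV (f0 x) (dfE x); apply.
  by rewrite mulN1r -invfM -expr2.
- move=> f g ef [df edf dfE] eg [dg edg dgE].
  exists (fun x => df (g x) * dg x) => [|x].
    by apply: Elem_mul => //; exact: Elem_comp.
  exact: is_derive1_comp.
Qed.

Lemma smooth_cst c : Smooth (fun=> c : R).
Proof. exact/elementary_smooth/Elem_cst. Qed.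

Lemma smooth_add f g : Smooth f -> Smooth g -> Smooth (fun x => f x + g x).
Proof.
by move=> sf sg; apply/elementary_smooth/Elem_add; exact: Elem_base.
Qed.

Lemma smooth_mul f g : Smooth f -> Smooth g -> Smooth (fun x => f x * g x).
Proof.
by move=> sf sg; apply/elementary_smooth/Elem_mul; exact: Elem_base.
Qed.

Lemma smooth_comp f g : Smooth f -> Smooth g -> Smooth (fun x => f (g x)).
Proof.
by move=> sf sg; apply/elementary_smooth/Elem_comp; exact: Elem_base.
Qed.

Lemma derive1_cstE (c : R) : derive1 (fun=> c : R) = fun=> 0.
Proof. by apply: derive1_funE => x; exact: is_derive_cst. Qed.

Lemma derive1_addE f g : Smooth f -> Smooth g ->
  derive1 (fun x => f x + g x) = fun x => derive1 f x + derive1 g x.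
Proof.
move=> sf sg; apply: derive1_funE => x.
by apply: is_deriveD; exact: smooth_is_derive.
Qed.

Lemma derive1_mulE f g : Smooth f -> Smooth g ->
  derive1 (fun x => f x * g x) = fun x => derive1 f x * g x + f x * derive1 g x.
Proof.
move=> sf sg; apply: derive1_funE => x.
apply: is_derive_eq; first by apply: is_deriveM; exact: smooth_is_derive.
by rewrite addrC mulrC.
Qed.

Lemma derive1_scaleE a f : Smooth f ->
  derive1 (fun x => a * f x) = fun x => a * derive1 f x.
Proof.
move=> sf; rewrite derive1_mulE//; last exact: smooth_cst.
by apply/funext => x; rewrite derive1_cstE mul0r add0r.
Qed.

Variant SmoothS f : Prop := MkSmoothS of periodicS f & Smooth f.

Lemma SmoothSP f : SmoothS f <-> smoothS f.
Proof. by split=> [[pf [sf]]|[pf sf]]; split. Qed.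

Lemma smoothS_cst c : SmoothS (fun=> c : R).
Proof. by split=> //; exact: smooth_cst. Qed.

Lemma smoothS_add f g : SmoothS f -> SmoothS g -> SmoothS (fun x => f x + g x).
Proof.
move=> [pf sf] [pg sg]; split; last exact: smooth_add.
by move=> x; rewrite pf pg.
Qed.

Lemma smoothS_mul f g : SmoothS f -> SmoothS g -> SmoothS (fun x => f x * g x).
Proof.
move=> [pf sf] [pg sg]; split; last exact: smooth_mul.
by move=> x; rewrite pf pg.
Qed.

Lemma smoothS_scale a f : SmoothS f -> SmoothS (fun x => a * f x).
Proof. by move=> sf; apply: smoothS_mul => //; exact: smoothS_cst. Qed.

Lemma smoothS_opp f : SmoothS f -> SmoothS (fun x => - f x).
Proof.
move=> sf; rewrite (_ : (fun x => - f x) = fun x => -1 * f x).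
  exact: smoothS_scale.
by apply/funext => x; rewrite mulN1r.
Qed.

Lemma smoothS_sub f g : SmoothS f -> SmoothS g -> SmoothS (fun x => f x - g x).
Proof. by move=> sf sg; apply: smoothS_add => //; exact: smoothS_opp. Qed.

Lemma smoothS_sum (I : Type) (r : seq I) (F : I -> R -> R) :
  (forall i, SmoothS (F i)) -> SmoothS (fun x => \sum_(i <- r) F i x).
Proof.
move=> h; elim: r => [|a r IH].
  under eq_fun do rewrite big_nil; exact: smoothS_cst.
by under eq_fun do rewrite big_cons; exact: smoothS_add.
Qed.

Lemma derive1_subE f g : Smooth f -> Smooth g ->
  derive1 (fun x => f x - g x) = fun x => derive1 f x - derive1 g x.
Proof.
by move=> sf sg; apply: derive1_funE => x; apply: is_deriveB; exact: smooth_is_derive.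
Qed.

Lemma smoothS_derive1 f : SmoothS f -> SmoothS (derive1 f).
Proof.
move=> [pf sf]; split; last exact: smooth_derive1.
move=> x; rewrite -[in RHS](funext pf : (fun y => f (y + 2 * pi)) = f).
apply/esym/is_derive1E; rewrite -[derive1 f _]mulr1.
apply: is_derive1_comp; first exact: smooth_is_derive.
by apply: is_derive_eq; rewrite addr0.
Qed.

Variant Cbound N f (M : R) : Prop := MkCbound of
  forall (k : nat) (x : R), (k <= N)%N -> `|derive1n k f x| <= M.

Lemma Cbound0 f M : Cbound 0 f M <-> forall x, `|f x| <= M.
Proof.
split=> [[h] x|h]; first exact: (h 0%N).
by split=> k x; rewrite leqn0 => /eqP ->; exact: h.
Qed.

Lemma CboundS N f M :
  Cbound N.+1 f M <-> (forall x, `|f x| <= M) /\ Cbound N (derive1 f) M.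
Proof.
split=> [[h]|[h0 [h]]]; first split=> [x|]; first exact: (h 0%N).
  by split=> k x kN; rewrite -derive1Sn; exact: h.
by split=> -[|k] x kN; [exact: h0|rewrite derive1Sn; exact: h].
Qed.

Lemma Cbound_le N f M M' : M <= M' -> Cbound N f M -> Cbound N f M'.
Proof. by move=> MM [h]; split=> k x kN; exact: le_trans (h k x kN) MM. Qed.

Lemma Cbound_leq N N' f M : (N' <= N)%N -> Cbound N f M -> Cbound N' f M.
Proof. by move=> NN [h]; split=> k x kN; apply: h; exact: leq_trans kN NN. Qed.

Lemma Cbound_ge0 N f M : Cbound N f M -> 0 <= M.
Proof. by move=> [/(_ 0%N 0 isT)]; apply: le_trans. Qed.

Lemma Cbound_add N f g M M' : Smooth f -> Smooth g ->
  Cbound N f M -> Cbound N g M' -> Cbound N (fun x => f x + g x) (M + M').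
Proof.
elim: N f g => [|N IH] f g sf sg.
  move=> /Cbound0 hf /Cbound0 hg; apply/Cbound0 => x.
  by rewrite (le_trans (ler_normD _ _))// lerD.
move=> /CboundS[hf hf'] /CboundS[hg hg']; apply/CboundS; split => //.
  by move=> x; rewrite (le_trans (ler_normD _ _))// lerD.
by rewrite derive1_addE//; apply: IH => //; exact: smooth_derive1.
Qed.

(** Each differentiation by the product rule doubles the number of terms, whence [2 ^+ N]. *)
Lemma Cbound_mul N f g M M' : Smooth f -> Smooth g ->
  Cbound N f M -> Cbound N g M' ->
  Cbound N (fun x => f x * g x) (2 ^+ N * (M * M')).
Proof.
elim: N f g => [|N IH] f g sf sg.
  move=> /Cbound0 hf /Cbound0 hg; apply/Cbound0 => x.
  by rewrite expr0 mul1r normrM ler_pM.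
move=> bf bg; have M0 := Cbound_ge0 bf; have M'0 := Cbound_ge0 bg.
move: (bf) (bg) => /CboundS[bf0 bf'] /CboundS[bg0 bg'].
apply/CboundS; split => //.
  move=> x; rewrite normrM (@le_trans _ _ (M * M'))//; first exact: ler_pM.
  by rewrite ler_peMl ?mulr_ge0// exprn_ege1// ler1n.
rewrite derive1_mulE// exprS -mulrA mulr2n mulrDl mul1r.
apply: Cbound_add.
- by apply: smooth_mul => //; exact: smooth_derive1.
- by apply: smooth_mul => //; exact: smooth_derive1.
- apply: IH => //; first exact: smooth_derive1.
  exact: Cbound_leq bg.
- apply: IH => //; first exact: smooth_derive1.
  exact: Cbound_leq bf.
Qed.

Lemma Cbound_derive1 N f M : Cbound N.+1 f M -> Cbound N (derive1 f) M.
Proof. by move=> /CboundS[]. Qed.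

Lemma periodicS_nat f n x : periodicS f -> f (x + n%:R * (2 * pi)) = f x.
Proof.
move=> pf; elim: n => [|n IH]; first by rewrite mul0r addr0.
by rewrite -natr1 mulrDl mul1r addrA pf.
Qed.

Lemma periodicS_int f (n : int) x : periodicS f -> f (x + n%:~R * (2 * pi)) = f x.
Proof.
move=> pf; case: n => n; first exact: periodicS_nat.
rewrite NegzE mulrNz mulNr -[LHS](periodicS_nat n.+1 _ pf) -[in RHS](addr0 x).
by congr f; rewrite -addrA addNr.
Qed.

Lemma periodicS_itv (x : R) :
  exists2 n : int, 0 <= x + n%:~R * (2 * pi) & x + n%:~R * (2 * pi) < 2 * pi.
Proof.
have p0 : 0 < 2 * pi :> R by rewrite mulr_gt0// pi_gt0.
have /andP[h1 h2] := Num.Theory.floor_itv (x / (2 * pi)).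
exists (- Num.floor (x / (2 * pi))); rewrite mulrNz mulNr.
- by rewrite subr_ge0 -ler_pdivlMr.
- by move: h2; rewrite ltr_pdivrMr// intrD mulrDl mul1r ltrBlDl.
Qed.

Lemma smoothS_bounded f : SmoothS f -> exists M, forall x, `|f x| <= M.
Proof.
move=> [pf sf].
have p0 : 0 <= 2 * pi :> R by rewrite mulr_ge0// pi_ge0.
have cf : {within `[0, 2 * pi], continuous (fun x => `|f x|)}.
  apply: continuous_subspaceT => x; apply: continuous_comp.
    exact: smooth_continuous.
  exact: norm_continuous.
have [c _ hc] := EVT_max p0 cf.
exists `|f c| => x; have [n n0 n1] := periodicS_itv x.
rewrite -(periodicS_int n x pf); apply: hc.
by rewrite in_itv/= n0 ltW.
Qed.

Lemma smoothS_Cbound N f : SmoothS f -> exists M, Cbound N f M.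
Proof.
elim: N f => [|N IH] f sf.
  by have [M hM] := smoothS_bounded sf; exists M; exact/Cbound0.
have [M hM] := smoothS_bounded sf.
have [M' hM'] := IH _ (smoothS_derive1 sf).
exists (Num.max M M'); apply/CboundS; split => //.
  by move=> x; rewrite le_max hM.
by apply: Cbound_le hM'; rewrite le_max lexx orbT.
Qed.

Lemma MVT_bound f M : (forall x, derivable f x 1) ->
  (forall x, `|derive1 f x| <= M) -> forall x y, `|f x - f y| <= M * `|x - y|.
Proof.
move=> df bf; suff h : forall x y, x <= y -> `|f y - f x| <= M * `|y - x|.
  move=> x y; have [xy|/ltW yx] := leP x y; last exact: h.
  by rewrite distrC (distrC x); exact: h.
move=> x y; rewrite le_eqVlt => /predU1P[->|xy].
  by rewrite !subrr normr0 mulr0.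
have [|c _ ->] := MVT_segment (ltW xy) (fun z _ => derivable_is_derive1 (df z)).
  apply: continuous_subspaceT => z; apply: differentiable_continuous.
  exact/derivable1_diffP.
by rewrite normrM ler_wpM2r.
Qed.

End SmoothFunctions.

(** * Integration on the circle *)

Section CircleIntegral.
Variable R : realType.
Implicit Types (f g h : R -> R) (x y l a b c M : R).
Local Notation mu := (@lebesgue_measure R).
Local Notation circ := (`[0%R, (2 * pi)%R]%classic : set R).

Lemma cvg_dist_le (u e : nat -> R) l : (forall n, `|u n - l| <= e n) ->
  e n @[n --> \oo] --> 0 -> u n @[n --> \oo] --> l.
Proof.
move=> ue e0; apply/cvgrPdist_le => d d0.
move/cvgrPdist_le : e0 => /(_ _ d0); apply: filterS => n.
rewrite sub0r normrN => h; rewrite distrC (le_trans (ue n))//.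
exact: le_trans (ler_norm _) h.
Qed.

Lemma twopi_gt0 : 0 < 2 * pi :> R.
Proof. by rewrite mulr_gt0// pi_gt0. Qed.

Lemma twopi_ge0 : 0 <= 2 * pi :> R.
Proof. exact/ltW/twopi_gt0. Qed.

Lemma lebesgue_circ : mu circ = (2 * pi)%:E.
Proof. by rewrite lebesgue_measure_itv/= lte_fin twopi_gt0 oppr0 adde0. Qed.

Variant Intg f : Prop := MkIntg of mu.-integrable circ (EFin \o f).

Lemma IntgE f : Intg f -> mu.-integrable circ (EFin \o f).
Proof. by case. Qed.

Lemma Intg_measurable f : Intg f -> measurable_fun circ f.
Proof. by case=> /integrableP[/measurable_EFinP]. Qed.

Lemma continuous_measurable_circ f : continuous f -> measurable_fun circ f.
Proof.
move=> cf; apply: measurable_funTS; exact: continuous_measurable_fun.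
Qed.

Lemma continuous_bounded_circ f : continuous f ->
  exists M, forall x, circ x -> `|f x| <= M.
Proof.
move=> cf.
have cf' : {within `[0, 2 * pi], continuous (fun x => `|f x|)}.
  apply: continuous_subspaceT => x; apply: continuous_comp; first exact: cf.
  exact: norm_continuous.
by have [c _ hc] := EVT_max twopi_ge0 cf'; exists `|f c| => x /hc.
Qed.

Lemma Intg_bounded f M : measurable_fun circ f ->
  (forall x, circ x -> `|f x| <= M) -> Intg f.
Proof.
move=> mf bf; split; apply: measurable_bounded_integrable => //.
  by rewrite [X in (X < _)%E]lebesgue_circ ltry.
exists M; split; first exact: num_real.
by move=> N MN x cx /=; exact: le_trans (bf _ cx) (ltW MN).
Qed.

Lemma Intg_continuous f : continuous f -> Intg f.
Proof.
move=> cf; have [M hM] := continuous_bounded_circ cf.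
exact: Intg_bounded (continuous_measurable_circ cf) hM.
Qed.

Lemma Intg_le f g : measurable_fun circ f ->
  (forall x, circ x -> `|f x| <= `|g x|) -> Intg g -> Intg f.
Proof.
move=> mf fg [ig]; split; apply: le_integrable ig => //.
by apply/measurable_EFinP.
Qed.

Lemma Intg_add f g : Intg f -> Intg g -> Intg (fun x => f x + g x).
Proof. by move=> [hf] [hg]; split; exact: (integrableD _ hf hg). Qed.

Lemma Intg_scale c f : Intg f -> Intg (fun x => c * f x).
Proof. by move=> [hf]; split; exact: (integrableZl _ c hf). Qed.

Lemma Intg_opp f : Intg f -> Intg (fun x => - f x).
Proof. by move=> [hf]; split; exact: (integrableN hf). Qed.

Lemma Intg_sub f g : Intg f -> Intg g -> Intg (fun x => f x - g x).
Proof. by move=> hf hg; apply: Intg_add => //; exact: Intg_opp. Qed.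

Lemma Intg_norm f : Intg f -> Intg (fun x => `|f x|).
Proof. by move=> [hf]; split; exact: (integrable_norm hf). Qed.

Lemma Intg_cst c : Intg (fun=> c).
Proof. by apply: Intg_continuous => x; exact: cst_continuous. Qed.

Lemma Intg_sum (I : Type) (r : seq I) (F : I -> R -> R) :
  (forall i, Intg (F i)) -> Intg (fun x => \sum_(i <- r) F i x).
Proof.
move=> h; elim: r => [|a r IH].
  by under eq_fun do rewrite big_nil; exact: Intg_cst.
by under eq_fun do rewrite big_cons; exact: Intg_add.
Qed.

Lemma Intg_mul_bounded f g M : Intg f -> measurable_fun circ g ->
  (forall x, circ x -> `|g x| <= M) -> Intg (fun x => f x * g x).
Proof.
move=> hf mg bg; apply: (@Intg_le _ (fun x => M * f x)).
- by apply: measurable_funM => //; exact: Intg_measurable.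
- move=> x cx; rewrite !normrM mulrC ler_wpM2r//.
  exact: le_trans (bg x cx) (ler_norm _).
- exact: Intg_scale.
Qed.

Lemma Intg_mul_continuous f g : Intg f -> continuous g ->
  Intg (fun x => f x * g x).
Proof.
move=> hf cg; have [M hM] := continuous_bounded_circ cg.
exact: Intg_mul_bounded hf (continuous_measurable_circ cg) hM.
Qed.

Lemma intcirc_add f g : Intg f -> Intg g ->
  intcirc (fun x => f x + g x) = intcirc f + intcirc g.
Proof. by move=> [hf] [hg]; exact: RintegralD. Qed.

Lemma intcirc_sub f g : Intg f -> Intg g ->
  intcirc (fun x => f x - g x) = intcirc f - intcirc g.
Proof. by move=> [hf] [hg]; exact: RintegralB. Qed.

Lemma intcirc_scale c f : Intg f ->
  intcirc (fun x => c * f x) = c * intcirc f.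
Proof. by move=> [hf]; exact: RintegralZl. Qed.

Lemma intcirc_opp f : Intg f -> intcirc (fun x => - f x) = - intcirc f.
Proof.
move=> hf; under eq_fun do rewrite -mulN1r.
by rewrite intcirc_scale// mulN1r.
Qed.

Lemma intcirc_cst c : intcirc (fun=> c) = c * (2 * pi).
Proof. by rewrite /intcirc Rintegral_cst// [X in fine X]lebesgue_circ. Qed.

Lemma intcirc_sum (I : Type) (r : seq I) (F : I -> R -> R) :
  (forall i, Intg (F i)) ->
  intcirc (fun x => \sum_(i <- r) F i x) = \sum_(i <- r) intcirc (F i).
Proof.
move=> h; elim: r => [|a r IH].
  by under eq_fun do rewrite big_nil; rewrite big_nil intcirc_cst mul0r.
under eq_fun do rewrite big_cons.
by rewrite big_cons -IH intcirc_add//; exact: Intg_sum.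
Qed.

Lemma eq_intcirc f g : (forall x, circ x -> f x = g x) -> intcirc f = intcirc g.
Proof. by move=> fg; apply: eq_Rintegral => x; rewrite inE => /fg. Qed.

Lemma intcirc_le f g : Intg f -> Intg g -> (forall x, circ x -> f x <= g x) ->
  intcirc f <= intcirc g.
Proof. by move=> [hf] [hg] fg; exact: le_Rintegral. Qed.

Lemma intcirc_ge0 f : (forall x, circ x -> 0 <= f x) -> 0 <= intcirc f.
Proof. by move=> f0; apply: Rintegral_ge0. Qed.

Lemma intcirc_norm_le f : Intg f -> `|intcirc f| <= intcirc (fun x => `|f x|).
Proof. by move=> [hf]; exact: le_normr_Rintegral. Qed.

Lemma intcirc_mul_le f g M : Intg f -> measurable_fun circ g ->
  (forall x, circ x -> `|g x| <= M) ->
  `|intcirc (fun x => f x * g x)| <= intcirc (fun x => `|f x|) * M.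
Proof.
move=> hf mg bg; have hfg := Intg_mul_bounded hf mg bg.
rewrite (le_trans (intcirc_norm_le hfg))// mulrC -intcirc_scale; last exact: Intg_norm.
apply: intcirc_le; [exact: Intg_norm|exact/Intg_scale/Intg_norm|].
by move=> x cx; rewrite normrM mulrC ler_wpM2r// bg.
Qed.

Lemma intcirc_bounded_le f M : Intg f -> (forall x, circ x -> `|f x| <= M) ->
  `|intcirc f| <= M * (2 * pi).
Proof.
move=> hf bf; rewrite (le_trans (intcirc_norm_le hf))// -intcirc_cst.
by apply: intcirc_le => //; [exact: Intg_norm|exact: Intg_cst].
Qed.

Lemma intcirc_dominated (fn : nat -> R -> R) f g :
  (forall n, measurable_fun circ (fn n)) ->
  (forall x, circ x -> fn n x @[n --> \oo] --> f x) ->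
  Intg g -> (forall n x, circ x -> `|fn n x| <= g x) ->
  intcirc (fn n) @[n --> \oo] --> intcirc f.
Proof.
move=> mfn fnf [ig] fng.
have mf : measurable_fun circ f by exact: measurable_fun_cvg mfn fnf.
have h0 : {ae mu, forall x, circ x ->
    (EFin \o fn n) x @[n --> \oo] --> (EFin \o f) x}.
  apply: aeW => x cx; apply: cvg_comp (fnf x cx) _; exact: cvg_refl.
have h1 : {ae mu, forall x n, circ x -> (`|(EFin \o fn n) x| <= (EFin \o g) x)%E}.
  by apply: aeW => x n cx; rewrite /= lee_fin; exact: fng.
have mfnE n : measurable_fun circ (EFin \o fn n) by exact/measurable_EFinP.
have mfE : measurable_fun circ (EFin \o f) by exact/measurable_EFinP.
have [i _ h2] := @dominated_convergence _ _ _ mu _ (measurable_itv _) _ _ _ mfnE mfE h0 ig h1.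
by apply: fine_cvg; rewrite fineK//; exact: integrable_fin_num.
Qed.

Lemma intcirc_uniform_cvg (fn : nat -> R -> R) f (e : nat -> R) :
  (forall n, Intg (fn n)) -> Intg f ->
  (forall n x, circ x -> `|fn n x - f x| <= e n) -> e n @[n --> \oo] --> 0 ->
  intcirc (fn n) @[n --> \oo] --> intcirc f.
Proof.
move=> hfn hf he e0; apply: (@cvg_dist_le _ (fun n => e n * (2 * pi))) => [n|].
  rewrite -intcirc_sub//.
  by apply: intcirc_bounded_le; [exact: Intg_sub|exact: he].
by rewrite -(mul0r (2 * pi)); apply: cvgMl.
Qed.

Lemma SmoothS_continuous f : SmoothS f -> continuous f.
Proof. by case=> _; exact: smooth_continuous. Qed.

Lemma SmoothS_Intg f : SmoothS f -> Intg f.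
Proof. by move=> /SmoothS_continuous; exact: Intg_continuous. Qed.

Lemma intcirc_derive1 f : SmoothS f -> intcirc (derive1 f) = 0.
Proof.
move=> sf; have [pf smf] := sf.
rewrite /intcirc /Rintegral (@continuous_FTC2 _ _ f) ?twopi_gt0//.
- by have := pf 0; rewrite add0r => ->; rewrite subee.
- by apply: continuous_subspaceT; exact/SmoothS_continuous/smoothS_derive1.
- split.
  + by move=> x _; exact: smooth_derivable.
  + by apply: cvg_at_right_filter; exact: SmoothS_continuous.
  + by apply: cvg_at_left_filter; exact: SmoothS_continuous.
Qed.

Lemma intcirc_parts f g : SmoothS f -> SmoothS g ->
  intcirc (fun x => derive1 f x * g x) = - intcirc (fun x => f x * derive1 g x).
Proof.
move=> sf sg; apply/eqP; rewrite -subr_eq0 opprK; apply/eqP.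
have [_ mf] := sf; have [_ mg] := sg.
rewrite -intcirc_add.
- rewrite -[RHS](intcirc_derive1 (smoothS_mul sf sg)).
  by rewrite derive1_mulE.
- by apply/SmoothS_Intg/smoothS_mul => //; exact: smoothS_derive1.
- by apply/SmoothS_Intg/smoothS_mul => //; exact: smoothS_derive1.
Qed.

Lemma L2S_Intg_sqr f : L2S f -> Intg (fun x => f x ^+ 2).
Proof.
move=> [_ mf f2]; split; apply/integrableP; split.
  by apply/measurable_EFinP/measurable_funX/measurable_funTS.
by under eq_integral do rewrite /= ger0_norm ?sqr_ge0//.
Qed.

Lemma L2S_measurable f : L2S f -> measurable_fun circ f.
Proof. by move=> [_ mf _]; exact: measurable_funTS. Qed.

Lemma L2S_Intg_mul f g : L2S f -> L2S g -> Intg (fun x => f x * g x).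
Proof.
move=> hf hg; apply: (@Intg_le _ (fun x => f x ^+ 2 + g x ^+ 2)).
- by apply: measurable_funM; exact: L2S_measurable.
- move=> x _; rewrite [leRHS]ger0_norm ?addr_ge0 ?sqr_ge0//.
  by rewrite ler_norml; apply/andP; split; nra.
- by apply: Intg_add; exact: L2S_Intg_sqr.
Qed.

Lemma L2S_intro f : periodicS f -> measurable_fun setT f ->
  Intg (fun x => f x ^+ 2) -> L2S f.
Proof.
move=> pf mf [/integrableP[_ h]]; split => //; move: h.
by under eq_integral do rewrite /= ger0_norm ?sqr_ge0//.
Qed.

Lemma SmoothS_L2S f : SmoothS f -> L2S f.
Proof.
move=> sf; have [pf _] := sf; apply: L2S_intro => //.
  by apply: continuous_measurable_fun; exact: SmoothS_continuous.
by apply: SmoothS_Intg; exact: smoothS_mul.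
Qed.

Lemma L2S_Intg f : L2S f -> Intg f.
Proof.
move=> hf; have := L2S_Intg_mul hf (SmoothS_L2S (smoothS_cst 1)).
by under eq_fun do rewrite mulr1.
Qed.

Lemma L2S_add f g : L2S f -> L2S g -> L2S (fun x => f x + g x).
Proof.
move=> hf hg; have [pf mf _] := hf; have [pg mg _] := hg; apply: L2S_intro.
- by move=> x; rewrite pf pg.
- exact: measurable_funD.
- under eq_fun do rewrite sqrrD.
  apply: Intg_add; last exact: L2S_Intg_sqr.
  apply: Intg_add; first exact: L2S_Intg_sqr.
  by under eq_fun do rewrite -mulr_natl; exact/Intg_scale/L2S_Intg_mul.
Qed.

Lemma L2S_scale c f : L2S f -> L2S (fun x => c * f x).
Proof.
move=> hf; have [pf mf _] := hf; apply: L2S_intro.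
- by move=> x; rewrite pf.
- exact: measurable_funM.
- by under eq_fun do rewrite exprMn; exact/Intg_scale/L2S_Intg_sqr.
Qed.

Lemma L2S_sub f g : L2S f -> L2S g -> L2S (fun x => f x - g x).
Proof.
move=> hf hg; under eq_fun do rewrite -[- g _]mulN1r.
by apply: L2S_add => //; exact: L2S_scale.
Qed.

(** The integral of [(f + t g)^2] is a nonnegative quadratic polynomial in [t], evaluated at its
    minimum [- C / B]. If [B = 0] it is affine, which forces [C = 0]. *)
Lemma intcirc_CauchySchwarz f g : L2S f -> L2S g ->
  intcirc (fun x => f x * g x) ^+ 2 <=
  intcirc (fun x => f x ^+ 2) * intcirc (fun x => g x ^+ 2).
Proof.
move=> hf hg.
have hff := L2S_Intg_sqr hf; have hgg := L2S_Intg_sqr hg.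
have hfg := L2S_Intg_mul hf hg.
set A := intcirc (fun x => f x ^+ 2); set B := intcirc (fun x => g x ^+ 2).
set C := intcirc _.
have quad t : 0 <= A + 2 * t * C + t ^+ 2 * B.
  rewrite -!intcirc_scale// -!intcirc_add//; do ?[exact: hff|exact: hgg|exact: hfg|exact: Intg_scale|apply: Intg_add].
  by apply: intcirc_ge0 => x _; have := sqr_ge0 (f x + t * g x); nra.
have A0 : 0 <= A by apply: intcirc_ge0 => x _; exact: sqr_ge0.
have B0 : 0 <= B by apply: intcirc_ge0 => x _; exact: sqr_ge0.
have [B1|] := ltP 0 B; last first.
  move=> B1; have {B0 B1} B0 : B = 0 by apply/eqP; rewrite eq_le B0 B1.
  have h t : 0 <= A + 2 * t * C by have := quad t; rewrite B0; lra.
  rewrite B0 mulr0; have [->|C0] := eqVneq C 0; first by rewrite expr0n.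
  (* At this [t] the affine function takes the value -1. *)
  have := h (- (A + 1) / (2 * C)).
  have -> : A + 2 * (- (A + 1) / (2 * C)) * C = -1 by field; rewrite C0.
  by rewrite lerNr oppr0 ler10.
have := quad (- C / B).
have -> : A + 2 * (- C / B) * C + (- C / B) ^+ 2 * B = A - C ^+ 2 / B.
  by field; rewrite gt_eqF.
by rewrite subr_ge0 ler_pdivrMr.
Qed.

End CircleIntegral.

(** * Trigonometric series *)

Section TrigonometricSeries.
Variable R : realType.
Implicit Types (f g h : R -> R) (x y th eta c M K : R) (a b : nat -> R) (N P k : nat)
  (n : int).

(** With a free phase, one family contains the cosines ([th = 0]) and the sines ([th = pi / 2]);
    differentiation shifts the phase, and products are sums of two members. *)
Definition trig n th : R -> R := fun x => cos (n%:~R * x - th).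

Lemma trig_periodic n th : periodicS (trig n th).
Proof.
move=> x; rewrite /trig mulrDr -addrA (addrC _ (- th)) addrA.
have pc : periodicS (fun y : R => cos y).
  by move=> y; rewrite mulr_natl cosD2pi.
exact: (periodicS_int n _ pc).
Qed.

Lemma SmoothS_trig n th : SmoothS (trig n th).
Proof.
split; first exact: trig_periodic.
apply: elementary_smooth.
apply: (Elem_comp (f := fun y => cos y)); first exact: Elem_cos.
apply: Elem_add; last exact: Elem_cst.
by apply: Elem_mul; [exact: Elem_cst|exact: Elem_id].
Qed.

Lemma trig_le1 n th x : `|trig n th x| <= 1.
Proof. exact: cos_max. Qed.

Lemma is_derive_trig n th x :
  is_derive x 1 (trig n th) (- n%:~R * trig n (th + pi / 2) x).
Proof.
rewrite /trig opprD addrA cosBpihalf mulNr mulrC -mulNr.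
apply: (@realfun.is_derive1_comp _ cos (fun x => n%:~R * x - th)).
have /is_derive_eq := is_deriveB (is_deriveZ n%:~R (is_derive_id x (1 : R)))
  (is_derive_cst th x (1 : R)).
by apply; rewrite subr0 -[LHS]/(_ * _) mulr1.
Qed.

Lemma derive1_trig n th :
  derive1 (trig n th) = fun x => - n%:~R * trig n (th + pi / 2) x.
Proof. by apply: derive1_funE => x; exact: is_derive_trig. Qed.

Lemma trigDpi n th x : trig n (th + pi) x = - trig n th x.
Proof. by rewrite /trig opprD addrA -[LHS]opprK -cosDpi subrK. Qed.

Lemma trigN n th x : trig (- n) th x = trig n (- th) x.
Proof. by rewrite /trig -cosN mulrNz; congr cos; ring. Qed.

Lemma trigM n n' th eta x : trig n th x * trig n' eta x =
  2^-1 * (trig (n' - n) (eta - th) x + trig (n' + n) (eta + th) x).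
Proof.
rewrite /trig.
have -> : (n' - n)%:~R * x - (eta - th) = (n'%:~R * x - eta) - (n%:~R * x - th).
  by rewrite intrB; ring.
have -> : (n' + n)%:~R * x - (eta + th) = (n'%:~R * x - eta) + (n%:~R * x - th).
  by rewrite intrD; ring.
by move: (_ - th) (_ - eta) => p q; rewrite cosB cosD; field.
Qed.

Lemma trig_split n th x :
  trig n th x = cos th * trig n 0 x + sin th * trig n (pi / 2) x.
Proof. by rewrite /trig subr0 cosBpihalf cosB; ring. Qed.

Lemma intcirc_trig n th : intcirc (trig n th) =
  if n == 0 then 2 * pi * cos th else 0.
Proof.
have [->|n0] := eqVneq n 0.
  have -> : trig 0 th = fun=> cos th.
    by apply/funext => x; rewrite /trig mul0r sub0r cosN.
  by rewrite intcirc_cst mulrC.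
have -> : trig n th = fun x => n%:~R^-1 * derive1 (trig n (th + pi / 2)) x.
  apply/funext => x; rewrite derive1_trig mulrA mulrN mulVf ?intr_eq0// mulN1r.
  by rewrite -addrA -splitr trigDpi opprK.
rewrite intcirc_scale; last exact/SmoothS_Intg/smoothS_derive1/SmoothS_trig.
by rewrite intcirc_derive1 ?mulr0//; exact: SmoothS_trig.
Qed.

Definition psum a b N : R -> R := fun x =>
  \sum_(k < N) (a k * trig k 0 x + b k * trig k (pi / 2) x).

Lemma SmoothS_psum a b N : SmoothS (psum a b N).
Proof.
apply: smoothS_sum => k.
by apply: smoothS_add; apply: smoothS_scale; exact: SmoothS_trig.
Qed.

Lemma derive1_psum a b N : derive1 (psum a b N) =
  psum (fun k => k%:R * b k) (fun k => - (k%:R * a k)) N.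
Proof.
apply: derive1_funE => x; rewrite /psum.
elim: N => [|N IH].
  by under eq_fun do rewrite big_ord0; rewrite big_ord0; exact: is_derive_cst.
under eq_fun do rewrite big_ord_recr/=.
rewrite big_ord_recr/=; apply: is_deriveD.
have /is_derive_eq := is_deriveD (is_deriveZ (a N) (is_derive_trig N 0 x))
  (is_deriveZ (b N) (is_derive_trig N (pi / 2) x)).
apply; rewrite -splitr add0r -[pi]add0r trigDpi.
by rewrite -![_ *: _]/(_ * _) -pmulrn; ring.
Qed.

(* [1/(k+1)^2 <= 2(1/(k+1) - 1/(k+2))], and the right-hand side telescopes. *)
Lemma sum_inv_sqr N P : (N <= P)%N ->
  \sum_(N <= k < P) (k.+1%:R ^+ 2)^-1 <= 2 / N.+1%:R :> R.
Proof.
move=> NP; suff h : \sum_(N <= k < P) (k.+1%:R ^+ 2)^-1 <=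
    2 * (N.+1%:R^-1 - P.+1%:R^-1) :> R.
  by rewrite (le_trans h)// ler_wpM2l// gerBl invr_ge0.
elim: P NP => [|P IH]; first by rewrite leqn0 => /eqP ->; rewrite big_geq// subrr mulr0.
rewrite leq_eqVlt => /predU1P[->|]; first by rewrite big_geq// subrr mulr0.
rewrite ltnS => NP; rewrite big_nat_recr//=.
have P0 : 0 < P.+1%:R :> R by rewrite ltr0n.
have P1 : P.+2%:R = P.+1%:R + 1 :> R by rewrite -natr1.
have h : (P.+1%:R ^+ 2)^-1 <= 2 * (P.+1%:R^-1 - P.+2%:R^-1) :> R.
  rewrite P1; have -> : 2 * (P.+1%:R^-1 - (P.+1%:R + 1)^-1) =
     2 / (P.+1%:R * (P.+1%:R + 1)) :> R.
    by field; rewrite !gt_eqF//; lra.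
  have P11 : 1 <= P.+1%:R :> R by rewrite ler1n.
  rewrite ler_pdivlMr; last by nra.
  rewrite mulrC ler_pdivrMr; last by nra.
  by nra.
by rewrite (le_trans (lerD (IH NP) h))// -mulrDr addrA subrK.
Qed.

(** By [sum_inv_sqr], this rate makes the tail of the series after [N] at most [2 * M / N.+1%:R],
    uniformly in [x]. *)
Definition decay2 a b M := forall k, `|a k| + `|b k| <= M / k.+1%:R ^+ 2.

Lemma decay2_ge0 a b M : decay2 a b M -> 0 <= M.
Proof.
move=> /(_ 0%N); rewrite expr1n divr1; apply: le_trans.
exact: addr_ge0.
Qed.

Lemma psum_cauchy a b M N P x : decay2 a b M -> (N <= P)%N ->
  `|psum a b P x - psum a b N x| <= 2 * M / N.+1%:R.
Proof.
move=> hM NP; rewrite /psum -!(big_mkord xpredT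
  (fun k => a k * trig k 0 x + b k * trig k (pi / 2) x)).
rewrite (big_cat_nat (leq0n N) NP)/= addrAC subrr add0r.
rewrite (le_trans (ler_norm_sum _ _ _))//.
apply: (@le_trans _ _ (\sum_(N <= k < P) M * (k.+1%:R ^+ 2)^-1)).
  apply: ler_sum => k _; apply: le_trans (hM k).
  rewrite (le_trans (ler_normD _ _))// !normrM lerD//.
    by rewrite ler_piMr// trig_le1.
  by rewrite ler_piMr// trig_le1.
rewrite -mulr_sumr (_ : 2 * M / N.+1%:R = M * (2 / N.+1%:R)); last by rewrite mulrCA mulrA.
by rewrite ler_wpM2l ?(decay2_ge0 hM)//; exact: sum_inv_sqr.
Qed.

Definition tsum a b : R -> R := fun x => lim (psum a b N x @[N --> \oo]).

Lemma cvg_harm2 M : 2 * M / N.+1%:R @[N --> \oo] --> (0 : R).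
Proof.
rewrite -(mulr0 (2 * M)); apply: cvgMr.
exact: cvg_harmonic.
Qed.

Lemma cvgn_le (u : nat -> R) (l c : R) : u n @[n --> \oo] --> l ->
  (\forall n \near \oo, u n <= c) -> l <= c.
Proof.
move=> ul uc; rewrite -(cvg_lim _ ul)//.
by apply: limr_le uc; apply: cvgP ul.
Qed.

Lemma cvg_of_modulus (u e : nat -> R) :
  (forall N P, (N <= P)%N -> `|u P - u N| <= e N) ->
  e N @[N --> \oo] --> 0 ->
  u N @[N --> \oo] --> lim (u N @[N --> \oo]) /\
  forall N, `|u N - lim (u N @[N --> \oo])| <= e N.
Proof.
move=> ue e0; have cu : u N @[N --> \oo] --> lim (u N @[N --> \oo]).
  apply/cauchy_cvgP/cauchy_exP => d d0.
  have /cvgrPdist_lt /(_ _ d0) [N0 _ hN0] := e0; exists (u N0).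
  exists N0 => // P /= NP; rewrite /ball/= distrC (le_lt_trans (ue N0 P NP))//.
  by have := hN0 N0 (leqnn N0); rewrite /= sub0r normrN; apply: le_lt_trans; exact: ler_norm.
split=> // N; rewrite distrC.
have h : `|u P - u N| @[P --> \oo] --> `|lim (u N @[N --> \oo]) - u N|.
  by apply: cvg_norm; apply: cvgB => //; exact: cvg_cst.
apply: cvgn_le h _; near=> P; apply: ue; near: P; exact: nbhs_infty_ge.
Unshelve. all: by end_near. Qed.

Lemma psum_cvg a b M x : decay2 a b M ->
  psum a b N x @[N --> \oo] --> tsum a b x /\
  forall N, `|psum a b N x - tsum a b x| <= 2 * M / N.+1%:R.
Proof.
move=> hM; apply: (@cvg_of_modulus (fun N => psum a b N x)
  (fun N => 2 * M / N.+1%:R)); last exact: cvg_harm2.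
by move=> N P NP; exact: psum_cauchy.
Qed.

(** A quadratic remainder bound survives pointwise limits and integration, so this criterion
    differentiates series and integrals without exchanging a limit and a derivative. *)
Lemma quadratic_is_derive f x (l K : R) :
  (forall y, `|f y - f x - (y - x) * l| <= K * (y - x) ^+ 2) ->
  is_derive x 1 f l.
Proof.
move=> h.
suff lim_l : h0^-1 *: (f (h0 *: (1 : R) + x) - f x) @[h0 --> (0 : R)^'] --> l.
  by apply: DeriveDef; [exact: cvgP lim_l|exact: cvg_lim lim_l].
have K0 : 0 <= `|K| + 1 by rewrite addr_ge0.
apply/cvgrPdist_le => e e0.
have d0 : 0 < e / (`|K| + 1) by rewrite divr_gt0// ltr_wpDl.
near=> z.
have z0 : z != 0 by near: z; exact: nbhs_dnbhs_neq.
rewrite -[_ *: (1 : R)]/(_ * _) mulr1 -[_ *: _]/(_ * _).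
have -> : l - z^-1 * (f (z + x) - f x) = - z^-1 * (f (z + x) - f x - (z + x - x) * l).
  by field.
rewrite normrM normrN normfV ler_pdivrMl ?normr_gt0//.
rewrite (le_trans (h _))// addrK -real_normK ?num_real// expr2 mulrCA.
rewrite ler_wpM2l// (@le_trans _ _ ((`|K| + 1) * `|z|))//.
  by rewrite ler_wpM2r// (le_trans (ler_norm _))// lerDl.
rewrite mulrC -ler_pdivlMr; last by rewrite ltr_wpDl.
by near: z; exact: dnbhs0_le.
Unshelve. all: by end_near. Qed.

Lemma MVT_between f (df : R -> R) : (forall z : R, is_derive z 1 f (df z)) ->
  forall x y : R, exists2 c : R, `|c - x| <= `|y - x| & f y - f x = df c * (y - x).
Proof.
move=> h x y.
have cf : continuous f.
  move=> z; apply: differentiable_continuous.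
  by apply/derivable1_diffP; exact: is_derive1_derivable (h z).
have [xy|/ltW yx] := leP x y.
  have [c] := MVT_segment xy (fun z _ => h z) (continuous_subspaceT cf).
  rewrite in_itv/= => /andP[xc cy] fE; exists c => //.
  by rewrite !ger0_norm ?subr_ge0// lerB.
have [c] := MVT_segment yx (fun z _ => h z) (continuous_subspaceT cf).
rewrite in_itv/= => /andP[yc cx] fE; exists c.
  by rewrite !ler0_norm ?subr_le0// !opprB lerB.
by rewrite -opprB fE -mulrN opprB.
Qed.

Lemma taylor_bound f (df : R -> R) K : (forall z : R, is_derive z 1 f (df z)) ->
  forall x y, (forall z, `|df z - df x| <= K * `|z - x|) ->
  `|f y - f x - (y - x) * df x| <= K * (y - x) ^+ 2.
Proof.
move=> h x y hK; have [c cxy ->] := MVT_between h x y.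
(* The hypothesis at distance 1 from [x] forces [K >= 0]. *)
have K0 : 0 <= K by have := le_trans (normr_ge0 _) (hK (x + 1)); rewrite addrC addKr normr1 mulr1.
rewrite mulrC -mulrBr normrM mulrC -real_normK ?num_real// expr2 mulrA.
by rewrite ler_wpM2r// (le_trans (hK c))// ler_wpM2l.
Qed.

Lemma decay2_le a b a' b' M : (forall k, `|a' k| + `|b' k| <= `|a k| + `|b k|) ->
  decay2 a b M -> decay2 a' b' M.
Proof. by move=> h hM k; exact: le_trans (h k) (hM k). Qed.

Definition mulk a k := k%:R * a k.

(** The second derivatives of all partial sums are bounded by [2 * M], so these satisfy one Taylor
    bound independent of [N], which passes to the limit. *)
Lemma is_derive_tsum a b M x : decay2 a b M -> decay2 (mulk a) (mulk b) M ->
  decay2 (mulk (mulk a)) (mulk (mulk b)) M ->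
  is_derive x 1 (tsum a b) (tsum (mulk b) (fun k => - mulk a k) x).
Proof.
move=> h0 h1 h2.
have h1' : decay2 (mulk b) (fun k => - mulk a k) M.
  by apply: decay2_le h1 => k; rewrite normrN addrC.
have h2' : decay2 (fun k => mulk (fun k => - mulk a k) k)
    (fun k => - mulk (mulk b) k) M.
  by apply: decay2_le h2 => k; rewrite normrN /mulk mulrN normrN.
apply: (@quadratic_is_derive _ _ _ (2 * M)) => y.
pose F N y := psum a b N y; pose G N y := psum (mulk b) (fun k => - mulk a k) N y.
have [c0 _] := psum_cvg y h0; have [c1 _] := psum_cvg x h0; have [c2 _] := psum_cvg x h1'.
have cv : `|F N y - F N x - (y - x) * G N x| @[N --> \oo] -->
    `|tsum a b y - tsum a b x - (y - x) * tsum (mulk b) (fun k => - mulk a k) x|.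
  by apply: cvg_norm; apply: cvgB; [exact: cvgB|exact: cvgMr].
apply: cvgn_le cv _; apply: nearW => N.
have dF (z : R) : is_derive z 1 (F N) (G N z).
  rewrite /F /G -derive1_psum; apply: smooth_is_derive.
  by have [] := SmoothS_psum a b N.
apply: (taylor_bound dF) => z; apply: MVT_bound => w.
  by apply: smooth_derivable; have [] := SmoothS_psum (mulk b) (fun k => - mulk a k) N.
rewrite derive1_psum.
have [_ /(_ N) hN] := psum_cvg w h2'.
(* Compared with the empty sum, the Cauchy estimate becomes a bound on the partial sum itself. *)
have := psum_cauchy w h2' (leq0n N).
by rewrite [psum _ _ 0 _]big_ord0 subr0 divr1.
Qed.

Definition rapid a := forall p, exists M, forall k, `|a k| * k.+1%:R ^+ p <= M.

Lemma rapid_mulk a : rapid a -> rapid (mulk a).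
Proof.
move=> ra p; have [M hM] := ra p.+1; exists M => k.
rewrite (le_trans _ (hM k))// normrM exprS (mulrC `|_|) -mulrA.
by rewrite ler_wpM2l// ler_wpM2r ?exprn_ge0// ger0_norm// ler_nat.
Qed.

Lemma rapidN a : rapid a -> rapid (fun k => - a k).
Proof. by move=> ra p; have [M hM] := ra p; exists M => k; rewrite normrN. Qed.

Lemma rapid_decay2 a b : rapid a -> rapid b -> exists M, decay2 a b M.
Proof.
move=> /(_ 2%N)[M hM] /(_ 2%N)[M' hM']; exists (M + M') => k.
by rewrite ler_pdivlMr ?exprn_gt0// mulrDl lerD.
Qed.

Lemma is_derive_tsum_rapid a b x : rapid a -> rapid b ->
  is_derive x 1 (tsum a b) (tsum (mulk b) (fun k => - mulk a k) x).
Proof.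
move=> ra rb; have [M h0] := rapid_decay2 ra rb.
have [M1 h1] := rapid_decay2 (rapid_mulk ra) (rapid_mulk rb).
have [M2 h2] := rapid_decay2 (rapid_mulk (rapid_mulk ra)) (rapid_mulk (rapid_mulk rb)).
have M0 := decay2_ge0 h0; have M10 := decay2_ge0 h1; have M20 := decay2_ge0 h2.
apply: (@is_derive_tsum _ _ (M + M1 + M2)) => k; last 1 first.
- by rewrite (le_trans (h2 k))// ler_wpM2r ?invr_ge0 ?exprn_ge0// lerDr addr_ge0.
- by rewrite (le_trans (h0 k))// ler_wpM2r ?invr_ge0 ?exprn_ge0// -addrA lerDl addr_ge0.
- by rewrite (le_trans (h1 k))// ler_wpM2r ?invr_ge0 ?exprn_ge0// addrAC lerDr addr_ge0.
Qed.

Lemma derive1_tsum a b : rapid a -> rapid b ->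
  derive1 (tsum a b) = tsum (mulk b) (fun k => - mulk a k).
Proof. by move=> ra rb; apply: derive1_funE => x; exact: is_derive_tsum_rapid. Qed.

Lemma SmoothS_tsum a b : rapid a -> rapid b -> SmoothS (tsum a b).
Proof.
move=> ra rb; split.
  move=> x; rewrite /tsum.
  have -> // : (fun N => psum a b N (x + 2 * pi)) = fun N => psum a b N x.
  by apply/funext => N; have [->] := SmoothS_psum a b N.
pose P f := exists a b, [/\ rapid a, rapid b & f = tsum a b].
suff : P (tsum a b) by apply: smooth_coind => f [{ra rb}a' [b' [ra rb ->]]]; split=> [x|];
  [exact: is_derive1_derivable (is_derive_tsum_rapid x ra rb)|
   rewrite derive1_tsum//; exists (mulk b'), (fun k => - mulk a' k); split=> //;
   [exact: rapid_mulk|exact/rapidN/rapid_mulk]].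
by exists a, b.
Qed.

(* Phases [th = 0] and [th = pi / 2] give the real and (minus) imaginary parts of
   [2 pi * fourier T n]; derivatives shift the phase by [pi / 2]. *)
Definition coef (T : distr R) th n : R := T (trig n th).

(** Orthogonality relations. The product contains only the frequencies [n - k] and [n + k]; both
    vanish when [n = k = 0], which explains the factor 2 and the missing sine part there. *)
Lemma trig_sqr_mul k n (th eta : R) : (0 <= n)%R ->
  intcirc (fun x => trig (Posz k) eta x * trig n th x) =
  if n == Posz k then (if k == 0%N then 2 else 1) * pi * cos eta * cos th
    + (if k == 0%N then 0 else pi * sin eta * sin th) else 0.
Proof.
move=> n0; under eq_fun do rewrite trigM.
rewrite intcirc_scale; last by apply: Intg_add; apply/SmoothS_Intg/SmoothS_trig.
rewrite intcirc_add; [|exact/SmoothS_Intg/SmoothS_trig..].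
rewrite !intcirc_trig subr_eq0.
have -> : (n + Posz k == 0) = (n == 0) && (k == 0%N) by lia.
have [->|] := eqVneq n (Posz k); last first.
  move=> nk; case: ifP => [/andP[/eqP n00 /eqP k0]|_]; last by rewrite addr0 mulr0.
  by move: nk; rewrite n00 k0 eqxx.
have -> : ((Posz k == 0) && (k == 0%N)) = (k == 0%N) by lia.
rewrite cosB cosD; case: ifP => _; by field.
Qed.

End TrigonometricSeries.

(** * Uniqueness of Fourier coefficients *)

Section FourierUniqueness.
Variable R : realType.
Implicit Types (f g h q : R -> R) (x y th eta c M : R) (n : int).
Local Notation mu := (@lebesgue_measure R).
Local Notation circ := (`[0%R, (2 * pi)%R]%classic : set R).

Lemma cvgr_sum (T : Type) (F : set_system T) {FF : Filter F} (I : Type) (r : seq I)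
    (u : I -> T -> R) (l : I -> R) : (forall i, u i t @[t --> F] --> l i) ->
  \sum_(i <- r) u i t @[t --> F] --> \sum_(i <- r) l i.
Proof.
move=> h; elim: r => [|i r IH].
  by under eq_fun do rewrite big_nil; rewrite big_nil; exact: cvg_cst.
by under eq_fun do rewrite big_cons; rewrite big_cons; exact: cvgD.
Qed.

Lemma continuous_exprn_comp g j : continuous g -> continuous (fun y => g y ^+ j).
Proof.
move=> cg y; elim: j => [|j IH]; first exact: cvg_cst.
under eq_fun do rewrite exprS.
exact: (@continuousM _ _ g (fun z => g z ^+ j) y (cg y) IH).
Qed.

Lemma continuous_expR_comp g : continuous g -> continuous (fun y => expR (g y)).
Proof.
move=> cg y; apply: (@continuous_comp _ _ _ g expR y); first exact: cg.
exact: continuous_expR.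
Qed.

Lemma series_exp_coeff_le (y : R) N : `|series (exp_coeff y) N| <= expR `|y|.
Proof.
have h : series (exp_coeff `|y|) N <= expR `|y|.
  apply: nondecreasing_cvgn_le; last exact: is_cvg_series_exp_coeff.
  by apply: nondecreasing_series => n _ _; exact: exp_coeff_ge0.
apply: le_trans h; rewrite -normed_series_exp_coeff /series/=.
exact: ler_norm_sum.
Qed.

(** The partial sums of the exponential series are polynomials in [q], dominated by [e^M] where [M]
    bounds [a * q] on the circle; dominated convergence carries the orthogonality to the limit. *)
Lemma orthogonal_expR h q : Intg h -> continuous q ->
  (forall j, intcirc (fun y => h y * q y ^+ j) = 0) ->
  forall a, intcirc (fun y => h y * expR (a * q y)) = 0.
Proof.
move=> hh cq hq a.
have cqa : continuous (fun y => a * q y) by move=> y; apply: cvgMr; exact: cq.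
have [M hM] := continuous_bounded_circ cqa.
pose fn N y := h y * series (exp_coeff (a * q y)) N.
have cj j : continuous (fun y => exp_coeff (a * q y) j).
  rewrite (_ : (fun y => _) = fun y => (a * q y) ^+ j * j`!%:R^-1)// => y.
  apply: (@continuousM _ _ (fun y => (a * q y) ^+ j) (fun=> j`!%:R^-1) y).
    exact: (@continuous_exprn_comp _ j cqa y).
  exact: cvg_cst.
have cfn N : continuous (fun y => series (exp_coeff (a * q y)) N).
  by move=> y; rewrite /series/=; apply: cvgr_sum => j; exact: cj.
have fn0 N : intcirc (fn N) = 0.
  rewrite /fn; under eq_fun do rewrite /series/= mulr_sumr.
  rewrite intcirc_sum; last first.
    by move=> j; apply: Intg_mul_continuous => //; exact: cj.
  rewrite big1_seq// => j _.
  rewrite (_ : (fun y => _) = fun y => a ^+ j / j`!%:R * (h y * q y ^+ j)).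
    rewrite intcirc_scale ?hq ?mulr0//.
    by apply: Intg_mul_continuous => //; exact: continuous_exprn_comp.
  by apply/funext => y; rewrite /exp_coeff/= exprMn; ring.
have cv : intcirc (fn N) @[N --> \oo] -->
    intcirc (fun y => h y * expR (a * q y)).
  apply: (@intcirc_dominated _ _ _ (fun y => `|h y| * expR M)).
  - move=> N; apply: Intg_measurable; exact: Intg_mul_continuous.
  - move=> y _; apply: cvgMr; rewrite /expR; exact: is_cvg_series_exp_coeff.
  - under eq_fun do rewrite mulrC; exact/Intg_scale/Intg_norm.
  - move=> N y cy; rewrite /fn normrM ler_wpM2l//.
    by rewrite (le_trans (series_exp_coeff_le _ _))// ler_expR hM.
rewrite -(cvg_lim _ cv)//; under eq_fun do rewrite fn0.
exact: lim_cst.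
Qed.

Variables (h : R -> R) (ih : Intg h).
Hypothesis h0 : forall n th, intcirc (fun y => h y * trig n th y) = 0.

(** Orthogonality of [h] to all products of [g] with trigonometric functions, rather than to [g]
    alone: this is what is preserved when [g] is multiplied by a trigonometric factor. *)
Let orth g := continuous g /\
  forall n th, intcirc (fun y => h y * g y * trig n th y) = 0.

Let trig_continuous n th : continuous (@trig R n th).
Proof. by apply: SmoothS_continuous; exact: SmoothS_trig. Qed.

Let orth_step g eta c : orth g -> orth (fun y => g y * (trig 1 eta y - c)).
Proof.
move=> [cg hg]; have ig : Intg (fun y => h y * g y) by exact: Intg_mul_continuous.
have igt n th : Intg (fun y => h y * g y * trig n th y).
  exact: Intg_mul_continuous.
split=> [y|n th].
  by apply: cvgM; [exact: cg|apply: cvgB; [exact: trig_continuous|exact: cvg_cst]].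
rewrite (_ : (fun y => _) = fun y => 2^-1 *
    (h y * g y * trig (n - 1) (th - eta) y + h y * g y * trig (n + 1) (th + eta) y)
    + (- c) * (h y * g y * trig n th y)).
  rewrite intcirc_add; [|exact/Intg_scale/Intg_add|exact: Intg_scale].
  rewrite !intcirc_scale//; last exact: Intg_add.
  by rewrite intcirc_add// !hg; ring.
apply/funext => y; have := trigM 1 n eta th y.
move=> e.
transitivity (h y * g y * (trig 1 eta y * trig n th y) - c * (h y * g y * trig n th y)).
  by ring.
by rewrite e; ring.
Qed.

Let orth_pow eta c j : orth (fun y => (trig 1 eta y - c) ^+ j).
Proof.
elim: j => [|j IH].
  split=> [y|n th]; first exact: cvg_cst.
  by rewrite -[RHS](h0 n th); congr intcirc; apply/funext => y; rewrite mulr1.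
by under eq_fun do rewrite exprSr; exact: orth_step.
Qed.

(** [orthogonal_expR] applied twice, with [q] the difference [trig 1 eta - c]: the powers of
    [expR (- M * q)] are exponentials of multiples of [q], orthogonal to [h] because the powers of
    [q] are. *)
Let orth_expexp eta c M :
  intcirc (fun y => h y * expR (- expR (- M * (trig 1 eta y - c)))) = 0.
Proof.
have cq : continuous (fun y => trig 1 eta y - c).
  by move=> y; apply: cvgB; [exact: trig_continuous|exact: cvg_cst].
have hq j : intcirc (fun y => h y * (trig 1 eta y - c) ^+ j) = 0.
  have [_ /(_ 0 0) <-] := orth_pow eta c j; congr intcirc; apply/funext => y.
  by rewrite /trig mul0r subr0 cos0 mulr1.
have cexp : continuous (fun y => expR (- M * (trig 1 eta y - c))).
  by apply: continuous_expR_comp => y; apply: cvgMr; exact: cq.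
have := @orthogonal_expR h _ ih cexp _ (-1).
under eq_fun do rewrite mulN1r; apply => j.
have := orthogonal_expR ih cq hq (j%:R * - M).
by under eq_fun do rewrite -mulrA expRM_natl.
Qed.

(* [q > 0] exactly on ]0, x[ (in [0, 2 pi]), so [exp (- exp (- N q))] tends to
   the indicator of [0, x]; it is a limit of polynomials in [q]. *)
Lemma orthogonal_integral_eq0 x : 0 < x < 2 * pi ->
  \int[mu]_(y in `[0, x]) (h \_ circ) y = 0.
Proof.
move=> /andP[x0 x2].
pose q y := trig 1 (x / 2) y - cos (x / 2).
(* For [0 < y < 2 * pi] the first sine is positive and the second has the sign of [x - y]. *)
have qE y : q y = 2 * sin (y / 2) * sin ((x - y) / 2).
  rewrite /q /trig mul1r.
  have -> : y - x / 2 = y / 2 - (x - y) / 2 by field.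
  have -> : x / 2 = y / 2 + (x - y) / 2 by field.
  by rewrite cosB cosD; ring.
(* The pointwise limit of [fn]; its third value occurs on the circle only at [0], [x] and [2 * pi],
   a null set. *)
pose L y : R := if 0 < q y then 1 else if q y < 0 then 0 else expR (- 1).
pose fn (N : nat) y := expR (- expR (- N%:R * q y)).
have cfn N : continuous (fn N).
  apply: continuous_expR_comp => y.
  apply: (@continuousN _ _ _ (fun y => expR (- N%:R * q y))).
  apply: continuous_expR_comp => z.
  by apply: cvgMr; apply: cvgB; [exact: trig_continuous|exact: cvg_cst].
have fnE N y : fn N y = expR (- (expR (- q y)) ^+ N).
  by rewrite /fn -expRM_natl mulNr mulrN.
have fnL y : fn N y @[N --> \oo] --> L y.
  rewrite /L; under eq_fun do rewrite fnE; case: ltP => [q0|q0'].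
    have z0 : expR (- q y) ^+ N @[N --> \oo] --> (0 : R).
      by apply: cvg_expr; rewrite ger0_norm ?expR_ge0// expR_lt1 oppr_lt0.
    have -> : 1 = expR (- 0) :> R by rewrite oppr0 expR0.
    apply: (@cvg_comp _ _ _ _ (fun z => expR (- z)) _ _ _ z0).
    apply: (@continuous_comp _ _ _ (fun z : R => - z) expR); first exact: opp_continuous.
    exact: continuous_expR.
  case: ltP => q0.
    apply: (@squeeze_cvgr _ _ _ _ (fun=> 0) (fun N => expR (q y) ^+ N)).
    - apply: nearW => N; rewrite expR_ge0/= expRN.
      have -> : expR (q y) ^+ N = (expR (- q y) ^+ N)^-1.
        by rewrite -exprVn -expRN opprK.
      rewrite lef_pV2 ?posrE ?expR_gt0 ?exprn_gt0 ?expR_gt0//.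
      by rewrite (le_trans _ (expR_ge1Dx _))// lerDr.
    - exact: cvg_cst.
    - by apply: cvg_expr; rewrite ger0_norm ?expR_ge0// expR_lt1.
  rewrite (_ : q y = 0); last by apply/eqP; rewrite eq_le q0' q0.
  under eq_fun do rewrite oppr0 expR0 expr1n; exact: cvg_cst.
have hL0 : intcirc (fun y => h y * L y) = 0.
  have cv : intcirc (fun y => h y * fn N y) @[N --> \oo] --> intcirc (fun y => h y * L y).
    apply: (@intcirc_dominated _ _ _ (fun y => `|h y|)).
    - by move=> N; apply: Intg_measurable; apply: Intg_mul_continuous => //; exact: cfn.
    - by move=> y _; apply: cvgMr; exact: fnL.
    - exact: Intg_norm.
    - move=> N y _; rewrite normrM ler_piMr// ger0_norm ?expR_ge0//.
      by rewrite expR_le1 oppr_le0 expR_ge0.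
  rewrite -(cvg_lim _ cv)//; under eq_fun do rewrite orth_expexp.
  exact: lim_cst.
rewrite -Rintegral_mkcondr Rintegral_mkcondl -[RHS]hL0 /intcirc /Rintegral.
have mhL : measurable_fun circ (fun y => h y * L y).
  have mfn N : measurable_fun circ (fun y => h y * fn N y).
    by apply: Intg_measurable; exact: Intg_mul_continuous.
  by apply: measurable_fun_cvg mfn _ => y _; apply: cvgMr; exact: fnL.
have mhx : measurable_fun circ (h \_ `[0, x]).
  apply/measurable_restrict => //.
  by apply: measurable_funS (Intg_measurable ih) => //; exact: subIsetl.
congr fine; apply: ae_eq_integral => //; [exact/measurable_EFinP|exact/measurable_EFinP|].
have cN : countable [set 0; x; 2 * pi].
  by apply: finite_set_countable; rewrite !finite_setU; do !split; exact: finite_set1.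
exists [set 0; x; 2 * pi]; split.
- by do 2?apply: measurableU; exact: measurable_set1.
- exact: countable_lebesgue_measure0.
move=> y /= /not_implyP[]; rewrite in_itv/= => /andP[y0 y1] hy.
apply: contrapT => hny; apply: hy.
have {}y0 : 0 < y by rewrite lt_neqAle y0 andbT; apply/eqP => yE; apply: hny; left; left.
have {}y1 : y < 2 * pi by rewrite lt_neqAle y1 andbT; apply/eqP => yE; apply: hny; right.
have yx : y != x by apply/eqP => yE; apply: hny; left; right.
have sy : 0 < sin (y / 2).
  by apply: sin_gt0_pi; rewrite divr_gt0//= ltr_pdivrMr// mulrC.
congr EFin; rewrite patchE /L; have [lyx|lxy|yxE] := ltgtP y x; last by rewrite yxE eqxx in yx.
  rewrite mem_set; last by rewrite /= in_itv/= !ltW.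
  rewrite ifT ?mulr1// qE mulr_gt0 ?mulr_gt0//.
  apply: sin_gt0_pi; rewrite divr_gt0 ?subr_gt0//= ltr_pdivrMr// mulrC.
  by rewrite (le_lt_trans _ x2)// gerBl ltW.
rewrite memNset; last by rewrite /= in_itv/= (ltW y0)/= leNgt lxy.
have q0 : q y < 0.
  rewrite qE pmulr_rlt0 ?mulr_gt0// -oppr_gt0 -sinN -mulNr opprB.
  apply: sin_gt0_pi; rewrite divr_gt0 ?subr_gt0//= ltr_pdivrMr// mulrC.
  by rewrite (le_lt_trans _ y1)// gerBl ltW.
by rewrite ltNge (ltW q0)/= q0 mulr0.
Qed.

(** The primitive of [h] vanishes on all of ]0, 2 pi[, and Lebesgue differentiation recovers [h]
    from it almost everywhere. *)
Lemma orthogonal_ae_eq0 : ae_eq mu circ (EFin \o h) (cst 0%E).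
Proof.
have locf := integrable_locally_restrict (measurable_itv _) (IntgE ih).
have intf y : mu.-integrable `[0, y] (EFin \o (h \_ circ)).
  apply: (@integrableS _ _ _ _ setT) => //.
  rewrite (_ : EFin \o _ = (EFin \o h) \_ circ); last first.
    by apply/funext => z; rewrite /= !patchE; case: ifP.
  by apply: (iffLR (integrable_mkcond _ _) (IntgE ih)); exact: measurable_itv.
have := @FTC1 R (h \_ circ) (BLeft 0) intf locf.
have : {ae mu, forall x, x != 0 /\ x != 2 * pi}.
  exists [set 0; 2 * pi]; split.
  - by apply: measurableU; exact: measurable_set1.
  - by apply: countable_lebesgue_measure0; apply: finite_set_countable;
      rewrite finite_setU; split; exact: finite_set1.
  - move=> x /= hx; apply: contrapT => nx; apply: hx; split; apply/eqP => xE; apply: nx.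
      by left.
    by right.
apply: filterS2; first exact: (ae_filter_ringOfSetsType mu).
move=> x [x0 x2] hx /=.
rewrite in_itv/= => /andP[]; rewrite !le_eqVlt eq_sym (negbTE x0) (negbTE x2)/= => {}x0 {}x2.
move: hx; rewrite lte_fin => /(_ x0)[_].
rewrite patchE mem_set; last by rewrite /= in_itv/= !ltW.
move=> <-; congr EFin; rewrite derive1E.
rewrite (@near_eq_derive _ _ _ _ (cst 0)) ?derive_cst ?oner_neq0//.
near=> y; apply: orthogonal_integral_eq0.
by apply/andP; split; near: y; [exact: lt_nbhsr|exact: lt_nbhsl].
Unshelve. all: by end_near. Qed.

Lemma orthogonal_sqr_eq0 : intcirc (fun y => h y ^+ 2) = 0.
Proof.
have mh := Intg_measurable ih.
rewrite -[RHS](mul0r (2 * pi)) -intcirc_cst /intcirc /Rintegral; congr fine.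
apply: ae_eq_integral => //.
- by apply/measurable_EFinP; exact: measurable_funX.
have := orthogonal_ae_eq0; apply: filterS.
move=> y /= hy cy.
by have [->] := hy cy; rewrite expr0n.
Qed.

End FourierUniqueness.

(** * Distributions and Fourier inversion *)

Section Distributions.
Variable R : realType.
Implicit Types (f g h : R -> R) (S T : distr R) (x y th eta c M : R) (a b : nat -> R)
  (n : int) (N k p : nat).
Local Notation mu := (@lebesgue_measure R).
Local Notation circ := (`[0%R, (2 * pi)%R]%classic : set R).

(** [is_distr] restated with the wrapped predicates and a nonnegative constant, so that bounds can
    be multiplied. *)
Variant Distr T : Prop := MkDistr of
  (forall c f g, SmoothS f -> SmoothS g ->
     T (fun x => c * f x + g x) = c * T f + T g) &
  (exists N C, 0 <= C /\ forall f M, SmoothS f -> Cbound N f M -> `|T f| <= C * M).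

Lemma DistrP T : Distr T <-> is_distr T.
Proof.
split=> [[lT [N [C [C0 hC]]]]|[lT [N [C hC]]]].
  split=> [c f g /SmoothSP sf /SmoothSP sg|]; first exact: lT.
  by exists N, C => f M /SmoothSP sf h; apply: hC => //; split.
split=> [c f g /SmoothSP sf /SmoothSP sg|]; first exact: lT.
exists N, `|C|; split=> // f M sf bf; have M0 := Cbound_ge0 bf.
case: (bf) => hf; rewrite (le_trans (hC f M _ hf))//; first exact/SmoothSP.
by rewrite ler_wpM2r// ler_norm.
Qed.

Lemma distr0 T : Distr T -> T (fun=> 0) = 0.
Proof.
case=> lT _; have := lT (-1) _ _ (smoothS_cst 0) (smoothS_cst 0).
under eq_fun do rewrite mulr0 addr0.
by rewrite mulN1r addNr.
Qed.

Lemma distr_scale T c f : Distr T -> SmoothS f -> T (fun x => c * f x) = c * T f.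
Proof.
move=> dT sf; case: (dT) => lT _; have := lT c _ _ sf (smoothS_cst 0).
by under eq_fun do rewrite addr0; rewrite distr0// addr0.
Qed.

Lemma distr_add T f g : Distr T -> SmoothS f -> SmoothS g ->
  T (fun x => f x + g x) = T f + T g.
Proof.
move=> [lT _] sf sg; have := lT 1 _ _ sf sg.
by under eq_fun do rewrite mul1r; rewrite mul1r.
Qed.

Lemma distr_opp T f : Distr T -> SmoothS f -> T (fun x => - f x) = - T f.
Proof.
move=> dT sf; under eq_fun do rewrite -mulN1r.
by rewrite distr_scale// mulN1r.
Qed.

Lemma distr_sub T f g : Distr T -> SmoothS f -> SmoothS g ->
  T (fun x => f x - g x) = T f - T g.
Proof.
move=> dT sf sg; rewrite distr_add ?distr_opp//; exact: smoothS_opp.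
Qed.

Lemma distr_sum T (I : Type) (r : seq I) (F : I -> R -> R) : Distr T ->
  (forall i, SmoothS (F i)) -> T (fun x => \sum_(i <- r) F i x) = \sum_(i <- r) T (F i).
Proof.
move=> dT sF; elim: r => [|i r IH].
  by under eq_fun do rewrite big_nil; rewrite big_nil distr0.
under eq_fun do rewrite big_cons; rewrite big_cons distr_add// ?IH//.
exact: smoothS_sum.
Qed.

Lemma coef_split T th n : Distr T ->
  coef T th n = cos th * coef T 0 n + sin th * coef T (pi / 2) n.
Proof.
move=> dT; rewrite /coef (funext (trig_split n th)).
rewrite distr_add ?distr_scale//; do ?apply: smoothS_scale; exact: SmoothS_trig.
Qed.

Lemma coefNz T th n : coef T th (- n) = coef T (- th) n.
Proof. by rewrite /coef (funext (trigN n th)). Qed.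

Lemma coefDpi T th n : Distr T -> coef T (th + pi) n = - coef T th n.
Proof.
move=> dT; rewrite /coef (funext (trigDpi n th)) distr_opp//; exact: SmoothS_trig.
Qed.

Lemma coef_pi T n : Distr T -> coef T pi n = - coef T 0 n.
Proof. by move=> dT; rewrite -[X in coef T X]add0r coefDpi. Qed.

Lemma coef_le T th n : Distr T ->
  `|coef T th n| <= `|coef T 0 n| + `|coef T (pi / 2) n|.
Proof.
move=> dT; rewrite coef_split// (le_trans (ler_normD _ _))// !normrM lerD//.
  by rewrite ler_piMl// cos_max.
by rewrite ler_piMl// sin_max.
Qed.

Lemma Distr_dfun f : Intg f -> Distr (dfun f).
Proof.
move=> hf; split=> [c g h sg sh|].
  rewrite /dfun; under eq_fun do rewrite mulrDr mulrCA.
  have cg := SmoothS_continuous sg; have ch := SmoothS_continuous sh.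
  rewrite intcirc_add ?intcirc_scale//; do ?apply: Intg_scale;
    exact: Intg_mul_continuous.
exists 0%N, (intcirc (fun x => `|f x|)); split.
  by apply: intcirc_ge0.
move=> g M sg /Cbound0 bg; apply: intcirc_mul_le => //.
by apply: continuous_measurable_circ; exact: SmoothS_continuous.
Qed.

Lemma Distr_dderiv T : Distr T -> Distr (dderiv T).
Proof.
move=> dT; case: (dT) => lT [N [C [C0 hC]]]; split=> [c f g sf sg|].
  have [_ mf] := sf; have [_ mg] := sg; have scf := smoothS_scale c sf.
  have [_ mcf] := scf.
  rewrite /dderiv derive1_addE// derive1_scaleE//.
  by rewrite lT; [rewrite opprD mulrN|exact: smoothS_derive1..].
exists N.+1, C; split=> // f M sf bf; rewrite normrN; apply: hC.
  exact: smoothS_derive1.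
exact: Cbound_derive1.
Qed.

Lemma Distr_dmul T h : Distr T -> SmoothS h -> Distr (dmul T h).
Proof.
move=> dT sh; case: (dT) => lT [N [C [C0 hC]]]; split=> [c f g sf sg|].
  rewrite /dmul; under eq_fun do rewrite mulrDr mulrCA.
  by rewrite lT//; exact: smoothS_mul.
have [K hK] := smoothS_Cbound N sh.
exists N, (C * (2 ^+ N * K)); split.
  by rewrite mulr_ge0// mulr_ge0 ?exprn_ge0// (Cbound_ge0 hK).
move=> f M sf bf; rewrite -mulrA -(mulrA _ K).
by apply: hC; [exact: smoothS_mul|case: sh => _ sh; case: sf => _ sf; exact: Cbound_mul].
Qed.

Lemma Distr_sub S T : Distr S -> Distr T -> Distr (fun g => S g - T g).
Proof.
move=> [lS [N [C [C0 hC]]]] [lT [N' [C' [C'0 hC']]]]; split=> [c f g sf sg|].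
  by rewrite lS// lT//; ring.
exists (maxn N N'), (C + C'); split; first exact: addr_ge0.
move=> f M sf bf; rewrite (le_trans (ler_normB _ _))// mulrDl lerD//.
  by apply: hC => //; apply: Cbound_leq bf; exact: leq_maxl.
by apply: hC' => //; apply: Cbound_leq bf; exact: leq_maxr.
Qed.

Lemma coef_dderiv T th n : Distr T ->
  coef (dderiv T) th n = n%:~R * coef T (th + pi / 2) n.
Proof.
move=> dT; rewrite /coef /dderiv derive1_trig distr_scale//; last exact: SmoothS_trig.
by rewrite mulNr opprK.
Qed.

Lemma dfun_derive1 f g : SmoothS f -> SmoothS g ->
  dfun (derive1 f) g = dderiv (dfun f) g.
Proof. by move=> sf sg; rewrite /dfun /dderiv intcirc_parts. Qed.

Lemma coef_derive1 f th n : SmoothS f ->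
  coef (dfun (derive1 f)) th n = n%:~R * coef (dfun f) (th + pi / 2) n.
Proof.
move=> sf; rewrite -coef_dderiv; last exact/Distr_dfun/SmoothS_Intg.
by rewrite /coef dfun_derive1//; exact: SmoothS_trig.
Qed.

Lemma coef_bound0 f th n M : SmoothS f -> (forall x, `|f x| <= M) ->
  `|coef (dfun f) th n| <= 2 * pi * M.
Proof.
move=> sf hM; rewrite /coef /dfun mulrC.
apply: intcirc_bounded_le.
  apply: SmoothS_Intg; apply: smoothS_mul => //; exact: SmoothS_trig.
by move=> x _; rewrite normrM -[leRHS]mulr1 ler_pM// trig_le1.
Qed.

(** [p] integrations by parts. Each moves the phase by [pi / 2], so the induction runs over all
    phases. *)
Lemma coef_derive_bound p f th n M : SmoothS f -> Cbound p f M ->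
  `|coef (dfun f) th n| * `|n%:~R| ^+ p <= 2 * pi * M.
Proof.
elim: p f th => [|p IH] f th sf.
  by move=> /Cbound0 bf; rewrite expr0 mulr1; exact: coef_bound0.
move=> /CboundS[_ /(IH _ (th - pi / 2) (smoothS_derive1 sf))].
by rewrite coef_derive1// subrK normrM exprS mulrCA mulrA.
Qed.

(** The weight [k + 1] includes the frequency 0; the comparison [k + 1 <= 2 k] for [k >= 1] costs
    [2 ^+ p]. *)
Lemma coef_bound p f th k M : SmoothS f -> Cbound p f M ->
  `|coef (dfun f) th k| * k.+1%:R ^+ p <= 2 ^+ p * (2 * pi * M).
Proof.
move=> sf bf; case: k => [|k].
  rewrite expr1n mulr1 (le_trans (coef_bound0 th 0 sf (M := M) _))//.
    by case: bf => h x; exact: (h 0%N x).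
  rewrite ler_peMl ?exprn_ege1 ?ler1n// mulr_ge0 ?twopi_ge0//.
  exact: Cbound_ge0 bf.
rewrite (le_trans (y := `|coef (dfun f) th k.+1| * (2 * k.+1%:R) ^+ p))//.
  rewrite ler_wpM2l// lerXn2r ?nnegrE ?mulr_ge0// -natrM ler_nat; lia.
rewrite exprMn mulrCA ler_wpM2l ?exprn_ge0//.
by have := coef_derive_bound th k.+1 sf bf; rewrite -pmulrn normr_nat.
Qed.

(** The normalized real Fourier coefficients, for which [psum] gives the Fourier partial sums; the
    constant mode is normalized by [2 * pi] instead of [pi]. *)
Definition fcos T k : R := (if k == 0%N then (2 * pi)^-1 else pi^-1) * coef T 0 k.
Definition fsin T k : R := pi^-1 * coef T (pi / 2) k.

Lemma fcos_le T k : `|fcos T k| <= `|coef T 0 k|.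
Proof.
rewrite normrM ler_piMl// ger0_norm; last by case: ifP; rewrite invr_ge0 ?twopi_ge0 ?pi_ge0.
have p2 := pi_ge2 R.
by case: ifP => _; rewrite invf_le1; lra.
Qed.

Lemma fsin_le T k : `|fsin T k| <= `|coef T (pi / 2) k|.
Proof.
rewrite normrM ler_piMl// ger0_norm ?invr_ge0 ?pi_ge0//.
by have p2 := pi_ge2 R; rewrite invf_le1; lra.
Qed.

Lemma fcos_fsin_bound p f k M : SmoothS f -> Cbound p f M ->
  `|fcos (dfun f) k| + `|fsin (dfun f) k| <= 2 ^+ p * (4 * pi * M) / k.+1%:R ^+ p.
Proof.
move=> sf bf; rewrite ler_pdivlMr ?exprn_gt0// mulrDl.
have h1 := coef_bound 0 k sf bf; have h2 := coef_bound (pi / 2) k sf bf.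
have -> : 2 ^+ p * (4 * pi * M) = 2 ^+ p * (2 * pi * M) + 2 ^+ p * (2 * pi * M) by ring.
apply: lerD.
  by rewrite (le_trans _ h1)// ler_wpM2r ?exprn_ge0// fcos_le.
by rewrite (le_trans _ h2)// ler_wpM2r ?exprn_ge0// fsin_le.
Qed.

Lemma rapid_fcos f : SmoothS f -> rapid (fcos (dfun f)).
Proof.
move=> sf p; have [M bf] := smoothS_Cbound p sf; exists (2 ^+ p * (2 * pi * M)) => k.
by rewrite (le_trans _ (coef_bound 0 k sf bf))// ler_wpM2r ?exprn_ge0// fcos_le.
Qed.

Lemma rapid_fsin f : SmoothS f -> rapid (fsin (dfun f)).
Proof.
move=> sf p; have [M bf] := smoothS_Cbound p sf; exists (2 ^+ p * (2 * pi * M)) => k.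
by rewrite (le_trans _ (coef_bound (pi / 2) k sf bf))// ler_wpM2r ?exprn_ge0// fsin_le.
Qed.

Lemma coef_trig th eta k (j : nat) : coef (dfun (trig k eta)) th j =
  if j == k then (if k == 0%N then 2 else 1) * pi * cos eta * cos th
    + (if k == 0%N then 0 else pi * sin eta * sin th) else 0 :> R.
Proof. by rewrite /coef /dfun trig_sqr_mul. Qed.

Lemma distr_psum T a b N : Distr T ->
  T (psum a b N) = \sum_(k < N) (a k * coef T 0 k + b k * coef T (pi / 2) k).
Proof.
move=> dT; rewrite /psum distr_sum//; last first.
  by move=> k; apply: smoothS_add; apply: smoothS_scale; exact: SmoothS_trig.
apply: eq_bigr => k _; rewrite distr_add ?distr_scale//;
  do ?apply: smoothS_scale; exact: SmoothS_trig.
Qed.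

Lemma dfunC f g : dfun f g = dfun g f.
Proof. by rewrite /dfun; under eq_fun do rewrite mulrC. Qed.

Lemma coef_psum a b N th (j : nat) : (j < N)%N ->
  coef (dfun (psum a b N)) th j =
  a j * ((if j == 0%N then 2 else 1) * pi * cos th) +
  b j * (if j == 0%N then 0 else pi * sin th).
Proof.
move=> jN; rewrite /coef dfunC distr_psum; last exact/Distr_dfun/SmoothS_Intg/SmoothS_trig.
rewrite (bigD1 (Ordinal jN))//= big1 ?addr0 => [|k kj].
  have h eta : coef (dfun (trig j th)) eta j = coef (dfun (trig j eta)) th j :> R.
    by rewrite /coef dfunC.
  rewrite !h !coef_trig eqxx cos0 sin0 cos_pihalf sin_pihalf.
  by case: ifP => _; ring.
rewrite !coef_trig !ifF ?mulr0 ?addr0//; apply/negbTE; apply: contra kj => /eqP[/esym e];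
  exact/eqP/val_inj.
Qed.

Lemma coef_tsum a b th (j : nat) : rapid a -> rapid b ->
  coef (dfun (tsum a b)) th j =
  a j * ((if j == 0%N then 2 else 1) * pi * cos th) +
  b j * (if j == 0%N then 0 else pi * sin th).
Proof.
move=> ra rb; have [M hM] := rapid_decay2 ra rb.
have st := SmoothS_trig j th; have sts := SmoothS_tsum ra rb.
have cv : coef (dfun (psum a b N)) th j @[N --> \oo] --> coef (dfun (tsum a b)) th j.
  apply: (intcirc_uniform_cvg (e := fun N => 2 * M / N.+1%:R)).
  - by move=> N; apply/SmoothS_Intg/smoothS_mul => //; exact: SmoothS_psum.
  - exact/SmoothS_Intg/smoothS_mul.
  - move=> N x _; rewrite -mulrBl normrM -[leRHS]mulr1 ler_pM ?trig_le1//.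
    by have [_] := psum_cvg x hM.
  - exact: cvg_harm2.
rewrite -(cvg_lim _ cv)//; apply: cvg_lim => //.
apply: cvg_near_cst; exists j.+1 => // N /= jN.
exact: coef_psum.
Qed.

Lemma coef_eq S T : Distr S -> Distr T ->
  (forall k, coef S 0 k = coef T 0 k) ->
  (forall k, coef S (pi / 2) k = coef T (pi / 2) k) ->
  forall th n, coef S th n = coef T th n.
Proof.
move=> dS dT h1 h2 th n.
have h k eta : coef S eta (Posz k) = coef T eta (Posz k).
  by rewrite coef_split// h1 h2 -coef_split.
by case: n => k; rewrite ?NegzE ?coefNz.
Qed.

Lemma L2S_coef0 h : L2S h -> (forall k, coef (dfun h) 0 k = 0) ->
  (forall k, coef (dfun h) (pi / 2) k = 0) -> intcirc (fun x => h x ^+ 2) = 0.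
Proof.
move=> hh h1 h2; have ih := L2S_Intg hh; apply: orthogonal_sqr_eq0 => // n th.
have d0 : Distr (dfun (fun=> 0 : R)) by exact/Distr_dfun/Intg_cst.
have c0 eta m : coef (dfun (fun=> 0)) eta m = 0 :> R.
  by rewrite /coef /dfun; under eq_fun do rewrite mul0r; rewrite intcirc_cst mul0r.
rewrite -[LHS]/(coef (dfun h) th n) -(c0 th n).
by apply: coef_eq => //; [exact: Distr_dfun|move=> k; rewrite c0..].
Qed.

Lemma continuous_sqr_int0 h : continuous h -> periodicS h ->
  intcirc (fun x => h x ^+ 2) = 0 -> h = fun=> 0.
Proof.
move=> ch ph h0; apply/funext => z; have [n c0 c1] := periodicS_itv z.
rewrite -(periodicS_int n z ph); move: (z + _) c0 c1 => c c0 c1 {z n}.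
apply: contrapT => /eqP hc.
have d0 : 0 < `|h c| / 2 by rewrite divr_gt0 ?normr_gt0.
have /cvgrPdist_lt /(_ _ d0) [e /= e0 he] := ch c.
(* The interval is taken to the right of [c], where [c < 2 * pi] leaves room for it inside the
   domain of integration. *)
pose r := Num.min (e / 2) (2 * pi - c).
have r0 : 0 < r by rewrite lt_min divr_gt0//= subr_gt0.
have mr : measurable (`[c, c + r]%classic : set R) by exact: measurable_itv.
have i1 : Intg (\1_`[c, c + r]%classic : R -> R).
  apply: (@Intg_bounded _ _ 1).
    by apply: measurable_funTS; exact: measurable_indic.
  by move=> x _; rewrite indicE; case: (_ \in _); rewrite ?normr1 ?normr0.
have : intcirc (fun x => (`|h c| / 2) ^+ 2 * \1_`[c, c + r]%classic x) <=
    intcirc (fun x => h x ^+ 2).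
  apply: intcirc_le; first exact: Intg_scale.
    by apply: Intg_continuous; exact: continuous_exprn_comp.
  move=> x _; rewrite indicE; have [|_] := boolP (x \in _); last by rewrite mulr0 sqr_ge0.
  rewrite inE/= in_itv/= => /andP[cx xr]; rewrite mulr1.
  rewrite -[leRHS]real_normK ?num_real// lerXn2r ?nnegrE// ?(ltW d0)//.
  have : `|h c - h x| < `|h c| / 2.
    apply: he; rewrite /= distrC ger0_norm ?subr_ge0//.
    have : r <= e / 2 by rewrite ge_min lexx.
    by lra.
  have := lerB_dist (h c) (h x); lra.
rewrite h0 intcirc_scale//; apply/negP; rewrite -ltNge mulr_gt0 ?exprn_gt0//.
rewrite /intcirc /Rintegral [X in fine X](@integral_indic _ _ _ mu circ (measurable_itv _) _ mr) setIidl.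
  have := @lebesgue_measure_itv R `[c, c + r]; rewrite /= lte_fin ltrDl r0 => mE.
  by rewrite [X in fine X]mE -EFinB/= addrAC subrr add0r.
move=> x /=; rewrite !in_itv/= => /andP[cx xr]; rewrite (le_trans c0 cx)/=.
rewrite (le_trans xr)// -lerBrDl.
by rewrite ge_min lexx orbT.
Qed.

Lemma SmoothS_coef_eq f g : SmoothS f -> SmoothS g ->
  (forall k, coef (dfun f) 0 k = coef (dfun g) 0 k) ->
  (forall k, coef (dfun f) (pi / 2) k = coef (dfun g) (pi / 2) k) -> f = g.
Proof.
move=> sf sg h1 h2; have sfg := smoothS_sub sf sg.
have df := Distr_dfun (SmoothS_Intg sf); have dg := Distr_dfun (SmoothS_Intg sg).
have hc th k : coef (dfun (fun x => f x - g x)) th k =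
    coef (dfun f) th k - coef (dfun g) th k.
  have st := SmoothS_trig k th.
  rewrite /coef /dfun; under eq_fun do rewrite mulrBl.
  by rewrite intcirc_sub//; apply/SmoothS_Intg/smoothS_mul.
have := continuous_sqr_int0 (SmoothS_continuous sfg).
case: (sfg) => pfg _ /(_ pfg) h.
have {h}/(congr1 (fun u => u _)) h : (fun x => f x - g x) = fun=> 0.
  apply: h; apply: L2S_coef0; first exact: SmoothS_L2S.
    by move=> k; rewrite hc h1 subrr.
  by move=> k; rewrite hc h2 subrr.
by apply/funext => x; apply/eqP; rewrite -subr_eq0 h.
Qed.

Lemma tsum_fourier f : SmoothS f -> tsum (fcos (dfun f)) (fsin (dfun f)) = f.
Proof.
move=> sf; have rc := rapid_fcos sf; have rs := rapid_fsin sf.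
have p0 : pi != 0 :> R by rewrite gt_eqF ?pi_gt0.
apply: SmoothS_coef_eq => //; first exact: SmoothS_tsum.
  move=> k; rewrite coef_tsum// cos0 sin0 /fcos; move: (coef _ _ _) (fsin _ _) => A B.
  case: ifP => _; rewrite !(mulr0, addr0, mulr1, mul1r) mulrAC mulVf ?mul1r//.
  by rewrite gt_eqF// twopi_gt0.
move=> k; rewrite coef_tsum// cos_pihalf sin_pihalf /fsin !mulr0 add0r mulr1.
case: ifP => [/eqP->|_]; last by rewrite mulrAC mulVf ?mul1r.
rewrite mulr0 /coef; apply/esym.
have -> : trig 0 (pi / 2) = fun=> 0 :> R.
  by apply/funext => x; rewrite /trig mul0r sub0r cosN cos_pihalf.
exact/distr0/Distr_dfun/SmoothS_Intg.
Qed.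

Definition fsum f N := psum (fcos (dfun f)) (fsin (dfun f)) N.

(** The derivative of a Fourier partial sum is the partial sum of the derivative, so convergence in
    C^p follows by induction from uniform convergence. *)
Lemma fsum_cvg p f : SmoothS f -> exists2 e : nat -> R, e N @[N --> \oo] --> 0 &
  forall N, Cbound p (fun x => f x - fsum f N x) (e N).
Proof.
elim: p f => [|p IH] f sf.
  have [M hM] := rapid_decay2 (rapid_fcos sf) (rapid_fsin sf).
  exists (fun N => 2 * M / N.+1%:R); first exact: cvg_harm2.
  move=> N; apply/Cbound0 => x; rewrite distrC.
  by have [_ /(_ N)] := psum_cvg x hM; rewrite tsum_fourier.
have [e1 e10 he1] := IH _ (smoothS_derive1 sf).
have [M hM] := rapid_decay2 (rapid_fcos sf) (rapid_fsin sf).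
exists (fun N => e1 N + 2 * M / N.+1%:R) => [|N].
  by rewrite -[0]addr0; apply: cvgD => //; exact: cvg_harm2.
have M0 := decay2_ge0 hM.
have [_ mf] := sf; have [_ ms] := SmoothS_psum (fcos (dfun f)) (fsin (dfun f)) N.
apply/CboundS; split.
  move=> x; rewrite distrC; have [_ /(_ N)] := psum_cvg x hM; rewrite tsum_fourier// => h.
  by rewrite (le_trans h)// lerDr (Cbound_ge0 (he1 N)).
apply: (@Cbound_le _ _ _ (e1 N)).
  by rewrite lerDl !mulr_ge0// invr_ge0.
have -> : derive1 (fun x => f x - fsum f N x) = fun x => derive1 f x - fsum (derive1 f) N x.
  rewrite derive1_subE// /fsum derive1_psum; apply/funext => x; congr (_ - psum _ _ _ _).
    apply/funext => k; rewrite /fcos /fsin coef_derive1// add0r; case: ifP => [/eqP->|_].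
      by rewrite !mul0r mulr0.
    by rewrite mulrCA.
  apply/funext => k; rewrite /fcos /fsin coef_derive1// -splitr coef_pi; last first.
    exact/Distr_dfun/SmoothS_Intg.
  case: ifP => [/eqP->|_]; first by rewrite !mul0r mulr0 oppr0.
  by rewrite !mulrN mulrCA.
exact: he1.
Qed.

Lemma distr_fsum_cvg T f : Distr T -> SmoothS f -> T (fsum f N) @[N --> \oo] --> T f.
Proof.
move=> dT sf; case: (dT) => _ [p [C [C0 hC]]].
have [e e0 he] := fsum_cvg p sf.
have sN N : SmoothS (fsum f N) by exact: SmoothS_psum.
apply: (@cvg_dist_le _ _ (fun N => C * e N)) => [N|].
  by rewrite distrC -distr_sub//; apply: hC => //; exact: smoothS_sub.
by rewrite -(mulr0 C); apply: cvgMr.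
Qed.

(** Trigonometric polynomials are dense for the seminorms that control [S] and [T]. *)
Lemma Distr_coef_eq S T : Distr S -> Distr T ->
  (forall k, coef S 0 k = coef T 0 k) ->
  (forall k, coef S (pi / 2) k = coef T (pi / 2) k) ->
  forall f, SmoothS f -> S f = T f.
Proof.
move=> dS dT h1 h2 f sf; have cS := distr_fsum_cvg dS sf.
have cT := distr_fsum_cvg dT sf.
apply: (cvg_unique _ cS) => //.
suff -> : (fun N => S (fsum f N)) = (fun N => T (fsum f N)) by [].
apply/funext => N; rewrite /fsum !distr_psum//.
by apply: eq_bigr => k _; rewrite h1 h2.
Qed.

End Distributions.

(** * The half Laplacian and Sobolev norms *)

Section HalfLaplacian.
Variable R : realType.
Implicit Types (f g h u v : R -> R) (S T : distr R) (x y th eta c M : R) (a b : nat -> R)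
  (n : int) (N k p : nat).

Lemma coef_dfun_add f g th n : Intg f -> Intg g ->
  coef (dfun (fun x => f x + g x)) th n = coef (dfun f) th n + coef (dfun g) th n.
Proof.
move=> hf hg; have ct := SmoothS_continuous (SmoothS_trig n th).
rewrite /coef /dfun; under eq_fun do rewrite mulrDl.
by rewrite intcirc_add//; exact: Intg_mul_continuous.
Qed.

Lemma coef_dfun_scale c f th n : Intg f ->
  coef (dfun (fun x => c * f x)) th n = c * coef (dfun f) th n.
Proof.
move=> hf; have ct := SmoothS_continuous (SmoothS_trig n th).
rewrite /coef /dfun; under eq_fun do rewrite -mulrA.
by rewrite intcirc_scale//; exact: Intg_mul_continuous.
Qed.

Lemma coef_dfun_sub f g th n : Intg f -> Intg g ->
  coef (dfun (fun x => f x - g x)) th n = coef (dfun f) th n - coef (dfun g) th n.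
Proof.
move=> hf hg; under eq_fun do rewrite -[- g _]mulN1r.
by rewrite coef_dfun_add ?coef_dfun_scale ?mulN1r//; exact: Intg_scale.
Qed.

(** (-Delta)^{1/2} of a smooth function as an explicit series, to work with in place of the choice
    made by [laplC]. The lock keeps the series folded. *)
Definition Lam f : R -> R :=
  locked (tsum (mulk (fcos (dfun f))) (mulk (fsin (dfun f)))).

Lemma SmoothS_Lam f : SmoothS f -> SmoothS (Lam f).
Proof.
by move=> sf; rewrite /Lam -lock; apply: SmoothS_tsum; apply: rapid_mulk; [exact: rapid_fcos|exact: rapid_fsin].
Qed.

Lemma coef_Lam f th n : SmoothS f ->
  coef (dfun (Lam f)) th n = `|n%:~R| * coef (dfun f) th n.
Proof.
move=> sf; have h eta k : coef (dfun (Lam f)) eta k = k%:R * coef (dfun f) eta k.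
  have rc := rapid_fcos sf; have rs := rapid_fsin sf.
  rewrite /Lam -lock coef_tsum; [|exact: rapid_mulk..].
  rewrite -[in RHS](tsum_fourier sf) coef_tsum// /mulk.
  by rewrite -!mulrA -mulrDr.
case: n => k; first by rewrite h ger0_norm.
by rewrite NegzE !coefNz h mulrNz normrN ger0_norm.
Qed.

(** Three derivatives give coefficients of order [k^-3]; the multiplier [k] leaves the summable
    [k^-2]. The constant is [2 ^+ 3 * (4 * pi)] from [fcos_fsin_bound], doubled by the summation. *)
Lemma Lam_bound f M : SmoothS f -> Cbound 3 f M ->
  forall x, `|Lam f x| <= 64 * pi * M.
Proof.
move=> sf bf x.
have M0 := Cbound_ge0 bf.
have hM : decay2 (mulk (fcos (dfun f))) (mulk (fsin (dfun f))) (32 * pi * M).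
  move=> k; rewrite (normrM _ (fcos _ _)) (normrM _ (fsin _ _)) -mulrDr.
  have h := fcos_fsin_bound k sf bf.
  rewrite (le_trans (ler_wpM2l (normr_ge0 _) h))// ger0_norm//.
  have k0 : 0 < k.+1%:R :> R by rewrite ltr0n.
  have -> : k%:R * (2 ^+ 3 * (4 * pi * M) / k.+1%:R ^+ 3) =
     (k%:R / k.+1%:R) * (32 * pi * M / k.+1%:R ^+ 2).
    by field; rewrite gt_eqF.
  rewrite ler_piMl//; last by rewrite ler_pdivrMr// mul1r ler_nat.
  by rewrite !mulr_ge0 ?invr_ge0 ?pi_ge0 ?exprn_ge0.
rewrite /Lam -lock; have [_ /(_ 0%N)] := psum_cvg x hM.
rewrite [psum _ _ 0 _]big_ord0 sub0r normrN => h.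
by rewrite (le_trans h)// divr1 !mulrA -natrM.
Qed.

Lemma LamD f g : SmoothS f -> SmoothS g ->
  Lam (fun x => f x + g x) = fun x => Lam f x + Lam g x.
Proof.
move=> sf sg; have sL := SmoothS_Lam sf; have sL' := SmoothS_Lam sg.
have e th k : coef (dfun (Lam (fun x => f x + g x))) th (Posz k) =
    coef (dfun (fun x => Lam f x + Lam g x)) th (Posz k).
  rewrite coef_Lam; last exact: smoothS_add.
  rewrite [RHS]coef_dfun_add; [|exact: SmoothS_Intg..].
  rewrite (coef_dfun_add th k (SmoothS_Intg sf) (SmoothS_Intg sg)) mulrDr.
  by congr (_ + _); apply/esym; exact: coef_Lam.
apply: SmoothS_coef_eq; [|exact: smoothS_add|by move=> k; exact: e|by move=> k; exact: e].
exact/SmoothS_Lam/smoothS_add.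
Qed.

Lemma LamZ c f : SmoothS f -> Lam (fun x => c * f x) = fun x => c * Lam f x.
Proof.
move=> sf; have sL := SmoothS_Lam sf.
have e th k : coef (dfun (Lam (fun x => c * f x))) th (Posz k) =
    coef (dfun (fun x => c * Lam f x)) th (Posz k).
  rewrite coef_Lam; last exact: smoothS_scale.
  rewrite [RHS]coef_dfun_scale; last exact: SmoothS_Intg.
  rewrite (coef_dfun_scale c th k (SmoothS_Intg sf)) mulrCA.
  by congr (_ * _); apply/esym; exact: coef_Lam.
apply: SmoothS_coef_eq; [|exact: smoothS_scale|by move=> k; exact: e|by move=> k; exact: e].
exact/SmoothS_Lam/smoothS_scale.
Qed.

Lemma Lam_trig k th : Lam (trig k th) = fun x => k%:R * trig k th x.
Proof.
have st := SmoothS_trig k th.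
have e eta j : coef (dfun (Lam (trig k th))) eta (Posz j) =
    coef (dfun (fun x => k%:R * trig k th x)) eta (Posz j).
  rewrite coef_Lam// coef_dfun_scale; last exact: SmoothS_Intg.
  rewrite coef_trig; case: eqP => [->|_]; first by rewrite ger0_norm.
  by rewrite !mulr0.
apply: SmoothS_coef_eq; [|exact: smoothS_scale|by move=> j; exact: e|by move=> j; exact: e].
exact: SmoothS_Lam.
Qed.

(** The transpose of [Lam] realizes (-Delta)^{1/2} u for [u] merely integrable; [Lam_bound] gives
    continuity of order 3. *)
Lemma Distr_Lam u : Intg u -> Distr (fun g => dfun u (Lam g)).
Proof.
move=> hu; split=> [c f g sf sg|].
  have sL := SmoothS_Lam sf; have sL' := SmoothS_Lam sg.
  rewrite LamD//; last exact: smoothS_scale.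
  rewrite LamZ//; have [+ _] := Distr_dfun hu; exact.
have [_ [N [C [C0 hC]]]] := Distr_dfun hu.
exists 3%N, (intcirc (fun x => `|u x|) * (64 * pi)); split.
  by rewrite !mulr_ge0 ?pi_ge0//; apply: intcirc_ge0.
move=> f M sf bf; rewrite -mulrA; apply: intcirc_mul_le => //.
  by apply: continuous_measurable_circ; exact/SmoothS_continuous/SmoothS_Lam.
by move=> x _; exact: Lam_bound.
Qed.

Lemma coef_Distr_Lam u th n : Intg u ->
  coef (fun g => dfun u (Lam g)) th n = `|n%:~R| * coef (dfun u) th n.
Proof.
move=> hu; have du := Distr_dfun hu.
suff h k eta : coef (fun g => dfun u (Lam g)) eta (Posz k) = k%:R * coef (dfun u) eta k.
  case: n => k; first by rewrite h ger0_norm.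
  by rewrite NegzE !coefNz h mulrNz normrN ger0_norm.
by rewrite /coef Lam_trig distr_scale//; exact: SmoothS_trig.
Qed.

Lemma dfun_Lam f g : SmoothS f -> SmoothS g -> dfun (Lam f) g = dfun f (Lam g).
Proof.
move=> sf sg; have hf := SmoothS_Intg sf.
apply: (Distr_coef_eq (S := dfun (Lam f)) (T := fun g => dfun f (Lam g))) => //.
- exact/Distr_dfun/SmoothS_Intg/SmoothS_Lam.
- exact: Distr_Lam.
- by move=> k; rewrite coef_Lam// coef_Distr_Lam.
- by move=> k; rewrite coef_Lam// coef_Distr_Lam.
Qed.

Lemma fourierE T n : fourier T n =
  Complex (coef T 0 n / (2 * pi)) (- (coef T (pi / 2) n / (2 * pi))).
Proof.
have e1 : (fun x => cos (n%:~R * x)) = trig n 0 :> (R -> R).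
  by apply/funext => x; rewrite /trig subr0.
have e2 : (fun x => sin (n%:~R * x)) = trig n (pi / 2) :> (R -> R).
  by apply/funext => x; rewrite /trig cosBpihalf.
by rewrite /fourier e1 e2.
Qed.

Lemma fourier_scaleE S T c n : fourier S n = (c%:C)%C * fourier T n <->
  coef S 0 n = c * coef T 0 n /\ coef S (pi / 2) n = c * coef T (pi / 2) n.
Proof.
have p0 : (2 * pi)^-1 != 0 :> R by rewrite invr_eq0 gt_eqF// twopi_gt0.
rewrite !fourierE; split=> [[]|[-> ->]].
  rewrite !mul0r subr0 addr0 mulrA => /(mulIf p0) ->.
  by rewrite mulrN => /oppr_inj; rewrite mulrA => /(mulIf p0) ->.
by congr Complex; rewrite ?mul0r ?subr0 ?addr0 ?mulrN mulrA.
Qed.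

(** The witness [S] shows that the set from which [lapl] chooses is inhabited; equality of
    coefficients then identifies the chosen distribution with [S] on smooth functions. *)
Lemma lapl_spec s S T : Distr S -> Distr T ->
  (forall th n, coef S th n = `|n%:~R| `^ (2 * s) * coef T th n) ->
  [/\ Distr (lapl s T),
    forall th n, coef (lapl s T) th n = `|n%:~R| `^ (2 * s) * coef T th n &
    forall f, SmoothS f -> lapl s T f = S f].
Proof.
move=> dS dT hS.
pose P := [set S : distr R | is_distr S /\ forall n : int, fourier S n =
    ((`|n%:~R : R| `^ (2 * s))%:C)%C * fourier T n].
have [+ h] : P (lapl s T).
  apply: getPex; exists S; split; first exact/DistrP.
  by move=> n; apply/fourier_scaleE; rewrite !hS.
move=> /DistrP dL.
have hL th n : coef (lapl s T) th n = `|n%:~R| `^ (2 * s) * coef T th n.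
  have /fourier_scaleE[h1 h2] := h n.
  by rewrite coef_split// h1 h2 (coef_split th n dT); ring.
split=> // f sf; apply: Distr_coef_eq => // k; by rewrite hL hS.
Qed.

Lemma powR_half2 x : 0 <= x -> x `^ (2 * 2^-1) = x.
Proof. by move=> x0; rewrite divff ?powRr1. Qed.

Lemma lapl_half u : Intg u ->
  [/\ Distr (lapl 2^-1 (dfun u)),
    forall th n, coef (lapl 2^-1 (dfun u)) th n = `|n%:~R| * coef (dfun u) th n &
    forall f, SmoothS f -> lapl 2^-1 (dfun u) f = dfun u (Lam f)].
Proof.
move=> hu; have [||th n|h1 h2 h3] := @lapl_spec 2^-1 (fun g => dfun u (Lam g)) (dfun u).
- exact: Distr_Lam.
- exact: Distr_dfun.
- by rewrite coef_Distr_Lam// powR_half2.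
by split=> // th n; rewrite h2 powR_half2.
Qed.

Lemma laplC_Lam f : SmoothS f -> laplC 2^-1 f = Lam f.
Proof.
move=> sf; have sL := SmoothS_Lam sf.
have [_ _ hl] := lapl_half (SmoothS_Intg sf).
pose P := [set w : R -> R | smoothS w /\ eq_distr (dfun w) (lapl 2^-1 (dfun f))].
have [] : P (laplC 2^-1 f).
  apply: getPex; exists (Lam f); split; first exact/SmoothSP.
  by move=> g /SmoothSP sg; rewrite hl// dfun_Lam.
move=> /SmoothSP sw hw.
have e th k : coef (dfun (laplC 2^-1 f)) th (Posz k) = coef (dfun (Lam f)) th (Posz k).
  rewrite /coef hw; last exact/SmoothSP/SmoothS_trig.
  by rewrite hl ?dfun_Lam//; exact: SmoothS_trig.
by apply: SmoothS_coef_eq.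
Qed.

Definition wgt (s : R) n : R := (1 + n%:~R ^+ 2) `^ s.
Definition pw T n : R := coef T 0 n ^+ 2 + coef T (pi / 2) n ^+ 2.
(* With [w := pw T], this bounds [(2 pi)^2 * Hnorm2 s T] by [h], without extended
   reals. *)
Definition Hle (s : R) (w : int -> R) (h : R) :=
  forall F : seq int, uniq F -> \sum_(n <- F) wgt s n * w n <= h.

Lemma wgt_ge0 s n : 0 <= wgt s n.
Proof. exact: powR_ge0. Qed.

Lemma pw_ge0 T n : 0 <= pw T n.
Proof. by rewrite addr_ge0// sqr_ge0. Qed.

Lemma Hle_ge0 s w (B : R) : Hle s w B -> 0 <= B.
Proof. by move=> /(_ [::] isT); rewrite big_nil. Qed.

Lemma Hle_le s s' w w' (B C : R) : 0 <= C ->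
  (forall n, wgt s' n * w' n <= C * (wgt s n * w n)) ->
  Hle s w B -> Hle s' w' (C * B).
Proof.
move=> C0 hw hh F uF; rewrite (@le_trans _ _ (\sum_(n <- F) C * (wgt s n * w n)))//.
  by apply: ler_sum => n _; exact: hw.
by rewrite -mulr_sumr ler_wpM2l// hh.
Qed.

Lemma Hnorm2_Hle s T (B : R) :
  (Hnorm2 s T <= B%:E)%E <-> Hle s (pw T) ((2 * pi) ^+ 2 * B).
Proof.
have p0 : 0 < (2 * pi) ^+ 2 :> R by rewrite exprn_gt0// twopi_gt0.
have tE n : (1 + n%:~R ^+ 2) `^ s * (Normc.normc (fourier T n)) ^+ 2 =
    ((2 * pi) ^+ 2)^-1 * (wgt s n * pw T n).
  rewrite fourierE /Normc.normc sqr_sqrtr; last by rewrite addr_ge0 ?sqr_ge0.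
  rewrite sqrrN !expr_div_n -mulrDl /wgt /pw; move: (_ `^ s) => W.
  by rewrite mulrA mulrC.
have t0 n : 0 <= ((2 * pi) ^+ 2)^-1 * (wgt s n * pw T n).
  by rewrite mulr_ge0 ?invr_ge0 ?(ltW p0)// mulr_ge0 ?wgt_ge0 ?pw_ge0.
rewrite /Hnorm2; under eq_esum do rewrite tE.
split=> [hh F uF|hh].
  rewrite -ler_pdivrMl// mulr_sumr -lee_fin -sumEFin (le_trans _ hh)//.
  apply: esum_ge; exists [set` F]; first by split; [exact: finite_seq|].
  by rewrite fsbig_seq.
apply: ub_ereal_sup => _ [F [fF _] <-].
have [r rE] := (finite_seqP F).1 fF.
have -> : F = [set` undup r] by rewrite rE; apply/seteqP; split=> z /=; rewrite mem_undup.
rewrite -fsbig_seq ?undup_uniq// sumEFin lee_fin -mulr_sumr ler_pdivrMl//.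
by apply: hh; exact: undup_uniq.
Qed.

Lemma Hle_nat s w (B : R) N : (forall n, 0 <= w n) -> Hle s w B ->
  \sum_(k < N) wgt s k * w k <= B.
Proof.
move=> w0 hB; rewrite -(big_mkord xpredT (fun k : nat => wgt s k * w k)) /index_iota subn0.
have := hB (map Posz (iota 0 N)); rewrite big_map; apply.
by rewrite map_inj_uniq ?iota_uniq// => i j [].
Qed.

(** Bounding [t i] by the geometric mean of [al i] and [be i] lets weights be distributed between
    the two factors without taking square roots. *)
Lemma sum_CauchySchwarz (I : Type) (r : seq I) (t al be : I -> R) :
  (forall i, 0 <= al i) -> (forall i, 0 <= be i) ->
  (forall i, t i ^+ 2 <= al i * be i) ->
  (\sum_(i <- r) t i) ^+ 2 <= (\sum_(i <- r) al i) * (\sum_(i <- r) be i).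
Proof.
move=> al0 be0 h; elim: r => [|i r IH]; first by rewrite !big_nil mul0r expr0n.
rewrite !big_cons.
have A0 : 0 <= \sum_(j <- r) al j by apply: sumr_ge0.
have B0 : 0 <= \sum_(j <- r) be j by apply: sumr_ge0.
move: IH A0 B0 (h i) (al0 i) (be0 i).
move: (\sum_(j <- r) t j) (\sum_(j <- r) al j) (\sum_(j <- r) be j) (t i) (al i) (be i).
move=> S A B z a b hS A0 B0 hz a0 b0.
(* The cross term is bounded by the arithmetic-geometric mean inequality: [4 * S^2 * z^2 <= 4 * (A *
   B) * (a * b) <= (a * B + A * b)^2]. *)
suff : 2 * (S * z) <= a * B + A * b by nra.
have [//|hlt] := leP (2 * (S * z)) (a * B + A * b).
have p0 : 0 <= a * B + A * b by rewrite addr_ge0 ?mulr_ge0.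
have h1 : (a * B + A * b) ^+ 2 < (2 * (S * z)) ^+ 2.
  by rewrite ltrXn2r ?nnegrE// (le_trans p0)// ltW.
have h2 : S ^+ 2 * z ^+ 2 <= (A * B) * (a * b) by rewrite ler_pM ?sqr_ge0.
have h3 := sqr_ge0 (a * B - A * b).
have h4 : (2 * (S * z)) ^+ 2 = 4 * (S ^+ 2 * z ^+ 2) by ring.
have h5 : (a * B + A * b) ^+ 2 = (a * B - A * b) ^+ 2 + 4 * ((A * B) * (a * b)) by ring.
by move: h1; rewrite h4 h5 => h1; lra.
Qed.

Lemma wgtN s n : wgt (- s) n * wgt s n = 1.
Proof.
have p0 : 0 < 1 + n%:~R ^+ 2 :> R by have := sqr_ge0 (n%:~R : R); lra.
by rewrite /wgt powRN mulVf// gt_eqF// powR_gt0.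
Qed.

(** Duality of H^s and H^{-s}: on partial sums of [g] this is Cauchy-Schwarz with the weights
    [wgt s] and [wgt (- s)], whose product is 1; the normalizing constants in [fcos] and [fsin] are
    at most 1. *)
Lemma distr_pairing_le T g s (B B' : R) : Distr T -> SmoothS g ->
  Hle s (pw T) B -> Hle (- s) (pw (dfun g)) B' -> T g ^+ 2 <= B * B'.
Proof.
move=> dT sg hB hB'.
have cv : T (fsum g N) ^+ 2 @[N --> \oo] --> T g ^+ 2.
  by rewrite expr2; under eq_fun do rewrite expr2; apply: cvgM; exact: distr_fsum_cvg.
apply: cvgn_le cv _; apply: nearW => N; rewrite /fsum distr_psum//.
apply: (@le_trans _ _ ((\sum_(k < N) wgt s k * pw T k) *
    (\sum_(k < N) wgt (- s) k * pw (dfun g) k))); last first.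
  apply: ler_pM.
  - by apply: sumr_ge0 => k _; rewrite mulr_ge0 ?wgt_ge0 ?pw_ge0.
  - by apply: sumr_ge0 => k _; rewrite mulr_ge0 ?wgt_ge0 ?pw_ge0.
  - by apply: Hle_nat => // n; exact: pw_ge0.
  - by apply: Hle_nat => // n; exact: pw_ge0.
apply: sum_CauchySchwarz => k; try by rewrite mulr_ge0 ?wgt_ge0 ?pw_ge0.
have -> : wgt s k * pw T k * (wgt (- s) k * pw (dfun g) k) = pw T k * pw (dfun g) k.
  rewrite mulrACA (mulrC (wgt s k)) wgtN mul1r//.
have sq (a b : R) : `|a| <= `|b| -> a ^+ 2 <= b ^+ 2.
  by move=> ab; rewrite -real_normK ?num_real// -[leRHS]real_normK ?num_real// lerXn2r ?nnegrE.
have h1 := sq _ _ (fcos_le (dfun g) k); have h2 := sq _ _ (fsin_le (dfun g) k).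
rewrite (@le_trans _ _ (pw T k * (fcos (dfun g) k ^+ 2 + fsin (dfun g) k ^+ 2)))//.
  rewrite /pw; move: (fcos _ _) (fsin _ _) (coef T _ _) (coef T _ _) => a b c d.
  rewrite -subr_ge0; suff -> : (d ^+ 2 + c ^+ 2) * (a ^+ 2 + b ^+ 2) - (a * d + b * c) ^+ 2 =
    (a * c - b * d) ^+ 2 by exact: sqr_ge0.
  by ring.
by rewrite ler_wpM2l ?pw_ge0// lerD.
Qed.

End HalfLaplacian.

(** * Multiplication and commutator estimates *)

Section Multiplication.
Variable R : realType.
Implicit Types (f g v : R -> R) (S T : distr R) (x y th eta c M : R)
  (n m : int) (N k p : nat).

Lemma eq_cvgn (u v : nat -> R) (l : R) : (forall N, v N = u N) ->
  u N @[N --> \oo] --> l -> v N @[N --> \oo] --> l.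
Proof. by move=> uv; rewrite (funext uv). Qed.

Lemma cvgn_scale (u : nat -> R) (c l : R) :
  u N @[N --> \oo] --> l -> c * u N @[N --> \oo] --> c * l.
Proof. by move=> h; apply: cvgMr. Qed.

(** For a negative exponent it is the comparison of [B] with [L * A] that is used, hence the
    two-sided hypothesis; [|s| <= 1] keeps the power of [L] below [L]. *)
Lemma powR_shift_le (s A B L : R) : 1 <= L -> 0 < A -> 0 < B -> `|s| <= 1 ->
  A <= L * B -> B <= L * A -> A `^ s <= L * B `^ s.
Proof.
move=> L1 A0 B0 s1 AB BA; have L0 : 0 < L by lra.
have powL r : 0 <= r -> r <= 1 -> L `^ r <= L.
  by move=> r0 r1; rewrite -[leRHS]powRr1 ?(ltW L0)// ler_powR.
have [s0|/ltW s0] := leP 0 s.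
  have s1' : s <= 1 by move: s1; rewrite ger0_norm.
  rewrite (@le_trans _ _ ((L * B) `^ s))//.
    by rewrite ge0_ler_powR// nnegrE ?mulr_ge0// ltW.
  by rewrite powRM ?(ltW L0) ?(ltW B0)// ler_wpM2r ?powR_ge0// powL.
have r0 : 0 <= - s by lra.
have r1 : - s <= 1 by move: s1; rewrite ler0_norm.
have h : B `^ (- s) <= L * A `^ (- s).
  rewrite (@le_trans _ _ ((L * A) `^ (- s)))//.
    by rewrite ge0_ler_powR// nnegrE ?mulr_ge0// ltW.
  by rewrite powRM ?(ltW L0) ?(ltW A0)// ler_wpM2r ?powR_ge0// powL.
move: h; rewrite !powRN => h.
have As : 0 < A `^ s by exact: powR_gt0.
have Bs : 0 < B `^ s by exact: powR_gt0.
move: h; rewrite ler_pdivlMr// mulrC ler_pdivrMr// mulrC => h; lra.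
Qed.

(** Peetre's inequality: [1 + (m + k)^2 <= 2 (1 + k)^2 (1 + m^2)], and likewise with [n] and [m]
    exchanged. *)
Lemma wgt_shift (s : R) n m k : `|s| <= 1 -> (n = m + k%:Z \/ n = m - k%:Z) ->
  wgt s n <= 2 * k.+1%:R ^+ 2 * wgt s m.
Proof.
move=> s1 nm; have k1 : k.+1%:R = k%:R + 1 :> R by rewrite -natr1.
have k0 : 0 <= k%:R :> R by [].
rewrite /wgt.
have {nm} : n%:~R = m%:~R + k%:R :> R \/ n%:~R = m%:~R - k%:R :> R.
  by case: nm => ->; [left; rewrite intrD|right; rewrite intrB].
move: (n%:~R : R) (m%:~R : R) => a b hab.
have c1 : 0 <= k%:R * (1 + b ^+ 2) by rewrite mulr_ge0// addr_ge0 ?sqr_ge0.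
have c2 : 0 <= k%:R * (1 + a ^+ 2) by rewrite mulr_ge0// addr_ge0 ?sqr_ge0.
have c3 := sqr_ge0 (k%:R * b); have c4 := sqr_ge0 (k%:R * a).
have c5 := sqr_ge0 (b - k%:R); have c6 := sqr_ge0 (b + k%:R).
have c7 := sqr_ge0 (a - k%:R); have c8 := sqr_ge0 (a + k%:R).
have a2 := sqr_ge0 a; have b2 := sqr_ge0 b; have k2 := sqr_ge0 (k%:R : R).
apply: powR_shift_le => //; rewrite ?k1; do ?lra.
- by nra.
- by case: hab => hab; nra.
Qed.

Lemma coef_dmul_trig T th n eta k : Distr T ->
  coef (dmul T (trig n th)) eta k =
  2^-1 * (coef T (th - eta) (n - k%:Z) + coef T (th + eta) (n + k%:Z)).
Proof.
move=> dT; rewrite /coef /dmul.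
have -> : (fun x => trig n th x * trig k eta x) = fun x =>
    2^-1 * (trig (n - k%:Z) (th - eta) x + trig (n + k%:Z) (th + eta) x).
  by apply/funext => x; rewrite mulrC trigM.
have s1 := SmoothS_trig (n - k%:Z) (th - eta); have s2 := SmoothS_trig (n + k%:Z) (th + eta).
by rewrite distr_scale ?distr_add//; exact: smoothS_add.
Qed.

(** The convolution formula in real form. The roles are exchanged: the distribution
    [dmul T (trig n th)] is applied to the Fourier partial sums of [f]. *)
Lemma coef_dmul_cvg T f th n : Distr T -> SmoothS f ->
  \sum_(k < N) (fcos (dfun f) k * (2^-1 * (coef T th (n - k%:Z) + coef T th (n + k%:Z))) +
    fsin (dfun f) k * (2^-1 * (coef T (th - pi / 2) (n - k%:Z)
                               + coef T (th + pi / 2) (n + k%:Z)))) @[N --> \oo] -->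
  coef (dmul T f) th n.
Proof.
move=> dT sf; have dTn := Distr_dmul dT (SmoothS_trig n th).
have -> : coef (dmul T f) th n = dmul T (trig n th) f.
  by rewrite /coef /dmul; congr T; apply/funext => x; rewrite mulrC.
have := distr_fsum_cvg dTn sf.
under eq_fun do rewrite /fsum distr_psum//.
under eq_fun do (under eq_bigr do rewrite !coef_dmul_trig// subr0 addr0).
by [].
Qed.

(** [fcos_fsin_bound] at order 6 contributes [2 ^+ 6 * (4 * pi)], that is twice [128 * pi], hence a
    factor 4 after squaring. The remaining 16 is 2 from [wgt_shift], 2 for the two shifts, and 2 for
    each of two sums of [1/(k+1)^2]. *)
Definition Cmul : R := 64 * (128 * pi) ^+ 2.

Lemma Cmul_ge0 : 0 <= Cmul.
Proof. by rewrite mulr_ge0// sqr_ge0. Qed.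

Lemma symbol_term_bound (T : distr R) (om al be c c' K' : R) n n' : Distr T ->
  `|c| <= K' -> `|c'| <= K' ->
  `|al * (2^-1 * (c * coef T om n + c' * coef T om n')) +
    be * (2^-1 * (c * coef T (om - pi / 2) n + c' * coef T (om + pi / 2) n'))| ^+ 2 <=
  (`|al| + `|be|) ^+ 2 * K' ^+ 2 * (pw T n + pw T n').
Proof.
move=> dT hc hc'; have K0 : 0 <= K' := le_trans (normr_ge0 _) hc.
pose X m : R := `|coef T 0 m| + `|coef T (pi / 2) m|.
have X0 m : 0 <= X m by rewrite addr_ge0.
have hX eta m : `|coef T eta m| <= X m by exact: coef_le.
have h eta eta' : `|2^-1 * (c * coef T eta n + c' * coef T eta' n')| <=
    2^-1 * (K' * (X n + X n')).
  rewrite normrM ger0_norm// ler_wpM2l// (le_trans (ler_normD _ _))// mulrDr !normrM.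
  by rewrite lerD// ler_pM.
rewrite (@le_trans _ _ (((`|al| + `|be|) * (2^-1 * (K' * (X n + X n')))) ^+ 2))//.
  rewrite lerXn2r ?nnegrE ?mulr_ge0 ?addr_ge0//.
  rewrite (le_trans (ler_normD _ _))// [leRHS]mulrDl (normrM al) (normrM be).
  by apply: lerD; apply: ler_wpM2l => //; exact: h.
have -> : ((`|al| + `|be|) * (2^-1 * (K' * (X n + X n')))) ^+ 2 =
  (`|al| + `|be|) ^+ 2 * K' ^+ 2 * (2^-1 ^+ 2 * (X n + X n') ^+ 2) by ring.
rewrite ler_wpM2l ?mulr_ge0 ?sqr_ge0//.
have hp m : X m ^+ 2 <= 2 * pw T m.
  rewrite /X /pw -(real_normK (num_real (coef T 0 m))) -(real_normK (num_real (coef T (pi / 2) m))).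
  by have := sqr_ge0 (`|coef T 0 m| - `|coef T (pi / 2) m|); nra.
have := hp n; have := hp n'; have := sqr_ge0 (X n - X n'); move: (X n) (X n') => a b.
move=> h1 h2 h3.
have -> : 2^-1 ^+ 2 * (a + b) ^+ 2 = (2 * a ^+ 2 + 2 * b ^+ 2 - (a - b) ^+ 2) / 4 by field.
by lra.
Qed.

(* [p n * coef (dmul T1 f) - q n * coef (dmul T2 f)] is a convolution of the
   coefficients of [f] and [T] with kernel [p n * s1 m - q n * s2 m]; multiplying
   by [f] and its commutators with Fourier multipliers are special cases. *)
Lemma symbol_bound (s : R) T T1 T2 f (M K B : R) (p q s1 s2 : int -> R)
    (th1 th2 d1 d2 : R) :
  `|s| <= 1 -> Distr T -> Distr T1 -> Distr T2 -> SmoothS f ->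
  (forall eta m, coef T1 eta m = s1 m * coef T (eta + d1) m) ->
  (forall eta m, coef T2 eta m = s2 m * coef T (eta + d2) m) ->
  th1 + d1 = th2 + d2 ->
  (forall n m k, (n = m + k%:Z \/ n = m - k%:Z) ->
     `|p n * s1 m - q n * s2 m| <= K * k.+1%:R ^+ 2) ->
  Cbound 6 f M -> Hle s (pw T) B ->
  Hle s (fun n => (p n * coef (dmul T1 f) th1 n - q n * coef (dmul T2 f) th2 n) ^+ 2)
    (Cmul * (K * M) ^+ 2 * B).
Proof.
move=> hs dT dT1 dT2 sf h1 h2 hd hK bf hB F uF.
have M0 := Cbound_ge0 bf; have B0 := Hle_ge0 hB.
set al := fcos (dfun f); set be := fsin (dfun f); pose om := th1 + d1.
pose c n m := p n * s1 m - q n * s2 m.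
pose t n k := al k * (2^-1 * (c n (n - k%:Z) * coef T om (n - k%:Z)
                              + c n (n + k%:Z) * coef T om (n + k%:Z))) +
  be k * (2^-1 * (c n (n - k%:Z) * coef T (om - pi / 2) (n - k%:Z)
                  + c n (n + k%:Z) * coef T (om + pi / 2) (n + k%:Z))).
pose y n := p n * coef (dmul T1 f) th1 n - q n * coef (dmul T2 f) th2 n.
have cvy n : \sum_(k < N) t n k @[N --> \oo] --> y n.
  have c1 := cvgn_scale (c := p n) (@coef_dmul_cvg _ _ th1 n dT1 sf).
  have c2 := cvgn_scale (c := q n) (@coef_dmul_cvg _ _ th2 n dT2 sf).
  apply: (eq_cvgn _ (cvgB c1 c2)) => N.
  rewrite -[RHS]/(_ - _) !mulr_sumr -sumrB.
  apply: eq_bigr => k _; rewrite !h1 !h2 /t /c /om -hd.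
  have -> : th1 - pi / 2 + d1 = th1 + d1 - pi / 2 by ring.
  have -> : th1 + pi / 2 + d1 = th1 + d1 + pi / 2 by ring.
  have -> : th2 - pi / 2 + d2 = th1 + d1 - pi / 2 by rewrite hd; ring.
  have -> : th2 + pi / 2 + d2 = th1 + d1 + pi / 2 by rewrite hd; ring.
  by rewrite -/al -/be; ring.
pose D := 128 * pi * (K * M).
have DD : 0 <= 16 * D ^+ 2 * B.
  by apply: mulr_ge0 => //; apply: mulr_ge0 => //; exact: sqr_ge0.
(* Six derivatives of [f] give [(k+1)^-12] after squaring, and the kernel costs [(k+1)^4]. Of the
   remaining [(k+1)^-8], one Cauchy-Schwarz factor takes [(k+1)^-2]; the other keeps [(k+1)^-6],
   enough to absorb the [(k+1)^2] of [wgt_shift] and still be summable. *)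
have tb n k : t n k ^+ 2 <= (k.+1%:R ^+ 2)^-1 *
    (4 * D ^+ 2 / k.+1%:R ^+ 6 * (pw T (n - k%:Z) + pw T (n + k%:Z))).
  have k0 : 0 < k.+1%:R :> R by rewrite ltr0n.
  have hc1 : `|c n (n - k%:Z)| <= K * k.+1%:R ^+ 2 by apply: hK; left; rewrite subrK.
  have hc2 : `|c n (n + k%:Z)| <= K * k.+1%:R ^+ 2 by apply: hK; right; rewrite addrK.
  have := symbol_term_bound om (al k) (be k) (n - k%:Z) (n + k%:Z) dT hc1 hc2.
  rewrite real_normK ?num_real// => hh; rewrite (le_trans hh)// [leRHS]mulrA.
  rewrite ler_wpM2r//; first by apply: addr_ge0; exact: pw_ge0.
  have hab : (`|al k| + `|be k|) ^+ 2 <= (2 ^+ 6 * (4 * pi * M) / k.+1%:R ^+ 6) ^+ 2.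
    rewrite lerXn2r ?nnegrE ?addr_ge0//; last exact: fcos_fsin_bound.
    by rewrite !mulr_ge0 ?pi_ge0 ?exprn_ge0 ?invr_ge0// exprn_ge0.
  rewrite (le_trans (ler_wpM2r (sqr_ge0 _) hab))// /D.
  rewrite le_eqVlt; apply/orP; left; apply/eqP; field.
  by rewrite gt_eqF.
have shift (g : int -> int) (c0 : R) : injective g -> 0 <= c0 ->
    (forall n, wgt s n <= c0 * wgt s (g n)) ->
    \sum_(n <- F) wgt s n * pw T (g n) <= c0 * B.
  move=> ig c00 hg; have uG : uniq (map g F) by rewrite map_inj_uniq.
  have := hB _ uG; rewrite big_map => hG.
  rewrite (le_trans _ (ler_wpM2l c00 hG))// mulr_sumr; apply: ler_sum => n _.
  by rewrite mulrA; apply: ler_wpM2r; [exact: pw_ge0|exact: hg].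
have key N : \sum_(n <- F) wgt s n * (\sum_(k < N) t n k) ^+ 2 <=
    Cmul * (K * M) ^+ 2 * B.
  apply: (@le_trans _ _ (\sum_(n <- F) wgt s n * (2 * \sum_(k < N)
      4 * D ^+ 2 / k.+1%:R ^+ 6 * (pw T (n - k%:Z) + pw T (n + k%:Z))))).
    apply: ler_sum => n _; rewrite ler_wpM2l ?wgt_ge0//.
    have e0 k : 0 <= 4 * D ^+ 2 / k.+1%:R ^+ 6 * (pw T (n - k%:Z) + pw T (n + k%:Z)).
      apply: mulr_ge0; last by apply: addr_ge0; exact: pw_ge0.
      by rewrite divr_ge0 ?exprn_ge0// mulr_ge0 ?sqr_ge0.
    apply: le_trans (sum_CauchySchwarz (al := fun k : 'I_N => (k.+1%:R ^+ 2)^-1)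
      (be := fun k : 'I_N => 4 * D ^+ 2 / k.+1%:R ^+ 6 *
        (pw T (n - k%:Z) + pw T (n + k%:Z))) _ _ _ _) _ => [k|k|k|].
    - by rewrite invr_ge0 exprn_ge0.
    - exact: e0.
    - exact: tb.
    - rewrite ler_wpM2r ?sumr_ge0//.
      have := sum_inv_sqr R (leq0n N); rewrite big_mkord divr1; apply: le_trans.
      exact: lexx.
  under eq_bigr do rewrite mulrCA mulr_sumr.
  rewrite -mulr_sumr exchange_big/=.
  apply: (@le_trans _ _ (2 * \sum_(k < N) (16 * D ^+ 2 * B) * (k.+1%:R ^+ 2)^-1)).
    rewrite ler_wpM2l//; apply: ler_sum => k _.
    have k0 : 0 < k.+1%:R :> R by rewrite ltr0n.
    have k1 : 1 <= k.+1%:R :> R by rewrite ler1n.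
    have hF : \sum_(n <- F) wgt s n * (pw T (n - k%:Z) + pw T (n + k%:Z)) <=
        2 * k.+1%:R ^+ 2 * (B + B).
      under eq_bigr do rewrite mulrDr.
      rewrite big_split/= mulrDr; apply: lerD.
        apply: shift; [by move=> a b /addIr|by rewrite mulr_ge0 ?exprn_ge0|].
        by move=> n; apply: wgt_shift => //; left; rewrite subrK.
      apply: shift; [by move=> a b /addIr|by rewrite mulr_ge0 ?exprn_ge0|].
      by move=> n; apply: wgt_shift => //; right; rewrite addrK.
    under eq_bigr do rewrite mulrCA.
    rewrite -mulr_sumr.
    have d0 : 0 <= 4 * D ^+ 2 / k.+1%:R ^+ 6 by rewrite divr_ge0 ?exprn_ge0// mulr_ge0 ?sqr_ge0.
    rewrite (le_trans (ler_wpM2l d0 hF))//.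
    have -> : 4 * D ^+ 2 / k.+1%:R ^+ 6 * (2 * k.+1%:R ^+ 2 * (B + B)) =
        (16 * D ^+ 2 * B) * (k.+1%:R ^+ 4)^-1 by field; rewrite gt_eqF.
    apply: ler_wpM2l; first exact: DD.
    by rewrite lef_pV2 ?posrE ?exprn_gt0// ler_weXn2l.
  rewrite -mulr_sumr.
  have := sum_inv_sqr R (leq0n N); rewrite big_mkord divr1 => hh.
  have -> : Cmul * (K * M) ^+ 2 * B = 2 * (16 * D ^+ 2 * B * 2) by rewrite /Cmul /D; ring.
  by apply: ler_wpM2l => //; apply: ler_wpM2l.
have cv : \sum_(n <- F) wgt s n * (\sum_(k < N) t n k) ^+ 2 @[N --> \oo] -->
    \sum_(n <- F) wgt s n * y n ^+ 2.
  apply: cvgr_sum => n; apply: cvgMr.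
  by rewrite expr2; under eq_fun do rewrite expr2; apply: cvgM; exact: cvy.
by apply: cvgn_le cv _; apply: nearW.
Qed.

End Multiplication.

(** * Commutators with (-Delta)^{1/2} and the bilinear forms they control *)

Section Commutators.
Variable R : realType.
Implicit Types (f g v w Z : R -> R) (S T : distr R) (x y th eta c M : R)
  (n m : int) (N k p : nat).

Lemma Hle_add (s B B' : R) (w w' : int -> R) : Hle s w B -> Hle s w' B' ->
  Hle s (fun n => w n + w' n) (B + B').
Proof.
move=> hw hw' F uF; under eq_bigr do rewrite mulrDr.
by rewrite big_split/= lerD// ?hw ?hw'.
Qed.

Lemma eq_Hle (s B : R) (w w' : int -> R) : (forall n, w n = w' n) ->
  Hle s w B -> Hle s w' B.
Proof. by move=> /funext ->. Qed.

Definition Cop : R := 2 * Cmul R.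

Lemma Cop_ge0 : 0 <= Cop.
Proof. by rewrite mulr_ge0// Cmul_ge0. Qed.

(** [symbol_bound] with [K = 1] at the phases 0 and [pi / 2], whose squares add up to [pw]; hence
    the factor 2 in [Cop]. The offset [d] accounts for a derivative acting on the second product. *)
Lemma symbol_bound_pw (s : R) S T T1 T2 f (M B : R) (p q s1 s2 : int -> R)
    (d d1 d2 : R) :
  `|s| <= 1 -> Distr T -> Distr T1 -> Distr T2 -> SmoothS f ->
  (forall eta m, coef T1 eta m = s1 m * coef T (eta + d1) m) ->
  (forall eta m, coef T2 eta m = s2 m * coef T (eta + d2) m) ->
  d1 = d + d2 ->
  (forall n m k, (n = m + k%:Z \/ n = m - k%:Z) ->
     `|p n * s1 m - q n * s2 m| <= k.+1%:R ^+ 2) ->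
  Cbound 6 f M -> Hle s (pw T) B ->
  (forall th n, coef S th n =
     p n * coef (dmul T1 f) th n - q n * coef (dmul T2 f) (th + d) n) ->
  Hle s (pw S) (Cop * M ^+ 2 * B).
Proof.
move=> hs dT dT1 dT2 sf h1 h2 hd hK bf hB hS.
have hK1 n m k : (n = m + k%:Z \/ n = m - k%:Z) ->
    `|p n * s1 m - q n * s2 m| <= 1 * k.+1%:R ^+ 2 by rewrite mul1r; exact: hK.
have h th : Hle s (fun n => coef S th n ^+ 2) (Cmul R * (1 * M) ^+ 2 * B).
  have e : th + d1 = th + d + d2 by rewrite hd addrA.
  have := symbol_bound hs dT dT1 dT2 sf h1 h2 e hK1 bf hB.
  by apply: eq_Hle => n; rewrite hS.
have := Hle_add (h 0) (h (pi / 2)); rewrite mul1r.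
by have -> : Cmul R * M ^+ 2 * B + Cmul R * M ^+ 2 * B = Cop * M ^+ 2 * B
  by rewrite /Cop; ring.
Qed.

(** The third bound is what makes [Qop] of order zero: [|n| m - n |m|] vanishes unless the signs
    differ, and then [|n| + |m| = k], so that [2 |n| |m| <= k^2]. *)
Lemma shift_norm_le n m k : (n = m + k%:Z \/ n = m - k%:Z) ->
  [/\ `|(n%:~R : R)| - `|m%:~R| <= k%:R, `|(m%:~R : R)| - `|n%:~R| <= k%:R &
   `|(`|n%:~R| * m%:~R - n%:~R * `|m%:~R| : R)| <= k%:R ^+ 2].
Proof.
move=> nm.
have {nm} : n%:~R = m%:~R + k%:R :> R \/ n%:~R = m%:~R - k%:R :> R.
  by case: nm => ->; [left; rewrite intrD|right; rewrite intrB].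
have : 0 <= k%:R :> R by [].
move: (n%:~R : R) (m%:~R : R) (k%:R : R) => a b c c0 h.
have hab : `|a - b| = c.
  case: h => ->; first by rewrite addrAC subrr add0r ger0_norm.
  by rewrite addrAC subrr add0r normrN ger0_norm.
split.
- by rewrite -hab lerB_dist.
- by rewrite -hab distrC lerB_dist.
- move: hab; have [a0|a0] := leP 0 a; have [b0|b0] := leP 0 b.
  + by move=> _; rewrite (ger0_norm a0) (ger0_norm b0) subrr normr0 sqr_ge0.
  + rewrite (ger0_norm a0) (ltr0_norm b0) ger0_norm; last lra.
    by move=> <-; rewrite ler_norml; apply/andP; split; nra.
  + rewrite (ltr0_norm a0) (ger0_norm b0) ltr0_norm; last lra.
    by move=> <-; rewrite ler_norml; apply/andP; split; nra.
  + rewrite (ltr0_norm a0) (ltr0_norm b0) => <-.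
    have -> : - a * b - a * - b = 0 by ring.
    by rewrite normr0 sqr_ge0.
Qed.

Lemma sqr_succ_ge k : k%:R <= k.+1%:R ^+ 2 :> R /\ k%:R ^+ 2 <= k.+1%:R ^+ 2 :> R.
Proof.
have k0 : 0 <= k%:R :> R by [].
by rewrite -natr1; split; nra.
Qed.

Lemma Hle_dmul (s : R) T f (M B : R) : `|s| <= 1 -> Distr T -> SmoothS f ->
  Cbound 6 f M -> Hle s (pw T) B -> Hle s (pw (dmul T f)) (Cop * M ^+ 2 * B).
Proof.
move=> hs dT sf bf hB.
apply: (@symbol_bound_pw s _ T T T f M B (fun=> 1) (fun=> 0) (fun=> 1) (fun=> 1) 0 0 0) => //.
- by move=> eta m; rewrite mul1r addr0.
- by move=> eta m; rewrite mul1r addr0.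
- by rewrite addr0.
- by move=> n m k _; rewrite mulr1 mul0r subr0 normr1 exprn_ege1// ler1n.
- by move=> th n; rewrite mul1r mul0r subr0.
Qed.

Lemma dfun_mul f g : dfun (fun x => f x * g x) = dmul (dfun f) g.
Proof.
by apply/funext => h; rewrite /dfun /dmul; under eq_fun do rewrite -mulrA.
Qed.

(** The kernel is [|n| - |m|], bounded by the frequency shift [k]: the commutator loses no
    derivative of [v]. *)
Lemma Hle_commutator (s : R) v f (M B : R) : `|s| <= 1 -> SmoothS v -> SmoothS f ->
  Cbound 6 f M -> Hle s (pw (dfun v)) B ->
  Hle s (pw (dfun (fun x => Lam (fun y => v y * f y) x - Lam v x * f x)))
    (Cop * M ^+ 2 * B).
Proof.
move=> hs sv sf bf hB; have sL := SmoothS_Lam sv.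
have svf := smoothS_mul sv sf; have sLf := smoothS_mul sL sf.
have dv := Distr_dfun (SmoothS_Intg sv); have dL := Distr_dfun (SmoothS_Intg sL).
apply: (@symbol_bound_pw s _ (dfun v) (dfun v) (dfun (Lam v)) f M B
  (fun n => `|n%:~R|) (fun=> 1) (fun=> 1) (fun m => `|m%:~R|) 0 0 0) => //.
- by move=> eta m; rewrite mul1r addr0.
- by move=> eta m; rewrite addr0; exact: coef_Lam.
- by rewrite addr0.
- move=> n m k /shift_norm_le[h1 h2 _]; rewrite mulr1 mul1r.
  have [hk _] := sqr_succ_ge k.
  by rewrite ler_norml; apply/andP; split; lra.
- move=> th n; rewrite mul1r addr0 -dfun_mul -dfun_mul -(coef_Lam th n svf).
  by apply: coef_dfun_sub; [exact: (SmoothS_Intg (SmoothS_Lam svf))|exact: SmoothS_Intg].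
Qed.

(* Order zero in [v], although each term is of order two. *)
Definition Qop Z v x := Lam (fun y => derive1 v y * Z y) x -
  derive1 (fun y => Lam v y * Z y) x.

Lemma SmoothS_Qop Z v : SmoothS Z -> SmoothS v -> SmoothS (Qop Z v).
Proof.
move=> sZ sv; apply: smoothS_sub.
  by apply/SmoothS_Lam/smoothS_mul => //; exact: smoothS_derive1.
by apply/smoothS_derive1/smoothS_mul => //; exact: SmoothS_Lam.
Qed.

Lemma Hle_Qop (s : R) Z v (M B : R) : `|s| <= 1 -> SmoothS v -> SmoothS Z ->
  Cbound 6 Z M -> Hle s (pw (dfun v)) B ->
  Hle s (pw (dfun (Qop Z v))) (Cop * M ^+ 2 * B).
Proof.
move=> hs sv sZ bZ hB; have sL := SmoothS_Lam sv; have sv' := smoothS_derive1 sv.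
have sv'Z := smoothS_mul sv' sZ; have sLZ := smoothS_mul sL sZ.
have dv := Distr_dfun (SmoothS_Intg sv); have dL := Distr_dfun (SmoothS_Intg sL).
have dv' := Distr_dfun (SmoothS_Intg sv').
apply: (@symbol_bound_pw s _ (dfun v) (dfun (derive1 v)) (dfun (Lam v)) Z M B
  (fun n => `|n%:~R|) (fun n => n%:~R) (fun n => n%:~R) (fun m => `|m%:~R|)
  (pi / 2) (pi / 2) 0) => //.
- by move=> eta m; rewrite coef_derive1.
- by move=> eta m; rewrite addr0; exact: coef_Lam.
- by rewrite addr0.
- move=> n m k /shift_norm_le[_ _ h]; rewrite (le_trans h)//.
  by have [] := sqr_succ_ge k.
- move=> th n; rewrite -dfun_mul -dfun_mul -(coef_Lam th n sv'Z) -(coef_derive1 th n sLZ).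
  by apply: coef_dfun_sub; apply: SmoothS_Intg; [exact: SmoothS_Lam|exact: smoothS_derive1].
Qed.

(** The form Q_Z with two arguments. It is not symmetric, and it is its symmetrization that
    [Qform_Qop] expresses by an operator of order zero. *)
Definition Qform Z v w : R := intcirc (fun x => Lam v x * derive1 w x * Z x).

(** In one term the derivative is moved off [w] by parts, in the other [Lam] is moved off [w] by
    self-adjointness. *)
Lemma Qform_Qop Z v w : SmoothS Z -> SmoothS v -> SmoothS w ->
  Qform Z v w + Qform Z w v = dfun w (Qop Z v).
Proof.
move=> sZ sv sw; have sL := SmoothS_Lam sv; have sv' := smoothS_derive1 sv.
have sv'Z := smoothS_mul sv' sZ; have sLZ := smoothS_mul sL sZ.
have dw := Distr_dfun (SmoothS_Intg sw).
rewrite /Qop (distr_sub dw (SmoothS_Lam sv'Z) (smoothS_derive1 sLZ)).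
rewrite -(dfun_Lam sw sv'Z) addrC; congr (_ + _).
  by congr intcirc; apply/funext => x; rewrite mulrA.
rewrite dfunC /dfun intcirc_parts// opprK.
by congr intcirc; apply/funext => x; rewrite mulrAC.
Qed.

Lemma Qform_bound Z v w (M B B' : R) : SmoothS Z -> SmoothS v -> SmoothS w ->
  Cbound 6 Z M -> Hle 0 (pw (dfun v)) B -> Hle 0 (pw (dfun w)) B' ->
  (Qform Z v w + Qform Z w v) ^+ 2 <= Cop * M ^+ 2 * B * B'.
Proof.
move=> sZ sv sw bZ hB hB'; rewrite Qform_Qop//.
have h0 : `|0 : R| <= 1 by rewrite normr0.
rewrite [leRHS]mulrC; apply: (@distr_pairing_le _ _ _ 0).
- exact/Distr_dfun/SmoothS_Intg.
- exact: SmoothS_Qop.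
- exact: hB'.
- by rewrite oppr0; exact: Hle_Qop.
Qed.

(** Self-adjointness turns the integral into the pairing of [a] with the commutator of [Lam] and [f]
    applied to [b], which is bounded on H^{1/2}. This gain is what allows [a] in H^{-1/2}. *)
Lemma Dform_bound (a b f : R -> R) (M B B' : R) : SmoothS a -> SmoothS b -> SmoothS f ->
  Cbound 6 f M -> Hle (- 2^-1) (pw (dfun a)) B -> Hle 2^-1 (pw (dfun b)) B' ->
  intcirc (fun x => (Lam a x * b x - Lam b x * a x) * f x) ^+ 2 <=
  Cop * M ^+ 2 * B * B'.
Proof.
move=> sa sb sf bf hB hB'.
have sLa := SmoothS_Lam sa; have sLb := SmoothS_Lam sb.
have sbf := smoothS_mul sb sf; have sLbf := smoothS_mul sLb sf.
have da := Distr_dfun (SmoothS_Intg sa).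
have -> : intcirc (fun x => (Lam a x * b x - Lam b x * a x) * f x) =
    dfun a (fun x => Lam (fun y => b y * f y) x - Lam b x * f x).
  rewrite (distr_sub da (SmoothS_Lam sbf) sLbf) -(dfun_Lam sa sbf) /dfun.
  rewrite -(intcirc_sub (SmoothS_Intg (smoothS_mul sLa sbf))
    (SmoothS_Intg (smoothS_mul sa sLbf))).
  by congr intcirc; apply/funext => x; ring.
have -> : Cop * M ^+ 2 * B * B' = B * (Cop * M ^+ 2 * B') by ring.
apply: (@distr_pairing_le _ _ _ (- 2^-1)).
- exact: da.
- exact: (smoothS_sub (SmoothS_Lam sbf) sLbf).
- exact: hB.
- have -> : - - 2^-1 = 2^-1 :> R by rewrite opprK.
  apply: (Hle_commutator _ sb sf bf hB').
  by rewrite ger0_norm// invf_le1// ler1n.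
Qed.

End Commutators.

(** * Riesz-Fischer and the Dirichlet energy *)

Section RieszFischer.
Variable R : realType.
Implicit Types (f g u v w : R -> R) (S T : distr R) (x y th eta c M : R)
  (a b : nat -> R) (n m : int) (N P k p j : nat).
Local Notation mu := (@lebesgue_measure R).
Local Notation circ := (`[0%R, (2 * pi)%R]%classic : set R).

(** The frequency-[k] term of Parseval's formula, with the positive and negative frequencies of [pw]
    already merged. *)
Definition penergy T k : R := fcos T k * coef T 0 k + fsin T k * coef T (pi / 2) k.

Lemma penergyE T k : penergy T k =
  (if k == 0%N then (2 * pi)^-1 else pi^-1) * coef T 0 k ^+ 2
  + pi^-1 * coef T (pi / 2) k ^+ 2.
Proof. by rewrite /penergy /fcos /fsin -!mulrA. Qed.

Lemma penergy_ge0 T k : 0 <= penergy T k.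
Proof.
rewrite penergyE addr_ge0// mulr_ge0 ?sqr_ge0 ?invr_ge0 ?pi_ge0//.
by case: ifP => _; rewrite invr_ge0 ?twopi_ge0 ?pi_ge0.
Qed.

Lemma penergy_le_pw T k : penergy T k <= pw T k.
Proof.
have p2 := pi_ge2 R; rewrite penergyE /pw; apply: lerD.
  apply: ler_piMl; first exact: sqr_ge0.
  by case: ifP => _; rewrite invf_le1; lra.
apply: ler_piMl; first exact: sqr_ge0.
by rewrite invf_le1; lra.
Qed.

Lemma coef0_pihalf T : Distr T -> coef T (pi / 2) 0 = 0.
Proof.
move=> dT; rewrite /coef.
have -> : trig 0 (pi / 2) = fun=> 0 :> R.
  by apply/funext => x; rewrite /trig mul0r sub0r cosN cos_pihalf.
exact: distr0.
Qed.

Lemma pw_le_penergy T k : Distr T -> pw T k <= 2 * pi * penergy T k.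
Proof.
move=> dT; have p0 := pi_gt0 R; rewrite penergyE /pw mulrDr; case: ifP => [/eqP->|_].
  rewrite coef0_pihalf// expr0n/= !mulr0 !addr0 mulrA divff ?mul1r//.
  by rewrite gt_eqF// twopi_gt0.
rewrite -!mulrA !(mulrA pi) divff ?gt_eqF// !mul1r.
by have := sqr_ge0 (coef T 0 k); have := sqr_ge0 (coef T (pi / 2) k); lra.
Qed.

Lemma dfun_fsum w N : Intg w -> dfun w (fsum w N) = \sum_(k < N) penergy (dfun w) k.
Proof. by move=> hw; rewrite /fsum distr_psum//; exact: Distr_dfun. Qed.

Lemma coef_psum_eq (w : R -> R) a b N th j : Intg w -> (j < N)%N ->
  a j = fcos (dfun w) j -> b j = fsin (dfun w) j ->
  coef (dfun (psum a b N)) th j = coef (dfun w) th j.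
Proof.
move=> hw jN aE bE; rewrite coef_psum// aE bE /fcos /fsin.
have p0 : pi != 0 :> R by rewrite gt_eqF ?pi_gt0.
rewrite (coef_split th j (Distr_dfun hw)); case: ifP => [/eqP->|_].
  rewrite (coef0_pihalf (Distr_dfun hw)) !mulr0 !addr0 mulrACA mulVf ?mul1r ?(mulrC (cos _))//.
  by rewrite gt_eqF// twopi_gt0.
move: (coef _ _ _) (coef _ _ _) (cos th) (sin th) => A B c s.
move: p0; set q := pi => p0; rewrite mul1r.
have pA z : q^-1 * z * q = z by rewrite mulrAC mulVf ?mul1r.
by rewrite mulrA pA mulrA pA (mulrC A) (mulrC B).
Qed.

Lemma psum_sqr a b N : b 0%N = 0 -> intcirc (fun x => psum a b N x ^+ 2) =
  \sum_(k < N) ((if k == 0%N :> nat then 2 * pi else pi) * a k ^+ 2 + pi * b k ^+ 2).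
Proof.
move=> b0; have sp := SmoothS_psum a b N.
rewrite -[LHS]/(dfun (psum a b N) (psum a b N)) distr_psum; last exact/Distr_dfun/SmoothS_Intg.
apply: eq_bigr => k _; rewrite !coef_psum// cos0 sin0 cos_pihalf sin_pihalf.
by case: ifP => [/eqP->|_]; rewrite ?b0; ring.
Qed.

Lemma psum_sub_sqr a b N P : b 0%N = 0 -> (N <= P)%N ->
  intcirc (fun x => (psum a b P x - psum a b N x) ^+ 2) <=
  2 * pi * \sum_(N <= k < P) (a k ^+ 2 + b k ^+ 2).
Proof.
move=> b0 NP; pose a' k := if (k < N)%N then 0 else a k.
pose b' k := if (k < N)%N then 0 else b k.
have -> : (fun x => (psum a b P x - psum a b N x) ^+ 2) = fun x => psum a' b' P x ^+ 2.
  apply/funext => x; congr (_ ^+ 2); rewrite /psum.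
  rewrite -!(big_mkord xpredT (fun k => a k * trig k 0 x + b k * trig k (pi / 2) x)).
  rewrite -(big_mkord xpredT (fun k => a' k * trig k 0 x + b' k * trig k (pi / 2) x)).
  rewrite !(big_cat_nat (leq0n N) NP)/= addrAC subrr add0r.
  have -> : \sum_(0 <= k < N) (a' k * trig k 0 x + b' k * trig k (pi / 2) x) = 0.
    by rewrite big_nat big1// => k /andP[_ kN]; rewrite /a' /b' kN !mul0r addr0.
  rewrite add0r big_nat [RHS]big_nat; apply: eq_bigr => k /andP[Nk _].
  by rewrite /a' /b' ltnNge Nk.
rewrite psum_sqr; last by rewrite /b'; case: ifP.
rewrite -(big_mkord xpredT (fun k => (if k == 0%N then 2 * pi else pi) * a' k ^+ 2
  + pi * b' k ^+ 2)).
have cat (f : nat -> R) : \sum_(0 <= k < P) f k = \sum_(0 <= k < N) f k + \sum_(N <= k < P) f k.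
  by rewrite (big_cat_nat (leq0n N) NP).
rewrite cat; have -> : \sum_(0 <= k < N) ((if k == 0%N then 2 * pi else pi) * a' k ^+ 2
    + pi * b' k ^+ 2) = 0.
  by rewrite big_nat big1// => k /andP[_ kN]; rewrite /a' /b' kN expr0n/= !mulr0 addr0.
rewrite add0r mulr_sumr big_nat [leRHS]big_nat; apply: ler_sum => k /andP[Nk _].
rewrite /a' /b' (leq_gtF Nk) (mulrDr (2 * pi) (a k ^+ 2)).
have := sqr_ge0 (a k); have := sqr_ge0 (b k); move: (pi_ge0 R).
set q := pi; move: (_ ^+ 2) (_ ^+ 2) => y x q0 y0 x0.
by have := mulr_ge0 q0 y0; have := mulr_ge0 q0 x0; case: ifP => _; lra.
Qed.

Lemma bounded_series_tail (c : nat -> R) (B e : R) : (forall k, 0 <= c k) ->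
  (forall N, \sum_(k < N) c k <= B) -> 0 < e ->
  exists N0, forall N P, (N0 <= N)%N -> (N <= P)%N -> \sum_(N <= k < P) c k <= e.
Proof.
move=> c0 cB e0.
have nd : nondecreasing_seq (series c) by exact: nondecreasing_series.
have cv : cvgn (series c).
  apply: nondecreasing_is_cvgn => //; exists B => _ [N _ <-].
  by rewrite /series/= big_mkord.
have /cvgrPdist_le /(_ _ e0)[N0 _ h] := cv.
exists N0 => N P N0N NP.
have hP := nondecreasing_cvgn_le nd cv P.
have := h N N0N; rewrite /= ger0_norm ?subr_ge0 ?nondecreasing_cvgn_le// => hN.
have -> : \sum_(N <= k < P) c k = series c P - series c N.
  by rewrite /series/= (big_cat_nat (leq0n N) NP)/= addrAC subrr add0r.
by lra.
Qed.

(** The upper limit is measurable and defined at every point, so it extends the pointwise limit with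
    no exceptional set to handle. *)
Lemma measurable_periodic_limit (F : nat -> R -> R) : (forall j, SmoothS (F j)) ->
  exists w, [/\ periodicS w, measurable_fun setT w &
    forall x l, F j x @[j --> \oo] --> l -> w x = l].
Proof.
move=> sF; exists (fun x => fine (limn_esup (fun j => (F j x)%:E))); split.
- move=> x; congr (fine (limn_esup _)); apply/funext => j.
  by have [->] := sF j.
- apply: (measurableT_comp (f := fine)); first exact: fine_measurable.
  apply: measurable_fun_limn_esup => j; apply/measurable_EFinP.
  by apply: continuous_measurable_fun; exact: SmoothS_continuous.
- move=> x l cl; have cE : (F j x)%:E @[j --> \oo] --> l%:E.
    by apply: cvg_comp cl _; exact: cvg_refl.
  by have [_ ->] := cvg_limn_einf_sup cE.
Qed.

Lemma geometric_CauchySchwarz (d : nat -> R) N P :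
  (\sum_(N <= j < P) d j) ^+ 2 <=
  2 * 2^-1 ^+ N * \sum_(N <= j < P) 2 ^+ j * d j ^+ 2.
Proof.
have [PN|NP] := leqP P N; first by rewrite !big_geq// expr0n/= mulr0.
apply: (@le_trans _ _ ((\sum_(N <= j < P) 2^-1 ^+ j) * \sum_(N <= j < P) 2 ^+ j * d j ^+ 2)).
  apply: sum_CauchySchwarz => j.
  - by rewrite exprn_ge0.
  - by rewrite mulr_ge0 ?sqr_ge0 ?exprn_ge0.
  - by rewrite mulrA -exprMn mulVf// expr1n mul1r.
rewrite ler_wpM2r//; first by apply: sumr_ge0 => j _; rewrite mulr_ge0 ?sqr_ge0 ?exprn_ge0.
suff : \sum_(N <= j < P) 2^-1 ^+ j <= 2 * (2^-1 ^+ N - 2^-1 ^+ P) :> R.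
  move=> h; rewrite (le_trans h)// ler_wpM2l// gerBl exprn_ge0//.
elim: P NP => // P IH; rewrite ltnS leq_eqVlt => /predU1P[->|NP].
  by rewrite big_nat1 exprS; move: (_ ^+ _) => z; lra.
rewrite big_nat_recr ?(ltnW NP)//= (le_trans (lerD (IH NP) (lexx _)))// exprS.
by move: (_ ^+ P) (_ ^+ N) => z z'; lra.
Qed.

(* Beppo Levi for [E = \sum_j 2^j (F (j+1) - F j)^2]: where [E] is finite, [F j]
   converges and its limit [w] satisfies [(w - F j)^2 <= 2^(1-j) E]. *)
Lemma fast_cauchy_limit (F : nat -> R -> R) : (forall j, SmoothS (F j)) ->
  (forall j, intcirc (fun x => (F j.+1 x - F j x) ^+ 2) <= 4^-1 ^+ j) ->
  exists w, L2S w /\ forall j, intcirc (fun x => (w x - F j x) ^+ 2) <= 4 * 2^-1 ^+ j.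
Proof.
move=> sF hF; have [w [pw mw hw]] := measurable_periodic_limit sF.
pose d j x := F j.+1 x - F j x.
have sd j : SmoothS (d j) by exact: smoothS_sub.
pose e j x := 2 ^+ j * d j x ^+ 2.
have se j : SmoothS (e j) by apply: smoothS_scale; exact: smoothS_mul.
have e0 j x : (0 <= (e j x)%:E)%E by rewrite lee_fin mulr_ge0 ?sqr_ge0 ?exprn_ge0.
pose E x := (\sum_(0 <= j <oo) (e j x)%:E)%E.
have me j : measurable_fun circ (fun x => (e j x)%:E).
  by apply/measurable_EFinP; apply: Intg_measurable; exact: SmoothS_Intg.
have mE : measurable_fun circ E.
  exact: ge0_emeasurable_sum.
have intE : (\int[mu]_(x in circ) E x <= 2%:E)%E.
  rewrite /E integral_nneseries//.
  apply: lime_le; first by apply: is_cvg_nneseries => j _ _; exact: integral_ge0.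
  apply: nearW => J; apply: (@le_trans _ _ (\sum_(0 <= j < J) (2^-1 ^+ j)%:E)%E).
    apply: lee_sum => j _.
    have fin : (\int[mu]_(x in circ) (e j x)%:E)%E \is a fin_num.
      by apply: integrable_fin_num => //; exact/IntgE/SmoothS_Intg.
    rewrite -(fineK fin) lee_fin -[leLHS]/(intcirc (e j)).
    rewrite /e intcirc_scale; last exact/SmoothS_Intg/smoothS_mul.
    rewrite (le_trans (ler_wpM2l _ (hF j)))// ?exprn_ge0//.
    by rewrite -exprMn (_ : 2 * 4^-1 = 2^-1)//; lra.
  rewrite sumEFin lee_fin.
  suff : \sum_(0 <= j < J) 2^-1 ^+ j = 2 - 2 * 2^-1 ^+ J :> R.
    by move=> ->; rewrite gerBl mulr_ge0// exprn_ge0.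
  elim: J => [|J IH]; first by rewrite big_geq// expr0; lra.
  by rewrite big_nat_recr//= IH exprS; move: (_ ^+ J) => z; lra.
have diff N P x : (N <= P)%N -> F P x - F N x = \sum_(N <= j < P) d j x.
  by move=> NP; rewrite /d telescope_sumr.
have dom N x : (((w x - F N x) ^+ 2)%:E <= (2 * 2^-1 ^+ N)%:E * E x)%E.
  have c0 : 0 < 2 * 2^-1 ^+ N :> R by rewrite mulr_gt0 ?exprn_gt0.
  (* Where [E] is infinite the bound is trivial since its factor is positive; elsewhere the sequence
     [F j x] is Cauchy. *)
  have [Ey|Efin] := eqVneq (E x) +oo%E; first by rewrite Ey gt0_muley ?lte_fin// leey.
  have E0 : (0 <= E x)%E by apply: nneseries_ge0 => j _ _.
  have {}Efin : E x \is a fin_num by rewrite ge0_fin_numE// lt_neqAle Efin leey.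
  rewrite -(fineK Efin) -EFinM lee_fin; set Er := fine (E x).
  have Er0 : 0 <= Er by rewrite fine_ge0.
  have sumE N' P : \sum_(N' <= j < P) e j x <= Er.
    have [PN|NP] := leqP P N'; first by rewrite big_geq.
    apply: (@le_trans _ _ (\sum_(0 <= j < P) e j x)).
      rewrite (big_cat_nat (leq0n N') (ltnW NP))/= lerDr; apply: sumr_ge0 => j _.
      by rewrite -lee_fin.
    rewrite -lee_fin -sumEFin /Er fineK//; exact: nneseries_lim_ge.
  have bd N' P : (N' <= P)%N -> (F P x - F N' x) ^+ 2 <= 2 * 2^-1 ^+ N' * Er.
    move=> NP; rewrite diff// (le_trans (geometric_CauchySchwarz _ _ _))//.
    by rewrite ler_wpM2l ?mulr_ge0 ?exprn_ge0//; exact: sumE.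
  have H1 N' P : (N' <= P)%N -> `|F P x - F N' x| <= Num.sqrt (2 * 2^-1 ^+ N' * Er).
    move=> NP; rewrite -sqrtr_sqr ler_sqrt ?mulr_ge0 ?exprn_ge0//; exact: bd.
  have H2 : Num.sqrt (2 * 2^-1 ^+ N' * Er) @[N' --> \oo] --> 0.
    rewrite -(sqrtr0 R); apply: (@cvg_comp _ _ _ _ Num.sqrt _ (nbhs (0 : R))); last first.
      exact: sqrt_continuous.
    rewrite -(mul0r Er); apply: cvgMl; rewrite -(mulr0 2); apply: cvgMr.
    by apply: cvg_expr; rewrite ger0_norm// invf_lt1// ltr1n.
  have [cF _] := cvg_of_modulus (u := fun P => F P x) H1 H2.
  rewrite (hw _ _ cF); move: (lim _) cF => l cF.
  have cv : (F P x - F N x) ^+ 2 @[P --> \oo] --> (l - F N x) ^+ 2.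
    rewrite expr2; under eq_fun do rewrite expr2.
    by apply: cvgM; apply: cvgB => //; exact: cvg_cst.
  apply: cvgn_le cv _; exists N => // P /= NP; exact: bd.
have mwF N : measurable_fun circ (fun x => (w x - F N x) ^+ 2).
  apply: measurable_funX; apply: measurable_funB; first exact: measurable_funTS.
  by apply: Intg_measurable; exact: SmoothS_Intg.
have intw N : (\int[mu]_(x in circ) ((w x - F N x) ^+ 2)%:E <= (4 * 2^-1 ^+ N)%:E)%E.
  apply: (@le_trans _ _ (\int[mu]_(x in circ) ((2 * 2^-1 ^+ N)%:E * E x))%E).
    apply: ge0_le_integral => //.
    - by move=> x _; rewrite lee_fin sqr_ge0.
    - by apply/measurable_EFinP; exact: mwF.
    - by apply: emeasurable_funM => //; exact: measurable_cst.
  rewrite ge0_integralZl//; last by move=> x _; apply: nneseries_ge0.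
  apply: (@le_trans _ _ ((2 * 2^-1 ^+ N)%:E * 2%:E)%E).
    by rewrite lee_wpmul2l// lee_fin mulr_ge0 ?exprn_ge0.
  by rewrite -EFinM lee_fin; move: (_ ^+ N) => z; lra.
have iw N : Intg (fun x => (w x - F N x) ^+ 2).
  split; apply/integrableP; split; first by apply/measurable_EFinP; exact: mwF.
  under eq_integral do rewrite /= ger0_norm ?sqr_ge0//.
  by rewrite (le_lt_trans (intw N))// ltry.
exists w; split.
  have hwF : L2S (fun x => w x - F 0%N x).
    apply: L2S_intro => //.
    - by move=> x; rewrite pw; have [->] := sF 0%N.
    - apply: measurable_funB => //.
      by apply: continuous_measurable_fun; exact: SmoothS_continuous.
  have := L2S_add hwF (SmoothS_L2S (sF 0%N)).
  by under eq_fun do rewrite subrK.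
move=> N; rewrite -lee_fin /intcirc /Rintegral fineK//.
by apply: integrable_fin_num => //; exact: (IntgE (iw N)).
Qed.

Lemma intcirc_sqr_add_le f g : L2S f -> L2S g ->
  intcirc (fun x => (f x + g x) ^+ 2) <=
  2 * intcirc (fun x => f x ^+ 2) + 2 * intcirc (fun x => g x ^+ 2).
Proof.
move=> hf hg; have [If Ig] := (L2S_Intg_sqr hf, L2S_Intg_sqr hg).
rewrite -!intcirc_scale// -intcirc_add; try exact: Intg_scale.
apply: intcirc_le; first exact/L2S_Intg_sqr/L2S_add.
  by apply: Intg_add; exact: Intg_scale.
move=> x _; have := sqr_ge0 (f x - g x).
by move: (f x) (g x) => y z; nra.
Qed.

Lemma riesz_fischer a b (B : R) : b 0%N = 0 ->
  (forall N, \sum_(k < N) (a k ^+ 2 + b k ^+ 2) <= B) ->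
  exists w, L2S w /\ intcirc (fun x => (w x - psum a b N x) ^+ 2) @[N --> \oo] --> 0.
Proof.
move=> b0 hB.
have c0 k : 0 <= a k ^+ 2 + b k ^+ 2 by rewrite addr_ge0 ?sqr_ge0.
have e0 j : 0 < 4^-1 ^+ j / (2 * pi) :> R by rewrite divr_gt0 ?twopi_gt0 ?exprn_gt0.
have /choice[nu hnu] := fun j => bounded_series_tail c0 hB (e0 j).
(* Summing makes the indices nondecreasing while keeping [nu j <= m j]. *)
pose m j := (\sum_(i < j.+1) nu i)%N.
have numj j : (nu j <= m j)%N by rewrite /m big_ord_recr/= leq_addl.
have mS j : (m j <= m j.+1)%N by rewrite /m [leqRHS]big_ord_recr/= leq_addr.
have tail j N : (m j <= N)%N ->
    intcirc (fun x => (psum a b N x - psum a b (m j) x) ^+ 2) <= 4^-1 ^+ j.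
  move=> jN; have h := psum_sub_sqr a b0 jN; apply: (le_trans h).
  have := ler_wpM2l (twopi_ge0 R) (hnu j _ _ (numj j) jN).
  by rewrite [X in _ <= X]mulrC divfK// gt_eqF// twopi_gt0.
have sF j := SmoothS_psum a b (m j).
have [w [hw cw]] := fast_cauchy_limit sF (fun j => tail j _ (mS j)).
exists w; split=> //.
(* [10 = 2 * 4 + 2 * 1]: the distance from [w] to the subsequence and the tail beyond [m j], each
   doubled by [intcirc_sqr_add_le]. *)
have c10 : 10 * 2^-1 ^+ j @[j --> \oo] --> (0 : R).
  rewrite -(mulr0 10); apply: cvgn_scale; apply: cvg_expr.
  by rewrite ger0_norm// invf_lt1// ltr1n.
apply/cvgrPdist_le => e ep.
have /cvgrPdist_le /(_ _ ep)[j _ /(_ j (leqnn j))] := c10.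
rewrite /= sub0r normrN ger0_norm ?mulr_ge0 ?exprn_ge0// => je.
exists (m j) => // N /= jN; rewrite sub0r normrN ger0_norm; last first.
  by apply: intcirc_ge0 => x _; exact: sqr_ge0.
have h1 : L2S (fun x => w x - psum a b (m j) x).
  by apply: L2S_sub => //; exact/SmoothS_L2S/SmoothS_psum.
have h2 : L2S (fun x => psum a b (m j) x - psum a b N x).
  by apply: L2S_sub; exact/SmoothS_L2S/SmoothS_psum.
have := intcirc_sqr_add_le h1 h2; rewrite (eq_intcirc (g := fun x => (w x - psum a b N x) ^+ 2)); last first.
  by move=> x _; congr (_ ^+ 2); rewrite addrA subrK.
rewrite (eq_intcirc (f := fun x => (psum a b (m j) x - psum a b N x) ^+ 2)
  (g := fun x => (psum a b N x - psum a b (m j) x) ^+ 2)); last first.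
  by move=> x _; rewrite -sqrrN opprB.
move=> h; apply: le_trans h (le_trans _ je).
have q : 4^-1 ^+ j <= 2^-1 ^+ j :> R by rewrite lerXn2r ?nnegrE// lef_pV2 ?posrE// ler_nat.
by have := cw j; have := tail j N jN; lra.
Qed.

Lemma L2_limit_coef w (F : nat -> R -> R) th k : L2S w -> (forall N, SmoothS (F N)) ->
  intcirc (fun x => (w x - F N x) ^+ 2) @[N --> \oo] --> 0 ->
  coef (dfun (F N)) th k @[N --> \oo] --> coef (dfun w) th k.
Proof.
move=> hw sF c0.
pose C : R := intcirc (fun x => trig k th x ^+ 2).
have C0 : 0 <= C by apply: intcirc_ge0 => x _; exact: sqr_ge0.
have st := SmoothS_trig k th.
apply: (@cvg_dist_le _ _ (fun N => Num.sqrt (intcirc (fun x => (w x - F N x) ^+ 2) * C))).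
  move=> N; rewrite distrC -sqrtr_sqr ler_sqrt; last first.
    by rewrite mulr_ge0// intcirc_ge0// => x _; exact: sqr_ge0.
  rewrite -coef_dfun_sub; last 2 first.
    - exact: L2S_Intg.
    - exact: SmoothS_Intg.
  apply: intcirc_CauchySchwarz; last exact: SmoothS_L2S.
  by apply: L2S_sub => //; exact: SmoothS_L2S.
rewrite -(sqrtr0 R); apply: (@cvg_comp _ _ _ _ Num.sqrt _ (nbhs (0 : R))); last first.
  exact: sqrt_continuous.
by rewrite -(mul0r C); apply: cvgMl.
Qed.

Lemma riesz_fischer_coef a b (B : R) : b 0%N = 0 ->
  (forall N, \sum_(k < N) (a k ^+ 2 + b k ^+ 2) <= B) ->
  exists w, [/\ L2S w, intcirc (fun x => (w x - psum a b N x) ^+ 2) @[N --> \oo] --> 0 &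
    forall k th, coef (dfun w) th k = a k * ((if k == 0%N then 2 else 1) * pi * cos th)
      + b k * (if k == 0%N then 0 else pi * sin th)].
Proof.
move=> b0 hB; have [w [hw cw]] := riesz_fischer b0 hB; exists w; split=> // k th.
have /cvg_lim <- := L2_limit_coef (th := th) (k := k) hw (SmoothS_psum a b) cw; last by [].
apply: cvg_lim => //; apply: cvg_near_cst; exists k.+1 => // N /= kN.
by rewrite coef_psum.
Qed.

Lemma fsum_defect w N : L2S w -> intcirc (fun x => (w x - fsum w N x) ^+ 2) =
  intcirc (fun x => w x ^+ 2) - \sum_(k < N) penergy (dfun w) k.
Proof.
move=> hw; have Iw := L2S_Intg hw; have sp := SmoothS_psum (fcos (dfun w)) (fsin (dfun w)) N.
have E1 : intcirc (fun x => w x * fsum w N x) = \sum_(k < N) penergy (dfun w) k.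
  exact: dfun_fsum.
have E2 : intcirc (fun x => fsum w N x ^+ 2) = \sum_(k < N) penergy (dfun w) k.
  rewrite -[LHS]/(dfun (fsum w N) (fsum w N)) {2}/fsum distr_psum; last exact/Distr_dfun/SmoothS_Intg.
  by apply: eq_bigr => k _; rewrite /penergy !(coef_psum_eq _ Iw).
have Im : Intg (fun x => 2 * (w x * fsum w N x)).
  by apply: Intg_scale; apply: L2S_Intg_mul => //; exact: SmoothS_L2S.
have I2 : Intg (fun x => fsum w N x ^+ 2) by exact/L2S_Intg_sqr/SmoothS_L2S.
rewrite (eq_intcirc (g := fun x => w x ^+ 2 - 2 * (w x * fsum w N x) + fsum w N x ^+ 2)); last first.
  by move=> x _; rewrite sqrrB mulr_natl.
rewrite intcirc_add//; last by apply: Intg_sub => //; exact: L2S_Intg_sqr.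
rewrite intcirc_sub//; last exact: L2S_Intg_sqr.
rewrite intcirc_scale; last by apply: L2S_Intg_mul => //; exact: SmoothS_L2S.
by rewrite E1 E2; lra.
Qed.

Lemma bessel w N : L2S w -> \sum_(k < N) penergy (dfun w) k <= intcirc (fun x => w x ^+ 2).
Proof.
move=> hw; rewrite -subr_ge0 -fsum_defect//.
by apply: intcirc_ge0 => x _; exact: sqr_ge0.
Qed.

Lemma fcos_fsin_sqr_le T k : fcos T k ^+ 2 + fsin T k ^+ 2 <= penergy T k.
Proof.
rewrite penergyE /fcos /fsin.
have h (q z : R) : 1 <= q -> (q^-1 * z) ^+ 2 <= q^-1 * z ^+ 2.
  move=> q1; rewrite exprMn ler_wpM2r ?sqr_ge0// expr2 ler_piMr ?invr_ge0 ?invf_le1; lra.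
by apply: lerD; [case: ifP => _|]; apply: h; have := pi_ge2 R; lra.
Qed.

(** Bessel's inequality and Riesz-Fischer provide an L^2 limit of the partial sums; it has the
    coefficients of [w], hence equals [w] in L^2 by uniqueness. *)
Lemma L2S_fsum_cvg w : L2S w ->
  intcirc (fun x => (w x - fsum w N x) ^+ 2) @[N --> \oo] --> 0.
Proof.
move=> hw; have dw := Distr_dfun (L2S_Intg hw).
have b0 : fsin (dfun w) 0 = 0 by rewrite /fsin coef0_pihalf// mulr0.
have hB N : \sum_(k < N) (fcos (dfun w) k ^+ 2 + fsin (dfun w) k ^+ 2) <= intcirc (fun x => w x ^+ 2).
  apply: le_trans (bessel N hw); apply: ler_sum => k _; exact: fcos_fsin_sqr_le.
have [v [hv cv vE]] := riesz_fischer_coef b0 hB.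
have vw th k : coef (dfun v) th k = coef (dfun w) th k.
  rewrite vE -(@coef_psum_eq w (fcos (dfun w)) (fsin (dfun w)) k.+1 th k)//; last exact: L2S_Intg.
  by rewrite coef_psum.
have d0 : intcirc (fun x => (w x - v x) ^+ 2) = 0.
  apply: L2S_coef0; first exact: L2S_sub.
    by move=> k; rewrite coef_dfun_sub ?vw ?subrr//; exact: L2S_Intg.
  by move=> k; rewrite coef_dfun_sub ?vw ?subrr//; exact: L2S_Intg.
apply: (@cvg_dist_le _ _ (fun N => 2 * intcirc (fun x => (v x - fsum w N x) ^+ 2))); last first.
  by rewrite -(mulr0 2); apply: cvgn_scale.
move=> N; rewrite subr0 ger0_norm; last by apply: intcirc_ge0 => x _; exact: sqr_ge0.
have h1 : L2S (fun x => w x - v x) by exact: L2S_sub.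
have h2 : L2S (fun x => v x - fsum w N x).
  by apply: L2S_sub => //; exact/SmoothS_L2S/SmoothS_psum.
have := intcirc_sqr_add_le h1 h2; rewrite d0 mulr0 add0r.
rewrite (eq_intcirc (g := fun x => (w x - fsum w N x) ^+ 2))//.
by move=> x _; congr (_ ^+ 2); rewrite addrA subrK.
Qed.

Lemma parseval w : L2S w ->
  \sum_(k < N) penergy (dfun w) k @[N --> \oo] --> intcirc (fun x => w x ^+ 2).
Proof.
move=> hw; apply: cvg_dist_le (L2S_fsum_cvg hw) => N.
rewrite distrC fsum_defect// ger0_norm// subr_ge0; exact: bessel.
Qed.

Lemma penergy_scale T S c k : coef S 0 k = c * coef T 0 k ->
  coef S (pi / 2) k = c * coef T (pi / 2) k -> penergy S k = c ^+ 2 * penergy T k.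
Proof. by rewrite !penergyE => -> ->; rewrite !(exprMn 2 c) (mulrDr (c ^+ 2)) !(mulrCA (c ^+ 2)). Qed.

Lemma powR_quarter (k : nat) : ((`|k%:~R| : R) `^ (2 * 4^-1)) = Num.sqrt k%:R.
Proof.
by rewrite -pmulrn ger0_norm// -powR12_sqrt//; congr (_ `^ _); lra.
Qed.

(** The bound makes the coefficients [sqrt k] times those of [u] square summable; Riesz-Fischer
    turns them into a witness for [laplL2], and Parseval evaluates its square integral. *)
Lemma laplL2_energy u (B : R) : L2S u -> (forall N, \sum_(k < N) k%:R * penergy (dfun u) k <= B) ->
  Intg (fun x => laplL2 4^-1 u x ^+ 2) /\
  \sum_(k < N) k%:R * penergy (dfun u) k @[N --> \oo] -->
    intcirc (fun x => laplL2 4^-1 u x ^+ 2).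
Proof.
move=> hu hB; have Iu := L2S_Intg hu; have du := Distr_dfun Iu.
pose a k := Num.sqrt k%:R * fcos (dfun u) k.
pose b k := Num.sqrt k%:R * fsin (dfun u) k.
have sq k : (Num.sqrt k%:R : R) ^+ 2 = k%:R by rewrite sqr_sqrtr.
have b0 : b 0%N = 0 by rewrite /b sqrtr0 mul0r.
have hab N : \sum_(k < N) (a k ^+ 2 + b k ^+ 2) <= B.
  apply: le_trans (hB N); apply: ler_sum => k _.
  have -> : a k ^+ 2 + b k ^+ 2 = k%:R * (fcos (dfun u) k ^+ 2 + fsin (dfun u) k ^+ 2).
    by rewrite /a /b; move: (fcos _ _) (fsin _ _) => y z; rewrite !exprMn !sq mulrDr.
  by apply: ler_wpM2l (fcos_fsin_sqr_le _ _); exact: ler0n.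
have [w [hw _ wE]] := riesz_fischer_coef b0 hab.
have wE' th (k : nat) : coef (dfun w) th k = Num.sqrt k%:R * coef (dfun u) th k.
  rewrite wE -(@coef_psum_eq u (fcos (dfun u)) (fsin (dfun u)) k.+1 th k)//.
  by rewrite coef_psum// /a /b (mulrDr (Num.sqrt _)) !(mulrA (Num.sqrt _)).
have wZ th (n : int) : coef (dfun w) th n = `|n%:~R| `^ (2 * 4^-1) * coef (dfun u) th n.
  have [k [->|->]] : exists k : nat, n = k \/ n = - k%:Z.
      by case: n => k; [exists k; left|exists k.+1; right; rewrite NegzE].
    by rewrite powR_quarter wE'.
  by rewrite !coefNz mulrNz normrN powR_quarter wE'.
have dw := Distr_dfun (L2S_Intg hw).
have [dL cL eL] := lapl_spec dw du wZ.
have [hl el] : L2S (laplL2 4^-1 u) /\ eq_distr (dfun (laplL2 4^-1 u)) (lapl 4^-1 (dfun u)).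
  apply: (@getPex _ [set v | L2S v /\ eq_distr (dfun v) (lapl 4^-1 (dfun u))]).
  by exists w; split=> // f /SmoothSP sf; rewrite eL.
split; first exact: L2S_Intg_sqr.
apply: eq_cvgn (parseval hl) => N; apply: eq_bigr => k _.
rewrite -[X in X * _]sq; apply/esym/penergy_scale.
- by rewrite -powR_quarter -cL; apply: el; exact/SmoothSP/SmoothS_trig.
- by rewrite -powR_quarter -cL; apply: el; exact/SmoothSP/SmoothS_trig.
Qed.

Lemma Lam_energy v : SmoothS v ->
  \sum_(k < N) k%:R * penergy (dfun v) k @[N --> \oo] --> intcirc (fun x => v x * Lam v x).
Proof.
move=> sv; have Iv := SmoothS_Intg sv; have sL := SmoothS_Lam sv.
have := distr_fsum_cvg (Distr_dfun Iv) sL; apply: eq_cvgn => N.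
rewrite /fsum distr_psum; last exact: Distr_dfun.
apply: eq_bigr => k _; rewrite /penergy /fcos /fsin !coef_Lam// -pmulrn ger0_norm//.
move: (coef _ _ _) (coef _ _ _) k%:R => y z j.
by rewrite (mulrDr j) !(mulrCA _ j) -!(mulrA j).
Qed.

End RieszFischer.

(** * Flows of vector fields *)

Section Flows.
Variable R : realType.
Implicit Types (f g h v w Z : R -> R) (t s x y z c M L : R).

Lemma quadratic_is_derive_near f x (l K : R) :
  (forall y, `|y - x| <= 1 -> `|f y - f x - (y - x) * l| <= K * (y - x) ^+ 2) ->
  is_derive x 1 f l.
Proof.
(* [f2] continues [f] by its tangent line outside the unit ball, so that the remainder bound becomes
   global. *)
move=> h; pose f2 y := if `|y - x| <= 1 then f y else f x + (y - x) * l.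
have f2x : f2 x = f x by rewrite /f2 subrr normr0 ler01.
have K0 : 0 <= K.
  have := h (x + 1); rewrite addrAC subrr add0r normr1 lexx expr1n mulr1 => /(_ isT).
  exact: le_trans.
apply: (@near_eq_is_derive _ _ _ f2).
  near=> y; rewrite /f2; case: ifP => // /negP[].
  by near: y; exists 1 => //= y; rewrite distrC => /ltW.
apply: (@quadratic_is_derive _ f2 x l K) => y; rewrite f2x /f2.
case: ifP => [|_]; first exact: h.
have -> : f x + (y - x) * l - f x - (y - x) * l = 0 by ring.
rewrite normr0; apply: mulr_ge0 => //; exact: sqr_ge0.
Unshelve. all: by end_near. Qed.

Lemma is_derive_bound f x l K : is_derive x 1 f l ->
  (forall y, `|f y - f x| <= K * `|y - x|) -> `|l| <= K.
Proof.
move=> fl h.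
have dq : h0^-1 *: (f (h0 *: (1 : R) + x) - f x) @[h0 --> (0 : R)^'] --> l.
  by have := @ex_derive _ _ _ _ _ _ _ fl; rewrite /derivable => /cvg_ex[a ca];
    rewrite -(@derive_val _ _ _ _ _ _ _ fl) /derive (cvg_lim _ ca).
have dn := cvg_norm dq; rewrite -(cvg_lim (@Rhausdorff R) (dn _)).
apply: limr_le; first exact: cvgP (dn _).
near=> z.
have z0 : z != 0 by near: z; exact: nbhs_dnbhs_neq.
rewrite -[_ *: (1 : R)]/(_ * _) mulr1 -[_ *: _]/(_ * _) normrM normfV.
by rewrite ler_pdivrMl ?normr_gt0// mulrC; have := h (z + x); rewrite addrK.
Unshelve. all: by end_near. Qed.

Lemma is_derive_affine (c d s : R) : is_derive s 1 (fun s : R => c * s + d) c.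
Proof.
apply: (@quadratic_is_derive _ _ s c 0) => y.
by rewrite (_ : _ - _ = 0) ?normr0 ?mul0r//; ring.
Qed.

(** Gronwall's argument: [(y - z)^2 e^(-2Ls)] has a nonpositive derivative. *)
Lemma ode_contract Z L (y z : R -> R) :
  (forall a b : R, `|Z a - Z b| <= L * `|a - b|) ->
  (forall s : R, is_derive s 1 y (Z (y s))) -> (forall s : R, is_derive s 1 z (Z (z s))) ->
  forall t, 0 <= t -> `|y t - z t| <= expR (L * t) * `|y 0 - z 0|.
Proof.
move=> hL hy hz t t0.
pose d s := y s - z s; pose e s := expR (- (2 * L) * s).
have dd (s : R) : is_derive s 1 d (Z (y s) - Z (z s)) by exact: is_deriveB.
have de (s : R) : is_derive s 1 e (e s * - (2 * L)).
  apply: (@is_derive1_comp _ expR (fun s => - (2 * L) * s)).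
  by have := is_derive_affine (- (2 * L)) 0 s; under eq_fun do rewrite addr0.
pose F s := d s * d s * e s.
pose dF s := e s * (2 * (d s * (Z (y s) - Z (z s)) - L * d s ^+ 2)).
have hF (s : R) : is_derive s 1 F (dF s).
  have h1 : is_derive s 1 (fun s => d s * d s) (2 * (d s * (Z (y s) - Z (z s)))).
    by apply: is_derive_eq; rewrite /GRing.scale/=; ring.
  have -> : dF s = d s * d s * (e s * - (2 * L)) + e s * (2 * (d s * (Z (y s) - Z (z s)))).
    by rewrite /dF; ring.
  exact: is_deriveM.
have dF0 s : dF s <= 0.
  rewrite /dF; apply: mulr_ge0_le0; first exact: expR_ge0.
  apply: mulr_ge0_le0 => //; rewrite subr_le0 (le_trans (ler_norm _))// normrM.
  rewrite -real_normK ?num_real// expr2 mulrCA; apply: ler_wpM2l => //; exact: hL.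
have [c _] := MVT_between hF 0 t; rewrite subr0 => FE.
have Ft : F t <= F 0.
  by rewrite -subr_le0 FE; apply: mulr_le0_ge0.
move: Ft; rewrite /F /e mulr0 expR0 mulr1 -!expr2 mulNr expRN => Ft.
rewrite -(@ler_pXn2r _ 2)// ?nnegrE ?mulr_ge0 ?expR_ge0// exprMn !real_normK ?num_real//.
move: Ft; rewrite ler_pdivrMr ?expR_gt0// -expRM_natl mulrA -[X in expR X]mulrA.
by rewrite [X in _ <= X]mulrC.
Qed.

Lemma ode_lipschitz Z L (y z : R -> R) :
  (forall a b : R, `|Z a - Z b| <= L * `|a - b|) ->
  (forall s : R, is_derive s 1 y (Z (y s))) -> (forall s : R, is_derive s 1 z (Z (z s))) ->
  forall t, `|y t - z t| <= expR (L * `|t|) * `|y 0 - z 0|.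
Proof.
move=> hL hy hz t; have [t0|t0] := leP 0 t; first by rewrite (ger0_norm t0); exact: (ode_contract hL hy hz).
have rev (u : R -> R) : (forall s : R, is_derive s 1 u (Z (u s))) ->
    forall s : R, is_derive s 1 (fun s => u (- s)) (- Z (u (- s))).
  move=> hu s; apply: is_derive_eq.
  by rewrite mulrN1.
have hL' (a b : R) : `|- Z a - - Z b| <= L * `|a - b| by rewrite -opprD normrN; exact: hL.
have := ode_contract hL' (rev _ hy) (rev _ hz) (t := - t).
by rewrite oppr_ge0 oppr0 opprK (ltr0_norm t0); apply; exact: ltW.
Qed.

Variables (Z : R -> R) (psi : R -> R -> R).
Hypotheses (sZ : SmoothS Z) (fl : is_flow Z psi).

Lemma flow0 x : psi 0 x = x. Proof. by have [] := fl. Qed.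

Lemma is_derive_flow t x : is_derive t 1 (fun s => psi s x) (Z (psi t x)).
Proof. by have [_ h _ _] := fl. Qed.

Lemma smooth_flow t : Smooth (psi t).
Proof. by have [_ _ h _] := fl; exact: MkSmooth. Qed.

Lemma flowD2pi t x : psi t (x + 2 * pi) = psi t x + 2 * pi.
Proof. by have [] := fl. Qed.

Lemma SmoothS_Lipschitz f M : SmoothS f -> Cbound 1 f M ->
  forall x y, `|f x - f y| <= M * `|x - y|.
Proof.
move=> [_ sf] /CboundS[_ /Cbound0 fM]; apply: MVT_bound => // x.
exact: smooth_derivable.
Qed.

(** As functions of [s] both sides solve the same differential equation and agree at 0. *)
Lemma flow_group t s x : psi (t + s) x = psi s (psi t x).
Proof.
have [M ZM] := smoothS_Cbound 1 sZ; have hL := SmoothS_Lipschitz sZ ZM.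
apply/eqP; rewrite -subr_eq0 -normr_le0.
have h1 (r : R) : is_derive r 1 (fun r => psi (t + r) x) (Z (psi (t + r) x)).
  apply: is_derive_eq; first apply: (@is_derive1_comp _ (fun r => psi r x) (fun r => t + r)).
  - exact: is_derive_flow.
  - by rewrite add0r !mulr1.
have := ode_lipschitz hL h1 (fun r => is_derive_flow r (psi t x)) s.
by rewrite addr0 flow0 subrr normr0 mulr0.
Qed.

Lemma flow_near_id M t x : Cbound 0 Z M -> `|psi t x - x| <= M * `|t|.
Proof.
move=> /Cbound0 ZM; have [c _] := MVT_between (fun s => is_derive_flow s x) 0 t.
by rewrite flow0 subr0 => ->; rewrite normrM ler_wpM2r.
Qed.

Lemma flow_Lipschitz M t x y : Cbound 1 Z M ->
  `|psi t x - psi t y| <= expR (M * `|t|) * `|x - y|.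
Proof.
move=> ZM; have hL := SmoothS_Lipschitz sZ ZM.
by have := ode_lipschitz hL (is_derive_flow^~ x) (is_derive_flow^~ y) t; rewrite !flow0.
Qed.

Lemma flow_diff_near_id M t x y : Cbound 1 Z M -> `|t| <= 1 ->
  `|psi t x - psi t y - (x - y)| <= M * expR M * `|t| * `|x - y|.
Proof.
move=> ZM t1; have hL := SmoothS_Lipschitz sZ ZM; have M0 := Cbound_ge0 ZM.
have h (s : R) : is_derive s 1 (fun s => psi s x - psi s y) (Z (psi s x) - Z (psi s y)).
  by apply: is_deriveB; exact: is_derive_flow.
have [c c1] := MVT_between h 0 t; rewrite !subr0 !flow0 in c1 * => ->.
rewrite normrM mulrAC; apply: ler_wpM2r => //.
rewrite -mulrA; apply: (le_trans (hL _ _)); apply: ler_wpM2l => //.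
apply: (le_trans (flow_Lipschitz _ _ _ ZM)); apply: ler_wpM2r => //.
by rewrite ler_expR -[leRHS]mulr1 ler_wpM2l// (le_trans c1).
Qed.

Lemma derive1_flow_near1 M t x : Cbound 1 Z M -> `|t| <= 1 ->
  `|derive1 (psi t) x - 1| <= M * expR M * `|t|.
Proof.
move=> ZM t1.
have h : is_derive x 1 (fun x => psi t x - x) (derive1 (psi t) x - 1).
  apply: (@is_deriveB _ _ _ (psi t) (fun x => x)).
  exact/smooth_is_derive/smooth_flow.
apply: is_derive_bound h _ => y.
have -> : psi t y - y - (psi t x - x) = psi t y - psi t x - (y - x) by ring.
exact: flow_diff_near_id.
Qed.

Lemma derive1_flow_bound M t x : Cbound 1 Z M -> `|t| <= 1 ->
  `|derive1 (psi t) x| <= 1 + M * expR M.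
Proof.
move=> ZM t1; rewrite -[X in `|X|](subrK 1) (le_trans (ler_normD _ _))//.
rewrite normr1 addrC lerD2l (le_trans (derive1_flow_near1 x ZM t1))//.
by rewrite -[leRHS]mulr1 ler_wpM2l// mulr_ge0 ?expR_ge0// (Cbound_ge0 ZM).
Qed.

Lemma SmoothS_flow w t : SmoothS w -> SmoothS (w \o psi t).
Proof.
move=> [pw sw]; split; first by move=> x; rewrite /= flowD2pi pw.
exact: smooth_comp (smooth_flow t).
Qed.

Lemma derive1_comp_flow w t x : SmoothS w ->
  derive1 (w \o psi t) x = derive1 w (psi t x) * derive1 (psi t) x.
Proof.
move=> [_ sw]; apply: is_derive1E; apply: is_derive1_comp; first exact: smooth_is_derive.
exact/smooth_is_derive/smooth_flow.
Qed.

(** Along a flow line the derivative of [w] is [w' Z], which is Lipschitz in time; the constant is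
    uniform in [x], as needed to differentiate under the integral. *)
Lemma flow_taylor w : SmoothS w -> exists K, forall t x,
  `|w (psi t x) - w x - t * (derive1 w x * Z x)| <= K * t ^+ 2.
Proof.
move=> sw; have [_ sw'] := sw.
pose G x := derive1 w x * Z x.
have sG : SmoothS G by apply: smoothS_mul => //; exact: smoothS_derive1.
have [M ZM] := smoothS_Cbound 0 sZ; have [M' GM] := smoothS_Cbound 1 sG.
exists (M' * M) => t x; have M'0 := Cbound_ge0 GM.
have h (s : R) : is_derive s 1 (fun s => w (psi s x)) (G (psi s x)).
  apply: (@is_derive1_comp _ w (fun s => psi s x)); last exact: is_derive_flow.
  exact: smooth_is_derive.
have := @taylor_bound _ _ (fun s => G (psi s x)) (M' * M) h 0 t.
rewrite flow0 !subr0; apply => s; rewrite subr0 (le_trans (SmoothS_Lipschitz sG GM _ _))//.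
by rewrite -mulrA ler_wpM2l//; exact: flow_near_id.
Qed.

Lemma flow_intcirc_derive w h : SmoothS w -> continuous h ->
  is_derive (0 : R) 1 (fun t => intcirc (fun x => w (psi t x) * h x))
    (intcirc (fun x => derive1 w x * Z x * h x)).
Proof.
move=> sw ch; have [K hK] := flow_taylor sw; have Ih := Intg_continuous ch.
have Iw f : SmoothS f -> Intg (fun x => f x * h x).
  by move=> sf; apply: Intg_mul_continuous => //; exact: SmoothS_Intg.
have Iwt t := Iw _ (SmoothS_flow t sw).
have IG : Intg (fun x => derive1 w x * Z x * h x).
  by apply: (Iw (fun x => derive1 w x * Z x)); apply: smoothS_mul => //; exact: smoothS_derive1.
apply: (@quadratic_is_derive _ _ _ _ (K * intcirc (fun x => `|h x|))) => t; rewrite !subr0.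
rewrite (eq_intcirc (f := fun x => w (psi 0 x) * h x) (g := fun x => w x * h x)); last first.
  by move=> x _; rewrite flow0.
rewrite -(intcirc_scale t IG) -(intcirc_sub (Iwt t) (Iw _ sw)) -intcirc_sub; last 2 first.
- exact: Intg_sub (Iwt t) (Iw _ sw).
- exact: Intg_scale.
apply: le_trans (intcirc_norm_le _) _.
  by apply: Intg_sub; [exact: Intg_sub (Iwt t) (Iw _ sw)|exact: Intg_scale].
rewrite mulrAC -intcirc_scale; last exact: Intg_norm.
apply: intcirc_le.
- by apply: Intg_norm; apply: Intg_sub; [exact: Intg_sub (Iwt t) (Iw _ sw)|exact: Intg_scale].
- by apply: Intg_scale; exact: Intg_norm.
move=> x _ /=.
have -> : w (psi t x) * h x - w x * h x - t * (derive1 w x * Z x * h x) =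
   (w (psi t x) - w x - t * (derive1 w x * Z x)) * h x by ring.
by rewrite normrM ler_wpM2r.
Qed.

End Flows.

(** * Explicit flows of trigonometric fields and the energy along a flow *)

Section FlowEnergies.
Variable R : realType.
Implicit Types (d f g h v w Z : R -> R) (t s x y z c M L : R) (n : int) (k N : nat).

Lemma cos_double_atan (q : R) : (1 + q ^+ 2) * cos (2 * atan q) = 1 - q ^+ 2.
Proof.
have q0 : 0 < 1 + q ^+ 2 by rewrite ltr_wpDr// sqr_ge0.
have c2 : cos (atan q) ^+ 2 = (1 + q ^+ 2)^-1 by rewrite cos_atan exprVn sqr_sqrtr// ltW.
rewrite mulr_natl mulr2n cosD -!expr2 sin2cos2 c2; field.
by rewrite gt_eqF.
Qed.

Lemma sin_double_atan (q : R) : (1 + q ^+ 2) * sin (2 * atan q) = 2 * q.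
Proof.
have q0 : 0 < 1 + q ^+ 2 by rewrite ltr_wpDr// sqr_ge0.
have c2 : cos (atan q) ^+ 2 = (1 + q ^+ 2)^-1 by rewrite cos_atan exprVn sqr_sqrtr// ltW.
have c0 : cos (atan q) != 0.
  by rewrite -sqrf_eq0 c2 invr_eq0 gt_eqF.
have sE : sin (atan q) = q * cos (atan q) by rewrite -{2}(atanK q) /tan divfK.
rewrite mulr_natl mulr2n sinD sE; move: (cos _) c2 => C c2.
rewrite (_ : q * C * C + C * (q * C) = 2 * q * C ^+ 2); last by ring.
by rewrite c2; field; rewrite gt_eqF.
Qed.

(* With [th = k x + const] and [l = e^(k t)], the flow of [x' = sin th] is
   [tan (th_t / 2) = l tan (th_0 / 2)]; the subtraction formula for [tan] turns
   this into a formula without poles. *)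
Lemma trig_flow_gt0 (k : nat) (th : R) : (0 < k)%N -> exists psi, is_flow (trig k th) psi.
Proof.
move=> k0; have kR : (k%:R : R) != 0 by rewrite pnatr_eq0 -lt0n.
pose s x : R := trig k th x; pose c x : R := trig k (th - pi / 2) x.
have cE x : c x = - sin (k%:~R * x - th).
  by rewrite /c /trig opprB addrA addrAC cosDpihalf.
have sc x : s x ^+ 2 = 1 - c x ^+ 2 
  by rewrite cE sqrrN; apply: (addIr (sin (k%:~R * x - th) ^+ 2)); rewrite subrK cos2Dsin2.
have c1 x : `|c x| <= 1 by exact: trig_le1.
(* [s] and [c] are the sine and cosine of the angle [k x - th + pi / 2]. With [l = e^(kt)], [D] is
   twice [cos^2 + l sin^2] of the half angle, hence positive, and [q] is the tangent of half the
   increment of the angle. *)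
pose m t : R := expR (k%:R * t) - 1; pose D t x := 2 + m t * (1 - c x).
have D0 t x : 0 < D t x.
  have := c1 x; rewrite ler_norml /D /m => /andP[cN c1'].
  have e0 := expR_gt0 (k%:R * t); move: (expR _) e0 => e e0.
  have := mulr_ge0 (ltW e0) (_ : 0 <= 1 - c x); rewrite subr_ge0 => /(_ c1') h.
  have [->|cx] := eqVneq (c x) 1; first by rewrite subrr mulr0 addr0.
  have cl : 0 < 1 - c x by rewrite subr_gt0 lt_neqAle cx.
  by have := mulr_gt0 e0 cl; rewrite mulrBl mul1r; lra.
have Dn t x : D t x != 0 by rewrite gt_eqF.
pose q t x := m t * s x * (D t x)^-1.
exists (fun t x => x + 2 / k%:R * atan (q t x)); split.
- by move=> x; rewrite /q /m mulr0 expR0 subrr !mul0r atan0 mulr0 addr0.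
- move=> t x.
  have dm (t' : R) : is_derive t' 1 m (k%:R * expR (k%:R * t')).
    have he : is_derive t' 1 (fun t => expR (k%:R * t)) (expR (k%:R * t') * k%:R).
      apply: (@is_derive1_comp _ expR (fun t => k%:R * t)).
      by have := is_derive_affine k%:R 0 t'; under eq_fun do rewrite addr0.
    have := is_derive1_comp (is_derive_affine 1 (- 1) _) he.
    by rewrite mul1r mulrC; congr is_derive; apply/funext => z; rewrite /= mul1r.
  have dD : is_derive t 1 (D^~ x) ((1 - c x) * (k%:R * expR (k%:R * t))).
    have := @is_derive1_comp _ (fun z => (1 - c x) * z + 2) m t _ _ (is_derive_affine _ _ _) (dm t).
    by congr is_derive; apply/funext => t'; rewrite /D /= addrC mulrC.
  have dN : is_derive t 1 (fun t => m t * s x) (s x * (k%:R * expR (k%:R * t))).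
    have := @is_derive1_comp _ (fun z => s x * z + 0) m t _ _ (is_derive_affine _ _ _) (dm t).
    by congr is_derive; apply/funext => t'; rewrite /= addr0 mulrC.
  have dq : is_derive t 1 (q^~ x) (2 * k%:R * expR (k%:R * t) * s x / D t x ^+ 2).
    have -> : 2 * k%:R * expR (k%:R * t) * s x / D t x ^+ 2 =
      m t * s x * (- (D t x) ^- 2 * ((1 - c x) * (k%:R * expR (k%:R * t))))
      + (D t x)^-1 * (s x * (k%:R * expR (k%:R * t))).
      have : D t x = 2 + m t * (1 - c x) by [].
      move: (Dn t x) (expR _) => d0 e dE.
      have -> : (D t x)^-1 * (s x * (k%:R * e)) = D t x * (s x * (k%:R * e)) / D t x ^+ 2 by field.
      by rewrite {3}dE; field.
    by apply: is_deriveM; exact: is_deriveV.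
  have q0 : 0 < 1 + q t x ^+ 2 by rewrite ltr_wpDr// sqr_ge0.
  have -> : trig k th (x + 2 / k%:R * atan (q t x)) =
      2 / k%:R * ((1 + q t x ^+ 2)^-1 * (2 * k%:R * expR (k%:R * t) * s x / D t x ^+ 2)).
    have -> : trig k th (x + 2 / k%:R * atan (q t x)) =
       s x * cos (2 * atan (q t x)) + c x * sin (2 * atan (q t x)).
      rewrite /trig (_ : k%:~R * (x + _) - th = (k%:~R * x - th) + 2 * atan (q t x)); last first.
        by rewrite mulrDr -!pmulrn (mulrA k%:R) mulrCA divff// mulr1 addrAC.
      by rewrite cosD cE mulNr.
    apply: (mulfI (lt0r_neq0 q0)); rewrite mulrDr !(mulrCA (1 + _)) cos_double_atan sin_double_atan.
    rewrite [X in _ = _ * X]mulrCA mulKf ?gt_eqF// /q; have := sc x.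
    have dE : D t x = 2 + m t * (1 - c x) by [].
    have -> : expR (k%:R * t) = m t + 1 by rewrite /m subrK.
    move: (Dn t x); rewrite dE; move: (m t) (c x) (s x) => m0 c0 s0 d0 sE.
    transitivity (s0 * (4 * (m0 + 1)) / (2 + m0 * (1 - c0)) ^+ 2); last by field; rewrite d0 kR.
    have -> : 1 - (m0 * s0 * (2 + m0 * (1 - c0))^-1) ^+ 2 =
      ((2 + m0 * (1 - c0)) ^+ 2 - m0 ^+ 2 * (1 - c0 ^+ 2)) / (2 + m0 * (1 - c0)) ^+ 2.
      by rewrite -sE; field.
    by field.
  have := @is_derive1_comp _ (fun z => 2 / k%:R * z + x) (fun t => atan (q t x)) t _ _
    (is_derive_affine _ _ _) (is_derive1_comp (is_derive1_atan _) dq).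
  by congr is_derive; apply/funext => t'; rewrite /= addrC.
- move=> t.
  suff : elementary (fun x => x + 2 / k%:R * atan (q t x)) by move/elementary_smooth => [].
  have es n a : elementary (fun x => trig n a x : R).
    by apply: Elem_base; have [] := SmoothS_trig n a.
  apply: Elem_add; first exact: Elem_id.
  apply: Elem_mul; first exact: Elem_cst.
  apply: (@Elem_comp _ (fun x => atan x)); first exact: Elem_atan.
  apply: Elem_mul; first by apply: Elem_mul; [exact: Elem_cst|exact: es].
  apply: Elem_inv => //; apply: Elem_add; first exact: Elem_cst.
  apply: Elem_mul; first exact: Elem_cst.
  have -> : (fun x => 1 - c x) = fun x => 1 + -1 * c x by apply/funext => x; rewrite mulN1r.
  apply: Elem_add; first exact: Elem_cst.
  by apply: Elem_mul; [exact: Elem_cst|exact: es].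
- by move=> t x; rewrite addrAC /q /D /s /c !(trig_periodic _ _ x).
Qed.

Lemma trig_flow (k : nat) (th : R) : exists psi, is_flow (trig k th) psi.
Proof.
case: k => [|k]; last exact: trig_flow_gt0.
have E x : trig 0 th x = cos th by rewrite /trig mul0r sub0r cosN.
exists (fun t x => cos th * t + x); split.
- by move=> x; rewrite mulr0 add0r.
- by move=> t x; rewrite E; exact: is_derive_affine.
- move=> t; suff [] : Smooth (fun x => cos th * t + x) by [].
  by apply/elementary_smooth/Elem_add; [exact: Elem_cst|exact: Elem_id].
- by move=> t x; rewrite addrA.
Qed.

Lemma Lam_Lam v : SmoothS v -> Lam (Lam v) = fun x => - derive1 (derive1 v) x.
Proof.
move=> sv; have s1 := smoothS_derive1 sv; have s2 := smoothS_derive1 s1.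
have E (th : R) n : coef (dfun (Lam (Lam v))) th n =
    coef (dfun (fun x => - derive1 (derive1 v) x)) th n.
  have -> : (fun x => - derive1 (derive1 v) x) = fun x => -1 * derive1 (derive1 v) x.
    by apply/funext => x; rewrite mulN1r.
  rewrite coef_dfun_scale; last exact: SmoothS_Intg.
  rewrite !coef_Lam//; last exact: SmoothS_Lam.
  rewrite !coef_derive1// -addrA -splitr coefDpi; last exact/Distr_dfun/SmoothS_Intg.
  by rewrite !mulrN mulN1r opprK !mulrA -normrM ger0_norm// -expr2 sqr_ge0.
by apply: (SmoothS_coef_eq (SmoothS_Lam (SmoothS_Lam sv)) (smoothS_opp s2)) => k; exact: E.
Qed.

Lemma Lam_L2 v : SmoothS v ->
  intcirc (fun x => Lam v x ^+ 2) = intcirc (fun x => derive1 v x ^+ 2).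
Proof.
move=> sv; have sL := SmoothS_Lam sv; have s1 := smoothS_derive1 sv.
transitivity (dfun (Lam v) (Lam v)); first by [].
rewrite dfun_Lam// Lam_Lam//.
transitivity (intcirc (fun x => derive1 v x * derive1 v x)); last by [].
rewrite intcirc_parts// -intcirc_opp; last exact/SmoothS_Intg/smoothS_mul/smoothS_derive1.
by apply: eq_intcirc => x _; rewrite mulrN.
Qed.

Definition En v : R := intcirc (fun x => v x * Lam v x).

Lemma intcirc_sqr_le v A : SmoothS v -> (forall x, `|v x| <= A) ->
  intcirc (fun x => v x ^+ 2) <= A ^+ 2 * (2 * pi).
Proof.
move=> sv vA; rewrite -intcirc_cst; apply: intcirc_le.
- exact/L2S_Intg_sqr/SmoothS_L2S.
- exact: Intg_cst.
move=> x _; rewrite -real_normK ?num_real// lerXn2r ?nnegrE//.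
exact: le_trans (vA x).
Qed.

(** Cauchy-Schwarz and the equality of the L^2 norms of [Lam d] and [d']. If [d] and [d'] are both
    O(t), the energy is O(t^2). *)
Lemma En_bound d A A' : SmoothS d -> (forall x, `|d x| <= A) ->
  (forall x, `|derive1 d x| <= A') -> `|En d| <= 2 * pi * (A * A').
Proof.
move=> sd dA dA'; have A0 := le_trans (normr_ge0 _) (dA 0).
have A'0 := le_trans (normr_ge0 _) (dA' 0).
rewrite -(@ler_pXn2r _ 2)// ?nnegrE//; last by rewrite mulr_ge0 ?twopi_ge0 ?mulr_ge0.
rewrite real_normK ?num_real//.
have sL := SmoothS_Lam sd.
apply: le_trans (intcirc_CauchySchwarz (SmoothS_L2S sd) (SmoothS_L2S sL)) _.
rewrite Lam_L2//; have h1 := intcirc_sqr_le sd dA.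
have h2 := intcirc_sqr_le (smoothS_derive1 sd) dA'.
apply: le_trans (ler_pM _ _ h1 h2) _.
- by apply: intcirc_ge0 => x _; exact: sqr_ge0.
- by apply: intcirc_ge0 => x _; exact: sqr_ge0.
- move: (2 * pi) => p; rewrite le_eqVlt; apply/orP; left; apply/eqP; ring.
Qed.

Lemma En_add w d : SmoothS w -> SmoothS d ->
  En (fun x => w x + d x) = En w + 2 * intcirc (fun x => d x * Lam w x) + En d.
Proof.
move=> sw sd; have sLw := SmoothS_Lam sw; have sLd := SmoothS_Lam sd.
have I f g : SmoothS f -> SmoothS g -> Intg (fun x => f x * g x).
  by move=> sf sg; apply: SmoothS_Intg; exact: smoothS_mul.
rewrite /En LamD//.
transitivity (intcirc (fun x => (w x * Lam w x + d x * Lam w x) + (w x * Lam d x + d x * Lam d x))).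
  by apply: eq_intcirc => x _; ring.
have E0 := intcirc_add (Intg_add (I _ _ sw sLw) (I _ _ sd sLw)) (Intg_add (I _ _ sw sLd) (I _ _ sd sLd)).
have E1 := intcirc_add (I _ _ sw sLw) (I _ _ sd sLw).
have E2 := intcirc_add (I _ _ sw sLd) (I _ _ sd sLd).
have E3 : intcirc (fun x => w x * Lam d x) = intcirc (fun x => d x * Lam w x).
  by apply: etrans (esym (dfun_Lam sw sd)) _; apply: eq_intcirc => x _; exact: mulrC.
have E4 := etrans E2 (congr1 (fun z => z + _) E3).
apply: etrans E0 (etrans (congr2 +%R E1 E4) _).
have R4 (a b c : R) : a + b + (b + c) = a + 2 * b + c by ring.
exact: R4.
Qed.

Section FlowEnergy.
Variables (Z : R -> R) (psi : R -> R -> R).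
Hypotheses (sZ : SmoothS Z) (fl : is_flow Z psi).

(** Write [w o psi_t] as [w + d t]. The cross term is linear in [w o psi_t] and handled by
    [flow_intcirc_derive]; the energy of [d t] is O(t^2) by [En_bound]. *)
Lemma En_flow_derive0 w : SmoothS w ->
  is_derive (0 : R) 1 (fun t => En (w \o psi t)) (2 * Qform Z w w).
Proof.
move=> sw; have sL := SmoothS_Lam sw.
pose d t x := w (psi t x) - w x.
have sd t : SmoothS (d t) by apply: smoothS_sub => //; exact: (SmoothS_flow fl t sw).
have d0 x : d 0 x = 0 by rewrite /d (flow0 fl) subrr.
have [M ZM] := smoothS_Cbound 1 sZ; have [M' wM] := smoothS_Cbound 2 sw.
have M0 := Cbound_ge0 ZM; have M'0 := Cbound_ge0 wM.
have wM1 := Cbound_leq (isT : (1 <= 2)%N) wM; have wM2 := Cbound_derive1 wM.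
have ZM0 := Cbound_leq (isT : (0 <= 1)%N) ZM.
have dA t x : `|d t x| <= M' * M * `|t|.
  apply: le_trans (SmoothS_Lipschitz sw wM1 _ _) _.
  rewrite -mulrA; apply: ler_wpM2l => //; exact: (flow_near_id fl _ _ ZM0).
(* The two summands bound [(w'(psi_t) - w') psi_t'] and [w' (psi_t' - 1)], whose sum is the
   derivative of [d t]. *)
pose C := M' * M * (1 + M * expR M) + M' * (M * expR M).
have dA' t x : `|t| <= 1 -> `|derive1 (d t) x| <= C * `|t|.
  move=> t1; have -> : derive1 (d t) x = (derive1 w (psi t x) - derive1 w x) * derive1 (psi t) x
      + derive1 w x * (derive1 (psi t) x - 1).
    have -> : derive1 (d t) x = derive1 (w \o psi t) x - derive1 w x.
      by rewrite /d derive1_subE//; [case: (SmoothS_flow fl t sw)|case: sw].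
    by rewrite (derive1_comp_flow fl)//; ring.
  apply: le_trans (ler_normD _ _) _; rewrite !normrM mulrDl; apply: lerD.
    rewrite mulrAC; apply: ler_pM => //; last exact: (derive1_flow_bound sZ fl).
    apply: le_trans (SmoothS_Lipschitz (smoothS_derive1 sw) wM2 _ _) _.
    rewrite -mulrA; apply: ler_wpM2l => //; exact: (flow_near_id fl _ _ ZM0).
  rewrite -mulrA; apply: ler_pM => //; last exact: (derive1_flow_near1 sZ fl).
  by have /CboundS[_ /(Cbound_leq (leq0n _))/Cbound0] := wM.
have C0 : 0 <= C.
  by rewrite /C; have := expR_ge0 M => e0; rewrite !(addr_ge0, mulr_ge0).
have En0 : En (d 0) = 0.
  rewrite /En (eq_intcirc (g := fun=> 0)) ?intcirc_cst ?mul0r// => x _.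
  by rewrite d0 mul0r.
have h2 : is_derive (0 : R) 1 (fun t => En (d t)) 0.
  apply: (@quadratic_is_derive_near _ _ _ _ (2 * pi * (M' * M * C))) => t.
  rewrite !subr0 mulr0 subr0 En0 subr0 => t1.
  apply: le_trans (En_bound (sd t) (dA t) (fun x => dA' t x t1)) _.
  rewrite -[t ^+ 2]real_normK ?num_real//; move: (2 * pi) => p.
  by rewrite le_eqVlt; apply/orP; left; apply/eqP; ring.
have h1 := flow_intcirc_derive sZ fl sw (SmoothS_continuous sL).
have Iw t : Intg (fun x => w (psi t x) * Lam w x).
  by apply: SmoothS_Intg; apply: (@smoothS_mul _ (w \o psi t)) => //; exact: (SmoothS_flow fl t sw).
have E t : (2 * intcirc (fun x => w (psi t x) * Lam w x) + - En w) + En (d t) = En (w \o psi t).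
  have -> : w \o psi t = fun x => w x + d t x.
    by apply/funext => x; rewrite /d /= addrC subrK.
  rewrite En_add//; congr (_ + _).
  have -> : intcirc (fun x => d t x * Lam w x) = intcirc (fun x => w (psi t x) * Lam w x) - En w.
    rewrite -intcirc_sub//; first by apply: eq_intcirc => x _; rewrite /d mulrBl.
    by apply: SmoothS_Intg; exact: smoothS_mul.
  by ring.
have EQ : intcirc (fun x => derive1 w x * Z x * Lam w x) = Qform Z w w.
  by apply: eq_intcirc => x _; rewrite mulrC mulrA.
have h3 := is_derive1_comp (is_derive_affine 2 (- En w) _) h1.
have h4 := is_deriveD h3 h2.
rewrite EQ addr0 in h4; apply: near_eq_is_derive h4.
by exists 1 => //= t _; exact: E.
Qed.

Lemma En_flow_derive w t : SmoothS w -> is_derive t 1 (fun t => En (w \o psi t))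
  (2 * Qform Z (w \o psi t) (w \o psi t)).
Proof.
move=> sw; have swt := SmoothS_flow fl t sw.
have E : (fun t => En (w \o psi t)) = (fun r => En ((w \o psi t) \o psi r)) \o (fun s => 1 * s + - t).
  apply/funext => s; congr En; apply/funext => x /=.
  by rewrite -(flow_group sZ fl) mul1r subrK.
rewrite E -[2 * _]mulr1.
apply: (@is_derive1_comp _ (fun r => En ((w \o psi t) \o psi r))); last exact: is_derive_affine.
by rewrite mul1r subrr; exact: En_flow_derive0.
Qed.

(** A mean value formula in place of a second derivative of the energy: uniformity in [w] then
    reduces to comparing Q_Z at [w o psi_c] and at [w], an L^2 question. *)
Lemma En_flow_MVT w t : SmoothS w -> exists2 c, `|c| <= `|t| &
  En (w \o psi t) - En w = 2 * Qform Z (w \o psi c) (w \o psi c) * t.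
Proof.
move=> sw; have [c ct E] := MVT_between (fun t => En_flow_derive t sw) 0 t.
exists c; first by move: ct; rewrite !subr0.
have E0 : w \o psi 0 = w by apply/funext => x; rewrite /= (flow0 fl).
by rewrite -{2}E0 E (subr0 t).
Qed.

End FlowEnergy.

End FlowEnergies.

(** * Composition with flows in L^2 *)

Section ChangeOfVariable.
Variable R : realType.
Local Notation mu := (@lebesgue_measure R).
Local Notation circ := (`[0%R, (2 * pi)%R]%classic : set R).
Variables (psi phi : R -> R).
Hypotheses (psiK : cancel psi phi) (phiK : cancel phi psi).
Hypotheses (phi_nd : {homo phi : x y / x <= y})
  (phi_lip : forall x y, x <= y -> phi y - phi x <= 2 * (y - x)).
Hypotheses (cpsi : continuous psi).

Let psi_le x b : (psi x <= b) = (x <= phi b).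
Proof.
apply/idP/idP => [/phi_nd|xb]; first by rewrite psiK.
rewrite leNgt; apply/negP => bx; have := phi_nd (ltW bx); rewrite psiK => bx'.
have xE : x = phi b by apply/eqP; rewrite eq_le xb.
by move: bx; rewrite xE phiK ltxx.
Qed.

Let psi_preimage a b : psi @^-1` `]a, b]%classic = `]phi a, phi b]%classic.
Proof.
by apply/seteqP; split=> x /=; rewrite !in_itv/= !ltNge !psi_le.
Qed.

(** Its increments complete those of [phi] to twice the length; they are nonnegative by [phi_lip],
    so [G] defines a Stieltjes measure. *)
Let G x := 2 * x - phi x.

Let G_nd : nondecreasing G.
Proof. by move=> x y xy; have := phi_lip xy; rewrite /G; lra. Qed.

Let G_cont : continuous G.
Proof.
have phic : continuous phi.
  move=> x; apply/cvgrPdist_le => e e0; near=> y.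
  have h : `|phi x - phi y| <= 2 * `|x - y|.
    have [xy|/ltW yx] := leP x y.
      have := phi_lip xy; have := phi_nd xy => h1 h2.
      by rewrite distrC (distrC x) !ger0_norm ?subr_ge0.
    have := phi_lip yx; have := phi_nd yx => h1 h2.
    by rewrite !ger0_norm ?subr_ge0.
  rewrite (le_trans h)// mulrC -ler_pdivlMr//.
  by near: y; apply: (@cvgr_dist_le _ _ _ _ _ id x) => //; rewrite divr_gt0.
move=> x; apply: cvgB; last exact: phic.
by apply: cvgM; [exact: cvg_cst|exact: cvg_id].
Unshelve. all: by end_near. Qed.

Let mpsi : @measurable_fun _ _ (measurableTypeR R) (measurableTypeR R) setT psi.
Proof. exact: (continuous_measurable_fun cpsi). Qed.

Let Gc : cumulative R R :=
  HB.pack G (isCumulative.Build R _ R G G_nd (right_continuousW G_cont)).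

Let nu : {measure set (measurableTypeR R) -> \bar R} :=
  measure_function_pushforward__canonical__measure_function_Measure mu mpsi.
Let muG : {measure set (measurableTypeR R) -> \bar R} := lebesgue_stieltjes_measure Gc.
Let half : {nonneg R} := NngNum (ltW (@divr_gt0 R 1 2 ltr01 (ltr0Sn R 1))).
Let m3 : {measure set (measurableTypeR R) -> \bar R} := mscale half (measure_add nu muG).

(* The part of [2 mu] not covered by [nu] is the Stieltjes measure of [G]. *)
Let mu_half A : measurable A -> mu A = m3 A.
Proof.
apply: lebesgue_measure_unique => X /ocitvP[->|[[a b]/= ab ->]]; first by rewrite !measure0.
have -> : m3 `]a, b]%classic = ((1 / 2)%:E * (nu `]a, b]%classic + muG `]a, b]%classic))%E.
  by rewrite -measure_addE.
have -> : nu `]a, b]%classic = (phi b - phi a)%:E.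
  by rewrite /nu /= /pushforward/= psi_preimage lebesgue_measure_itv/= lte_fin lt_neqAle
    (inj_eq (can_inj phiK)) lt_eqF//= phi_nd ?ltW.
have -> : muG `]a, b]%classic = (G b - G a)%:E.
  have -> : muG `]a, b]%classic = wlength Gc `]a, b]%classic.
    by apply: measurable_mu_extE; exact: is_ocitv.
  by rewrite wlength_itv/= lte_fin ab.
rewrite lebesgue_measure_itv/= lte_fin ab -!EFinD -EFinM; congr (_%:E).
by rewrite /G; lra.
Qed.

(** The left side is the integral of [g] for the image measure [nu] of Lebesgue measure under [psi],
    and [2 mu = nu + muG] with [muG] nonnegative. *)
Lemma integral_bilipschitz_le (g : R -> \bar R) : measurable_fun setT g ->
  (forall x, (0 <= g x)%E) ->
  (\int[mu]_x g (psi x) <= 2%:E * \int[mu]_x g x)%E.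
Proof.
move=> mg g0.
have -> : (\int[mu]_x g x = \int[m3]_x g x)%E.
  by apply: eq_measure_integral => A mA _; exact: mu_half.
rewrite ge0_integral_mscale// ge0_integral_measure_add//.
rewrite muleA -EFinM/= mul1r divff ?pnatr_eq0// mul1e.
have -> : (\int[mu]_x g (psi x) = \int[nu]_x g x)%E.
  by rewrite /nu ge0_integral_pushforward//= preimage_setT.
by rewrite leeDl// integral_ge0.
Qed.

End ChangeOfVariable.

(** * Composition with a flow as a bounded operator on L^2 *)

Section FlowL2.
Variable R : realType.
Local Notation mu := (@lebesgue_measure R).
Local Notation circ := (`[0%R, (2 * pi)%R]%classic : set R).
Variables (Z : R -> R) (psi : R -> R -> R).
Hypotheses (sZ : SmoothS Z) (fl : is_flow Z psi).

Lemma flowK t x : psi (- t) (psi t x) = x.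
Proof. by rewrite -(flow_group sZ fl) subrr (flow0 fl). Qed.

(** For [t] this small, [psi t] and its inverse [psi (- t)] are nondecreasing and 2-Lipschitz, and
    points move by at most 1/2. So [psi t] sends one period into three consecutive ones; each costs
    a factor 2, whence [6 = 3 * 2]. *)
Lemma flow_L2_le : exists2 t0 : R, 0 < t0 & forall (t : R) (h : R -> R), `|t| <= t0 -> L2S h ->
  L2S (h \o psi t) /\
  intcirc (fun x => h (psi t x) ^+ 2) <= 6 * intcirc (fun x => h x ^+ 2).
Proof.
have [M ZM] := smoothS_Cbound 1 sZ; have M0 := Cbound_ge0 ZM.
have ZM0 := Cbound_leq (isT : (0 <= 1)%N) ZM.
have eM1 : 1 <= expR M by rewrite -expR0 ler_expR.
have C0 : 0 < 2 * (M * expR M + 1) by rewrite mulr_gt0// ltr_wpDl// mulr_ge0// expR_ge0.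
exists (2 * (M * expR M + 1))^-1 => [|t h tt0 hh]; first by rewrite invr_gt0.
have t1 : `|t| <= 1.
  have c0 : 0 <= M * expR M by rewrite mulr_ge0 ?expR_ge0.
  by rewrite (le_trans tt0)// invf_le1//; lra.
have Ct : M * expR M * `|t| <= 2^-1.
  rewrite (@le_trans _ _ ((M * expR M + 1) * `|t|))// ?ler_wpM2r ?lerDl//.
  by move: tt0; rewrite -[_^-1]mul1r ler_pdivlMr// => h'; lra.
have Mt : M * `|t| <= 2^-1.
  by rewrite (le_trans _ Ct)// ler_wpM2r// ler_peMr.
have near_id s x y : `|s| = `|t| -> x <= y ->
    psi s x <= psi s y /\ psi s y - psi s x <= 2 * (y - x).
  move=> st xy; have := flow_diff_near_id sZ fl y x ZM; move=> /(_ s); rewrite st => /(_ t1) d.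
  have : `|psi s y - psi s x - (y - x)| <= 2^-1 * (y - x).
    by apply: le_trans d _; rewrite (ger0_norm (_ : 0 <= y - x)) ?subr_ge0// ler_wpM2r ?subr_ge0.
  by rewrite ler_norml => /andP[d1 d2]; split; lra.
have pit := smooth_continuous (smooth_flow fl t).
pose p (j : int) x := psi t x - j%:~R * (2 * pi).
have pK j : cancel (p j) (fun x => psi (- t) (x + j%:~R * (2 * pi))).
  by move=> x; rewrite /p subrK flowK.
have Kp j : cancel (fun x => psi (- t) (x + j%:~R * (2 * pi))) (p j).
  by move=> x; rewrite /p -{1}(opprK t) flowK addrK.
have phi_nd j : {homo (fun x => psi (- t) (x + j%:~R * (2 * pi))) : x y / x <= y}.
  by move=> x y xy; have [] := near_id (- t) (x + j%:~R * (2 * pi)) (y + j%:~R * (2 * pi)) (normrN t) (lerD xy (lexx _)).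
have phi_lip j x y : x <= y -> psi (- t) (y + j%:~R * (2 * pi)) - psi (- t) (x + j%:~R * (2 * pi)) <= 2 * (y - x).
  move=> xy; have [_] := near_id (- t) _ _ (normrN t) (lerD xy (lexx (j%:~R * (2 * pi)))).
  by rewrite opprD addrACA subrr addr0.
have cp j : continuous (p j).
  by move=> x; apply: cvgB; [exact: pit|exact: cvg_cst].
have [ph mh _] := hh; have Ih := L2S_Intg_sqr hh.
(* One period of [h ^+ 2], extended by zero: on the circle, [h (psi t x) ^+ 2] is at most the sum of
   [F (p j x)] over [j = 0, 1, -1], and each integral is over the whole line. *)
pose F : R -> \bar R := (fun x => (h x ^+ 2)%:E) \_ circ.
have F0 x : (0 <= F x)%E by rewrite /F patchE; case: ifP => // _; rewrite lee_fin sqr_ge0.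
have mc : measurable circ by exact: measurable_itv.
have mF : measurable_fun setT F.
  apply: (iffLR (measurable_restrictT _ mc)).
  by apply/measurable_EFinP; apply: measurable_funX; exact: measurable_funTS.
have mhp : measurable_fun setT (h \o psi t).
  by apply: measurableT_comp => //; exact: continuous_measurable_fun.
have intF : (\int[mu]_x F x = (intcirc (fun x => h x ^+ 2))%:E)%E.
  rewrite /F -integral_mkcond /intcirc /Rintegral fineK//.
  by apply: integrable_fin_num => //; exact: (IntgE Ih).
have le6 : (\int[mu]_(x in circ) (h (psi t x) ^+ 2)%:E <= (6 * intcirc (fun x => h x ^+ 2))%:E)%E.
  have mFp j : measurable_fun setT (fun x => F (p j x)).
    by apply: (measurableT_comp mF); exact: continuous_measurable_fun.
  have mFp2 := emeasurable_funD (mFp 0) (mFp 1).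
  have mFp3 := emeasurable_funD mFp2 (mFp (- 1)).
  apply: (@le_trans _ _ (\int[mu]_x (F (p 0%R x) + F (p 1%R x) + F (p (- 1)%R x))%E)%E).
    rewrite integral_mkcond; apply: ge0_le_integral => //.
    - by move=> x _; rewrite patchE; case: ifP => // _; rewrite lee_fin sqr_ge0.
    - apply: (iffLR (measurable_restrictT _ mc)).
      by apply/measurable_EFinP; apply: measurable_funX; exact: measurable_funTS.
    move=> x _; rewrite patchE; case: ifPn => [|_]; last by rewrite !adde_ge0.
    rewrite inE/= in_itv/= => /andP[x0 x2].
    have FE j : 0 <= p j x <= 2 * pi -> F (p j x) = (h (psi t x) ^+ 2)%:E.
      move=> pj; rewrite /F patchE mem_set ?in_itv//= /p -mulNr -mulrNz.
      by rewrite periodicS_int.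
    have := flow_near_id fl t x ZM0; rewrite ler_norml => /andP[d1 d2].
    have p2 := pi_ge2 R.
    have [q0|q0] := leP 0 (psi t x).
      have [q2|/ltW q2] := leP (psi t x) (2 * pi).
        rewrite (FE 0); last by rewrite /p mul0r subr0 q0.
        by rewrite -addeA leeDl// adde_ge0.
      rewrite (FE 1); last by rewrite /p mul1r subr_ge0 q2/=; move: (pi) p2 x2 q2 => q; lra.
      by rewrite addeAC leeDr// adde_ge0.
    rewrite (FE (- 1)); last by rewrite /p mulN1r opprK; move: (pi) p2 => q; lra.
    by rewrite leeDr// adde_ge0.
  have le2 j : (\int[mu]_x F (p j x) <= (2 * intcirc (fun x => h x ^+ 2))%:E)%E.
    by rewrite EFinM -intF; exact: (integral_bilipschitz_le (pK j) (Kp j) (phi_nd j) (phi_lip j) (cp j)).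
  rewrite ge0_integralD//; try exact: mFp; try exact: mFp2; last by move=> x _; rewrite adde_ge0.
  rewrite ge0_integralD//; try exact: mFp.
  apply: le_trans (leeD (leeD (le2 0) (le2 1)) (le2 (- 1))) _.
  by rewrite -!EFinD lee_fin; lra.
have Ihp : Intg (fun x => h (psi t x) ^+ 2).
  split; apply/integrableP; split.
    by apply/measurable_EFinP; apply: measurable_funX; exact: measurable_funTS.
  under eq_integral do rewrite /= ger0_norm ?sqr_ge0//.
  by rewrite (le_lt_trans le6)// ltry.
split; first by apply: L2S_intro => // x; rewrite /= (flowD2pi fl) ph.
rewrite -lee_fin /intcirc /Rintegral fineK//.
by apply: integrable_fin_num => //; exact: (IntgE Ihp).
Qed.

End FlowL2.

(** * Stationarity *)

Section Stationarity.
Variable R : realType.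
Implicit Types (f g h v w : R -> R) (S T : distr R) (t s x y c e : R) (n : int) (k N P j : nat).

Lemma sum_seq_le (I : eqType) (r s : seq I) (g : I -> R) : uniq r -> uniq s ->
  {subset r <= s} -> (forall i, 0 <= g i) -> \sum_(i <- r) g i <= \sum_(i <- s) g i.
Proof.
move=> ur us rs g0; have -> : \sum_(i <- r) g i = \sum_(i <- s | i \in r) g i.
  rewrite -[RHS]big_filter; apply: perm_big; apply: uniq_perm => //; first exact: filter_uniq.
  by move=> i; rewrite mem_filter; case: (boolP (i \in r)) => //= /rs ->.
by rewrite [leRHS](bigID (fun i => i \in r))/= lerDl sumr_ge0.
Qed.

Lemma Hle_of_nat (s B : R) (w : int -> R) : (forall n, w (- n) = w n) ->
  (forall n, 0 <= w n) -> (forall N, \sum_(k < N) wgt s k * w k <= B) -> Hle s w (2 * B).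
Proof.
move=> wN w0 hB F uF.
have g0 n : 0 <= wgt s n * w n by rewrite mulr_ge0 ?wgt_ge0.
pose N := (\max_(n <- F) `|n|%N).+1.
have FN n : n \in F -> (`|n| < N)%N.
  by move=> nF; rewrite ltnS; apply: leq_bigmax_seq.
pose L := [seq Posz k | k <- iota 0 N] ++ [seq Negz k | k <- iota 0 N].
have uL : uniq L.
  rewrite cat_uniq !map_inj_uniq ?iota_uniq; last 2 first.
  - by move=> a b [].
  - by move=> a b [].
  by apply/and3P; split=> //; apply/hasPn => n /mapP[k _ ->]; apply/mapP => -[].
have FL : {subset F <= L}.
  move=> n /FN nN; rewrite mem_cat; case: n nN => k kN.
    by rewrite map_f// mem_iota.
  by rewrite [X in _ || X]map_f ?orbT// mem_iota/=; exact: ltn_trans kN.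
apply: le_trans (sum_seq_le uF uL FL g0) _.
have iE : iota 0 N = index_iota 0 N by rewrite /index_iota subn0.
rewrite /L big_cat !big_map iE !big_mkord mulr_natl mulr2n.
apply: lerD; first exact: hB.
apply: le_trans (hB N.+1); rewrite [leRHS]big_ord_recl ler_wpDl//.
apply: ler_sum => k _; rewrite NegzE wN /wgt mulrNz sqrrN.
by rewrite lexx.
Qed.

Lemma pwN T n : Distr T -> pw T (- n) = pw T n.
Proof.
move=> dT; rewrite /pw !coefNz oppr0 (coef_split (- (pi / 2)) n dT).
by rewrite cosN sinN cos_pihalf sin_pihalf mul0r add0r mulN1r sqrrN.
Qed.

Lemma L2S_Hle0 w : L2S w -> Hle 0 (pw (dfun w)) (2 * (2 * pi * intcirc (fun x => w x ^+ 2))).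
Proof.
move=> hw; have dw := Distr_dfun (L2S_Intg hw); apply: Hle_of_nat.
- by move=> n; exact: pwN.
- by move=> n; exact: pw_ge0.
move=> N; apply: le_trans (ler_wpM2l (twopi_ge0 R) (bessel N hw)); rewrite mulr_sumr.
by apply: ler_sum => k _; rewrite /wgt powRr0 mul1r; exact: pw_le_penergy.
Qed.

Lemma QformDl Z v v' w : SmoothS Z -> SmoothS v -> SmoothS v' -> SmoothS w ->
  Qform Z (fun x => v x + v' x) w = Qform Z v w + Qform Z v' w.
Proof.
move=> sZ sv sv' sw; have I g : SmoothS g -> Intg (fun x => Lam g x * derive1 w x * Z x).
  move=> sg; apply: SmoothS_Intg; apply: smoothS_mul => //.
  by apply: smoothS_mul; [exact: SmoothS_Lam|exact: smoothS_derive1].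
rewrite /Qform LamD//; apply: etrans _ (intcirc_add (I _ sv) (I _ sv')).
by apply: eq_intcirc => x _; rewrite !mulrDl.
Qed.

Lemma QformDr Z v w w' : SmoothS Z -> SmoothS v -> SmoothS w -> SmoothS w' ->
  Qform Z v (fun x => w x + w' x) = Qform Z v w + Qform Z v w'.
Proof.
move=> sZ sv sw sw'; have I g : SmoothS g -> Intg (fun x => Lam v x * derive1 g x * Z x).
  move=> sg; apply: SmoothS_Intg; apply: smoothS_mul => //.
  by apply: smoothS_mul; [exact: SmoothS_Lam|exact: smoothS_derive1].
rewrite /Qform; case: (sw) (sw') => _ dw [_ dw']; rewrite derive1_addE//.
apply: etrans _ (intcirc_add (I _ sw) (I _ sw')).
by apply: eq_intcirc => x _; rewrite mulrDr mulrDl.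
Qed.

Lemma QformNl Z v w : SmoothS Z -> SmoothS v -> SmoothS w ->
  Qform Z (fun x => - v x) w = - Qform Z v w.
Proof.
move=> sZ sv sw; have sv' := smoothS_opp sv.
apply/eqP; rewrite -addr_eq0 addrC -QformDl//.
have -> : (fun x => v x - v x) = fun x => 0 * v x by apply/funext => x; rewrite subrr mul0r.
rewrite /Qform LamZ// (eq_intcirc (g := fun=> 0)) ?intcirc_cst ?mul0r//.
by move=> x _; rewrite !mul0r.
Qed.

Lemma QformNr Z v w : SmoothS Z -> SmoothS v -> SmoothS w ->
  Qform Z v (fun x => - w x) = - Qform Z v w.
Proof.
move=> sZ sv sw; have sw' := smoothS_opp sw.
apply/eqP; rewrite -addr_eq0 addrC -QformDr//.
have -> : (fun x => w x - w x) = fun=> 0 by apply/funext => x; rewrite subrr.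
rewrite /Qform derive1_cstE (eq_intcirc (g := fun=> 0)) ?intcirc_cst ?mul0r//.
by move=> x _; rewrite mulr0 mul0r.
Qed.

Lemma Qform_L2 Z : SmoothS Z -> exists2 C : R, 0 <= C & forall v w, SmoothS v -> SmoothS w ->
  (Qform Z v w + Qform Z w v) ^+ 2 <=
  C * (intcirc (fun x => v x ^+ 2) * intcirc (fun x => w x ^+ 2)).
Proof.
move=> sZ; have [M ZM] := smoothS_Cbound 6 sZ.
exists (Cop R * M ^+ 2 * (2 * (2 * pi)) ^+ 2).
  by apply: mulr_ge0; [apply: mulr_ge0; [exact: Cop_ge0|exact: sqr_ge0]|exact: sqr_ge0].
move=> v w sv sw; have hv := L2S_Hle0 (SmoothS_L2S sv); have hw := L2S_Hle0 (SmoothS_L2S sw).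
apply: le_trans (Qform_bound sZ sv sw ZM hv hw) _.
move: (2 * pi) (Cop R) (intcirc _) (intcirc _) => p C a b.
by rewrite le_eqVlt; apply/orP; left; apply/eqP; ring.
Qed.

(** Twice the difference of the diagonal values is the symmetrized form at [(a - v, a + v)], in
    which the mixed terms cancel. *)
Lemma Qform_diff Z C : SmoothS Z -> (forall v w, SmoothS v -> SmoothS w ->
  (Qform Z v w + Qform Z w v) ^+ 2 <=
    C * (intcirc (fun x => v x ^+ 2) * intcirc (fun x => w x ^+ 2))) ->
  forall a v, SmoothS a -> SmoothS v -> (2 * (Qform Z a a - Qform Z v v)) ^+ 2 <=
  C * (intcirc (fun x => (a x - v x) ^+ 2) * intcirc (fun x => (a x + v x) ^+ 2)).
Proof.
move=> sZ hC a v sa sv; have svN := smoothS_opp sv.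
have := hC _ _ (smoothS_sub sa sv) (smoothS_add sa sv).
have sP := smoothS_add sa sv; have sM := smoothS_sub sa sv.
have e1 : Qform Z (fun x => a x - v x) (fun x => a x + v x) =
    (Qform Z a a + Qform Z a v) + (- Qform Z v a + - Qform Z v v).
  apply: etrans (QformDl sZ sa svN sP) _; apply: congr2; first exact: QformDr.
  apply: etrans (QformNl sZ sv sP) _; rewrite -opprD; congr (- _); exact: QformDr.
have e2 : Qform Z (fun x => a x + v x) (fun x => a x - v x) =
    (Qform Z a a + - Qform Z a v) + (Qform Z v a + - Qform Z v v).
  apply: etrans (QformDl sZ sa sv sM) _; apply: congr2.
    apply: etrans (QformDr sZ sa sa svN) _; congr (_ + _); exact: QformNr.
  apply: etrans (QformDr sZ sv sa svN) _; congr (_ + _); exact: QformNr.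
have R4 (p q r s : R) : (p + q) + (- r + - s) + ((p + - q) + (r + - s)) = 2 * (p - s) by ring.
by rewrite e1 e2 R4.
Qed.

Lemma is_derive_littleo (f : R -> R) (l e : R) : is_derive (0 : R) 1 f l -> 0 < e ->
  exists2 d : R, 0 < d & forall t : R, `|t| <= d -> `|f t - f 0 - t * l| <= e * `|t|.
Proof.
move=> fl e0.
have dq : h0^-1 *: (f (h0 *: (1 : R) + 0) - f 0) @[h0 --> (0 : R)^'] --> l.
  by have := @ex_derive _ _ _ _ _ _ _ fl; rewrite /derivable => /cvg_ex[a ca];
    rewrite -(@derive_val _ _ _ _ _ _ _ fl) /derive (cvg_lim _ ca).
have /cvgrPdist_le /(_ _ e0)[d /= d0 h] := dq.
exists (d / 2) => [|t td]; first exact: divr_gt0.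
have [->|t0] := eqVneq t 0; first by rewrite subrr mul0r subr0 normr0 mulr0.
have d2 : ball_ Num.norm 0 d t.
  by rewrite /ball_/= sub0r normrN (le_lt_trans td)// gtr_pMr// invf_lt1// ltr1n.
have := h t d2 t0.
rewrite -[_ *: (1 : R)]/(_ * _) mulr1 -[_ *: _]/(_ * _) addr0 => ht.
have -> : f t - f 0 - t * l = - t * (l - t^-1 * (f t - f 0)) by field.
by rewrite normrM normrN mulrC; apply: ler_wpM2r.
Qed.

Lemma penergy_cvg (F : nat -> R -> R) w k : L2S w -> (forall N, SmoothS (F N)) ->
  intcirc (fun x => (w x - F N x) ^+ 2) @[N --> \oo] --> 0 ->
  penergy (dfun (F N)) k @[N --> \oo] --> penergy (dfun w) k.
Proof.
move=> hw sF cw; have h th := L2_limit_coef (th := th) (k := k) hw sF cw.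
apply: eq_cvgn (_ : _ @[N --> \oo] --> _).
  by move=> N; exact: penergyE.
rewrite penergyE; apply: cvgD.
  by apply: cvgn_scale; rewrite expr2; under eq_fun do rewrite expr2; exact: cvgM.
by apply: cvgn_scale; rewrite expr2; under eq_fun do rewrite expr2; exact: cvgM.
Qed.

Lemma En_fsum w N : L2S w -> En (fsum w N) = \sum_(k < N) k%:R * penergy (dfun w) k.
Proof.
move=> hw; have Iw := L2S_Intg hw; have sf : SmoothS (fsum w N) by exact: SmoothS_psum.
have sL := SmoothS_Lam sf.
transitivity (dfun (Lam (fsum w N)) (fsum w N)).
  by apply: eq_intcirc => x _; rewrite mulrC.
rewrite {2}/fsum distr_psum; last exact/Distr_dfun/SmoothS_Intg.
apply: eq_bigr => k _; rewrite !coef_Lam// -pmulrn ger0_norm//.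
rewrite /fsum !(coef_psum_eq _ Iw)// /penergy.
by move: (fcos _ _) (fsin _ _) (coef _ _ _) (coef _ _ _) => a b c d; ring.
Qed.

Lemma En_ge_sum v P : SmoothS v -> \sum_(k < P) k%:R * penergy (dfun v) k <= En v.
Proof.
move=> sv; have c := Lam_energy sv.
rewrite /En -(cvg_lim (@Rhausdorff R) c).
have nd : nondecreasing_seq (fun N => \sum_(k < N) k%:R * penergy (dfun v) k).
  apply/nondecreasing_seqP => N; rewrite big_ord_recr/= lerDl.
  by rewrite mulr_ge0// penergy_ge0.
exact: (nondecreasing_cvgn_le nd (cvgP _ c)).
Qed.

Lemma intcirc_fsum_le w N : L2S w ->
  intcirc (fun x => fsum w N x ^+ 2) <= intcirc (fun x => w x ^+ 2).
Proof.
move=> hw; apply: le_trans (bessel N hw).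
have sf : SmoothS (fsum w N) by exact: SmoothS_psum.
rewrite -[leLHS]/(dfun (fsum w N) (fsum w N)) {2}/fsum distr_psum; last exact/Distr_dfun/SmoothS_Intg.
rewrite le_eqVlt; apply/orP; left; apply/eqP; apply: eq_bigr => k _.
by rewrite /penergy !(coef_psum_eq _ (L2S_Intg hw)).
Qed.

End Stationarity.

(** * From stationarity to the vanishing of Q_Z along partial sums *)

Section StationaryFlow.
Variable R : realType.
Implicit Types (f g h v w : R -> R) (t s x y c e d : R) (k N P j : nat).

(** [C + 1] dominates the square root of [C] and keeps roots out of the constants. *)
Lemma sqr_le_bound (C x y : R) : 0 <= C -> 0 <= y -> x ^+ 2 <= C * y ^+ 2 -> `|x| <= (C + 1) * y.
Proof.
move=> C0 y0 h; rewrite -(@ler_pXn2r _ 2)// ?nnegrE ?mulr_ge0 ?addr_ge0//.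
rewrite real_normK ?num_real// (le_trans h)// exprMn ler_wpM2r ?sqr_ge0//.
by nra.
Qed.

Let arith1 (a b j : R) : a <= 6 * b -> b <= j -> 2 * a + 2 * b <= 14 * j.
Proof. by lra. Qed.

Let arith2 (a p q r : R) : p <= r -> q <= r -> a <= 2 * p + 2 * q -> a <= 4 * r.
Proof. by lra. Qed.

Let arith3 (a g1 g2 a1 b1 r y z : R) : g1 <= 6 * g2 -> g2 <= 4 * r -> a1 <= 2 * g1 + 2 * g2 ->
    a <= 2 * a1 + 2 * b1 -> b1 <= y -> y <= z -> a <= 112 * r + 2 * z.
Proof. by lra. Qed.

Let arith4 (r k q z : R) : r * (2 * k * q) <= z -> k * (q * r) <= z / 2.
Proof. by lra. Qed.

Let arith5 (y z : R) : y <= z / 2 -> z / 2 + y <= z.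
Proof. by lra. Qed.

Let arith7 (c x y : R) : 0 <= x -> c * (x * y) <= (c * y + 1) * x.
Proof. by nra. Qed.

Let arith8 (c x y z : R) : z <= c * x ^+ 2 * y * y -> z <= c * (x * y) ^+ 2.
Proof. by rewrite exprMn (expr2 y) !mulrA. Qed.

Section OneFlow.
Variables (Z : R -> R) (psi : R -> R -> R) (t0 : R).
Hypotheses (sZ : SmoothS Z) (fl : is_flow Z psi).
Hypothesis (h6 : forall (t : R) (h : R -> R), `|t| <= t0 -> L2S h ->
  L2S (h \o psi t) /\ intcirc (fun x => h (psi t x) ^+ 2) <= 6 * intcirc (fun x => h x ^+ 2)).

Let sv w N : SmoothS (fsum w N). Proof. exact: SmoothS_psum. Qed.

Lemma flow_fsum_cvg w t : `|t| <= t0 -> L2S w ->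
  intcirc (fun x => ((w \o psi t) x - (fsum w N \o psi t) x) ^+ 2) @[N --> \oo] --> 0.
Proof.
move=> tt0 hw.
apply: (@cvg_dist_le _ _ (fun N => 6 * intcirc (fun x => (w x - fsum w N x) ^+ 2))); last first.
  by rewrite -(mulr0 6); apply: cvgn_scale; exact: L2S_fsum_cvg.
move=> N; rewrite subr0 ger0_norm; last by apply: intcirc_ge0 => x _; exact: sqr_ge0.
have hd : L2S (fun x => w x - fsum w N x) by apply: L2S_sub => //; exact: SmoothS_L2S.
by have [] := h6 tt0 hd.
Qed.

(** By [En_flow_MVT] the energy changes by [2 t Q_Z] at some intermediate time, and Q_Z is
    controlled by L^2 norms, which the flow increases by at most a fixed factor. *)
Lemma flow_En_bounded w B t : `|t| <= t0 -> L2S w ->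
  (forall N, \sum_(k < N) k%:R * penergy (dfun w) k <= B) ->
  exists B', forall N, En (fsum w N \o psi t) <= B'.
Proof.
move=> tt0 hw hB; have [C C0 hC] := Qform_L2 sZ.
pose J := 6 * intcirc (fun x => w x ^+ 2).
exists (B + (C + 1) * J * `|t|) => N.
have [c ct E] := En_flow_MVT sZ fl t (sv w N).
have E' := canRL (subrK _) E; rewrite E' addrC; apply: lerD.
  by apply: le_trans (hB N); rewrite En_fsum.
rewrite (le_trans (ler_norm _))// normrM ler_wpM2r//.
have sc := SmoothS_flow fl c (sv w N).
have J0 : 0 <= intcirc (fun x => (fsum w N \o psi c) x ^+ 2).
  by apply: intcirc_ge0 => x _; exact: sqr_ge0.
have JJ : intcirc (fun x => (fsum w N \o psi c) x ^+ 2) <= J.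
  have [_ h] := h6 (le_trans ct tt0) (SmoothS_L2S (sv w N)).
  by apply: le_trans h _; rewrite ler_wpM2l//; exact: intcirc_fsum_le.
apply: sqr_le_bound => //; first exact: le_trans JJ.
have := hC _ _ sc sc; rewrite mulr_natl mulr2n -expr2 => h; apply: le_trans h _.
by apply: ler_wpM2l => //; rewrite lerXn2r ?nnegrE//; exact: le_trans JJ.
Qed.

(** Lower semicontinuity, one finite truncation at a time: the coefficients of the moved partial
    sums converge while their energies stay bounded. So the flow preserves H^{1/2}. *)
Lemma flow_penergy_bounded w B t : `|t| <= t0 -> L2S w ->
  (forall N, \sum_(k < N) k%:R * penergy (dfun w) k <= B) ->
  exists B', forall P, \sum_(k < P) k%:R * penergy (dfun (w \o psi t)) k <= B'.
Proof.
move=> tt0 hw hB; have [B' hB'] := flow_En_bounded tt0 hw hB; exists B' => P.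
have [hwt _] := h6 tt0 hw.
have cv : \sum_(k < P) k%:R * penergy (dfun (fsum w N \o psi t)) k @[N --> \oo] -->
    \sum_(k < P) k%:R * penergy (dfun (w \o psi t)) k.
  apply: cvgr_sum => k; apply: cvgn_scale; apply: penergy_cvg => //.
    by move=> N; exact: (SmoothS_flow fl t (sv w N)).
  exact: flow_fsum_cvg.
apply: cvgn_le cv _; apply: nearW => N.
by apply: le_trans (hB' N); apply: En_ge_sum; exact: (SmoothS_flow fl t (sv w N)).
Qed.

(** All later partial sums are L^2-close to a fixed smooth one, [fsum w N0], which the flow moves by
    O(|t|). Composition being bounded on L^2, every later partial sum moves little, and the
    continuity of Q_Z on L^2 concludes. *)
Lemma flow_En_uniform w e : L2S w -> 0 < e -> exists2 d : R, 0 < d & exists N0, forall t N,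
  `|t| <= t0 -> `|t| <= d -> (N0 <= N)%N ->
  `|En (fsum w N \o psi t) - En (fsum w N) - 2 * t * Qform Z (fsum w N) (fsum w N)| <= e * `|t|.
Proof.
move=> hw e0; have [C C0 hC] := Qform_L2 sZ.
pose J := intcirc (fun x => w x ^+ 2).
have J0 : 0 <= J by apply: intcirc_ge0 => x _; exact: sqr_ge0.
pose K := C * (14 * J) + 1.
have K0 : 0 < K by rewrite ltr_wpDl// !mulr_ge0.
(* Chosen so that [K * (112 * eta)] is half of [e ^+ 2]; the restriction on [t] supplies the other
   half. Here [14 = 2 * 6 + 2] and [112 = 2 * 14 * 4], from [intcirc_sqr_add_le] and the factor 6 of
   composition with the flow. *)
have eta0 : 0 < e ^+ 2 / (224 * K).
  by apply: divr_gt0; [exact: exprn_gt0|apply: mulr_gt0 => //; rewrite ltr0n].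
set eta := e ^+ 2 / (224 * K) in eta0.
have /cvgrPdist_le /(_ _ eta0)[N0 _ hN0] := L2S_fsum_cvg hw.
have {}hN0 N : (N0 <= N)%N -> intcirc (fun x => (w x - fsum w N x) ^+ 2) <= eta.
  by move=> NN; have := hN0 N NN; rewrite /= sub0r normrN => /(le_trans (ler_norm _)).
have [M ZM] := smoothS_Cbound 0 sZ; have [M' wM] := smoothS_Cbound 1 (sv w N0).
have M0 := Cbound_ge0 ZM; have M'0 := Cbound_ge0 wM.
pose L := M' * M; have L0 : 0 <= L by rewrite mulr_ge0.
pose Q := 4 * pi * L ^+ 2 + 1.
have Q0 : 0 < Q.
  by rewrite /Q ltr_wpDl//; apply: mulr_ge0; [rewrite mulr_ge0// pi_ge0|exact: sqr_ge0].
have dpos : 0 < e ^+ 2 / (2 * K * Q) by rewrite divr_gt0 ?exprn_gt0// !mulr_gt0.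
exists (Num.min 1 (e ^+ 2 / (2 * K * Q))); first by rewrite lt_min ltr01.
exists N0 => t N tt0; rewrite le_min => /andP[t1 td] NN.
have [c ct E] := En_flow_MVT sZ fl t (sv w N); rewrite E.
set v := fsum w N in E *; have sV : SmoothS v by exact: sv.
have sc := SmoothS_flow fl c sV.
have -> : 2 * Qform Z (v \o psi c) (v \o psi c) * t - 2 * t * Qform Z v v =
  2 * (Qform Z (v \o psi c) (v \o psi c) - Qform Z v v) * t.
  by move: (Qform _ _ _) (Qform _ _ _) => p q; ring.
rewrite normrM; apply: ler_wpM2r => //.
rewrite -(@ler_pXn2r _ 2)// ?nnegrE ?(ltW e0)// real_normK ?num_real//.
apply: le_trans (Qform_diff sZ hC sc sV) _.
have cc0 := le_trans ct tt0.
have hS : intcirc (fun x => ((v \o psi c) x + v x) ^+ 2) <= 14 * J.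
  apply: le_trans (intcirc_sqr_add_le (SmoothS_L2S sc) (SmoothS_L2S sV)) _.
  have [_ h] := h6 cc0 (SmoothS_L2S sV); have := intcirc_fsum_le N hw; rewrite -/v -/J => h'.
    exact: arith1 h h'.
have hD : intcirc (fun x => ((v \o psi c) x - v x) ^+ 2) <= 112 * eta + 4 * pi * L ^+ 2 * `|t|.
  (* [v o psi_c - v] is split into [g o psi_c - g], small because [g] is, and the displacement [b]
     of the fixed smooth function. *)
  pose g x := v x - fsum w N0 x; have sg : SmoothS g by apply: smoothS_sub.
  have hg : intcirc (fun x => g x ^+ 2) <= 4 * eta.
    have h1 : L2S (fun x => w x - fsum w N0 x) by apply: L2S_sub => //; exact: SmoothS_L2S.
    have h2 : L2S (fun x => v x - w x) by apply: L2S_sub => //; exact: SmoothS_L2S.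
    have := intcirc_sqr_add_le h1 h2.
    rewrite (eq_intcirc (f := fun x => (w x - fsum w N0 x + (v x - w x)) ^+ 2) (g := fun x => g x ^+ 2)); last first.
      by move=> x _; congr (_ ^+ 2); rewrite /g addrC addrA subrK.
    rewrite (eq_intcirc (f := fun x => (v x - w x) ^+ 2) (g := fun x => (w x - v x) ^+ 2)); last first.
      by move=> x _; rewrite -sqrrN opprB.
        by apply: arith2; [exact: hN0 (leqnn N0)|exact: hN0 NN].
  have sgc := SmoothS_flow fl c sg; have [_ hgc] := h6 cc0 (SmoothS_L2S sg).
  pose b x := (fsum w N0 \o psi c) x - fsum w N0 x.
  have sb : SmoothS b by apply: smoothS_sub => //; exact: (SmoothS_flow fl c (sv w N0)).
  have sA : SmoothS (fun x => (g \o psi c) x + - g x).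
    by apply: smoothS_add => //; exact: smoothS_opp.
  have bL x : `|b x| <= L * `|c|.
    apply: le_trans (SmoothS_Lipschitz (sv w N0) wM _ _) _.
    rewrite /L -mulrA; apply: ler_wpM2l => //; exact: (flow_near_id fl _ _ ZM).
  have := intcirc_sqr_add_le (SmoothS_L2S sA) (SmoothS_L2S sb).
  have := intcirc_sqr_add_le (SmoothS_L2S sgc) (SmoothS_L2S (smoothS_opp sg)).
  rewrite (eq_intcirc (f := fun x => (- g x) ^+ 2) (g := fun x => g x ^+ 2)); last first.
    by move=> x _; rewrite sqrrN.
  rewrite (eq_intcirc (f := fun x => (_ + b x) ^+ 2) (g := fun x => ((v \o psi c) x - v x) ^+ 2)); last first.
    by move=> x _; congr (_ ^+ 2); rewrite /g /b /=; ring.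
  have hb := intcirc_sqr_le sb bL.
  have hLc : (L * `|c|) ^+ 2 * (2 * pi) <= 2 * pi * L ^+ 2 * `|t|.
    have p0 := twopi_ge0 R; rewrite exprMn; move: (2 * pi) p0 => p p0.
    rewrite mulrC mulrA; apply: ler_wpM2l; first by rewrite mulr_ge0 ?sqr_ge0.
    by rewrite expr2 (le_trans (ler_wpM2l (normr_ge0 _) ct))// ler_piMl// (le_trans ct).
    have -> : 4 * pi * L ^+ 2 * `|t| = 2 * (2 * pi * L ^+ 2 * `|t|).
    by rewrite !mulrA -natrM.
  move=> hA hT; exact: arith3 hgc hg hA hT hb hLc.
apply: (@le_trans _ _ (C * ((112 * eta + 4 * pi * L ^+ 2 * `|t|) * (14 * J)))).
  apply: ler_wpM2l => //; apply: ler_pM => //.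
  - by apply: intcirc_ge0 => x _; exact: sqr_ge0.
  - by apply: intcirc_ge0 => x _; exact: sqr_ge0.
have h1 : K * (112 * eta) = e ^+ 2 / 2 by rewrite /eta; field; rewrite gt_eqF.
have h2 : K * (4 * pi * L ^+ 2 * `|t|) <= e ^+ 2 / 2.
  apply: (@le_trans _ _ (K * (Q * `|t|))).
    by rewrite ler_wpM2l ?(ltW K0)// ler_wpM2r// /Q lerDl.
  move: td; rewrite ler_pdivlMr ?mulr_gt0// => td.
    exact: arith4 td.
set X := 112 * eta + 4 * pi * L ^+ 2 * `|t|.
have X0 : 0 <= X.
  by apply: le_trans hD; apply: intcirc_ge0 => x _; exact: sqr_ge0.
have KX : K * X <= e ^+ 2.
    by rewrite /X mulrDr h1; exact: arith5.
by apply: le_trans KX; exact: arith7.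
Qed.

End OneFlow.

Lemma energy_cvg m (u : 'I_m -> R -> R) : (forall i, L2S (u i)) ->
  (forall i, exists B, forall N, \sum_(k < N) k%:R * penergy (dfun (u i)) k <= B) ->
  \sum_(i < m) \sum_(k < P) k%:R * penergy (dfun (u i)) k @[P --> \oo] --> energy u.
Proof.
move=> hu hB; rewrite /energy intcirc_sum; last first.
  by move=> i; have [B hBi] := hB i; have [] := laplL2_energy (hu i) hBi.
by apply: cvgr_sum => i; have [B hBi] := hB i; have [] := laplL2_energy (hu i) hBi.
Qed.

Lemma H12_Hle m (u : 'I_m -> R -> R) i : H12 u -> exists B, Hle 2^-1 (pw (dfun (u i))) B.
Proof.
move=> hu; have [hi hH] := hu i.
have H0 : (0 <= Hnorm2 2^-1 (dfun (u i)))%E.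
  by apply: esum_ge0 => n _; rewrite lee_fin mulr_ge0 ?sqr_ge0 ?powR_ge0.
have fin : Hnorm2 2^-1 (dfun (u i)) \is a fin_num by rewrite ge0_fin_numE.
exists ((2 * pi) ^+ 2 * fine (Hnorm2 2^-1 (dfun (u i)))).
by apply/Hnorm2_Hle; rewrite fineK.
Qed.

Lemma H12_penergy m (u : 'I_m -> R -> R) i : H12 u ->
  exists B, forall N, \sum_(k < N) k%:R * penergy (dfun (u i)) k <= B.
Proof.
move=> hu; have [B hle] := H12_Hle i hu; exists B => N.
apply: le_trans (Hle_nat N (fun n => pw_ge0 _ n) hle); apply: ler_sum => k _.
apply: ler_pM => //; [exact: penergy_ge0| |exact: penergy_le_pw].
rewrite /wgt powR12_sqrt; last by rewrite addr_ge0// sqr_ge0.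
rewrite -[leLHS](@ger0_norm _ k%:R)// -sqrtr_sqr ler_sqrt ?addr_ge0 ?sqr_ge0//.
by rewrite lerDr.
Qed.

Lemma finite_uniform m (Q : 'I_m -> R -> nat -> Prop) :
  (forall i d d' N N', d' <= d -> (N <= N')%N -> Q i d N -> Q i d' N') ->
  (forall i, exists2 d : R, 0 < d & exists N, Q i d N) ->
  exists2 d : R, 0 < d & exists N, forall i, Q i d N.
Proof.
move=> mono h.
have /choice[d hd] : forall i, exists d, 0 < d /\ exists N, Q i d N.
  by move=> i; have [d d0 hN] := h i; exists d.
have /choice[N hN] : forall i, exists N, Q i (d i) N by move=> i; have [_] := hd i.
have d0 i : 0 < d i by have [] := hd i.
have s0 (I : {pred 'I_m}) : 0 <= \sum_(i in I) (d i)^-1.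
  by apply: sumr_ge0 => i _; rewrite invr_ge0 ltW.
have S0 : 0 < 1 + \sum_i (d i)^-1 by rewrite ltr_pwDl// s0.
(* This reciprocal lies below every [d i], and the added 1 keeps it positive for an empty family. *)
exists (1 + \sum_i (d i)^-1)^-1; first by rewrite invr_gt0.
exists (\sum_i N i)%N => i; apply: mono (hN i).
  rewrite invf_ple ?posrE// (bigD1 i)//= addrCA lerDl addr_ge0//.
  by apply: sumr_ge0 => j _; rewrite invr_ge0 ltW.
by rewrite (bigD1 i)//= leq_addr.
Qed.

Lemma cvgn_near_ge (a : nat -> R) (l e : R) : 0 < e -> a N @[N --> \oo] --> l ->
  exists N0, forall N, (N0 <= N)%N -> l - e <= a N.
Proof.
move=> e0 /cvgrPdist_le /(_ _ e0)[N0 _ h]; exists N0 => N /h/=.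
by rewrite ler_norml => /andP[_]; lra.
Qed.

Let arith6 (e t' q S' S0' E' E0' : R) : 0 <= e -> 
  E' - E0' >= - (e * t') -> S' >= E' - 2 * (e * t') -> S0' <= E0' ->
  `|S' - S0' - q| <= e * t' -> - (4 * (e * t')) <= q.
Proof. by move=> e0 h1 h2 h3; rewrite ler_norml => /andP[_ h4]; lra. Qed.

(* [E t <= liminf En (v_N o psi_t)] and [E 0 = sup En v_N]: the uniform expansion
   of [En (v_N o psi_t)] bounds [2 t q N] below by [- 4 e |t|] for both [t = tau]
   and [t = - tau]. *)
Lemma stationary_trig m (u : 'I_m -> R -> R) k (th : R) : H12 u -> stationary u ->
  \sum_(i < m) Qform (trig k th) (fsum (u i) N) (fsum (u i) N) @[N --> \oo] --> 0.
Proof.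
move=> hu st; have [psi fl] := trig_flow k th; set Z : R -> R := trig k th in fl *.
have sZ : SmoothS Z by exact: SmoothS_trig.
have hU i : L2S (u i) by have [] := hu i.
have hB i := H12_penergy i hu.
have [t0 t00 h6] := flow_L2_le sZ fl.
pose E t := energy (fun i => u i \o psi t).
have hE : is_derive (0 : R) 1 E 0 by exact: (st Z psi ((SmoothSP _).1 sZ) fl).
have u0 : (fun i => u i \o psi 0) = u.
  by apply/funext => i; apply/funext => x; rewrite /= (flow0 fl).
have Ecv t : `|t| <= t0 -> \sum_(i < m) \sum_(k < P) k%:R * penergy (dfun (u i \o psi t)) k @[P --> \oo] --> E t.
  move=> tt0; apply: energy_cvg => i; first by have [] := h6 t (u i) tt0 (hU i).
  by have [B hBi] := hB i; exact: (flow_penergy_bounded sZ fl h6 tt0 (hU i) hBi).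
have sv i N : SmoothS (fsum (u i) N) by exact: SmoothS_psum.
(* One [e] truncates the energy at a frequency [P]; the other lets [N] grow with [P] fixed, where
   only finitely many coefficients occur. *)
have lower t e : `|t| <= t0 -> 0 < e -> exists N0, forall N, (N0 <= N)%N ->
    E t - 2 * e <= \sum_(i < m) En (fsum (u i) N \o psi t).
  move=> tt0 e0; have [P hP] := cvgn_near_ge e0 (Ecv t tt0).
  have cv : \sum_(i < m) \sum_(k < P) k%:R * penergy (dfun (fsum (u i) N \o psi t)) k @[N --> \oo] -->
      \sum_(i < m) \sum_(k < P) k%:R * penergy (dfun (u i \o psi t)) k.
    apply: cvgr_sum => i; apply: cvgr_sum => j; apply: cvgn_scale.
    have [hut _] := h6 t (u i) tt0 (hU i); apply: penergy_cvg => //.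
      by move=> N; exact: (SmoothS_flow fl t (sv i N)).
    exact: (flow_fsum_cvg h6 tt0 (hU i)).
  have [N0 hN0] := cvgn_near_ge e0 cv; exists N0 => N NN.
  have h1 := hP P (leqnn P); have h2 := hN0 N NN.
  have h3 : \sum_(i < m) \sum_(k < P) k%:R * penergy (dfun (fsum (u i) N \o psi t)) k <=
      \sum_(i < m) En (fsum (u i) N \o psi t).
    by apply: ler_sum => i _; apply: En_ge_sum; exact: (SmoothS_flow fl t (sv i N)).
  by apply: le_trans h3; apply: le_trans h2; rewrite mulr_natl mulr2n opprD addrA lerB.
have upper N : \sum_(i < m) En (fsum (u i) N) <= E 0.
  have cv := energy_cvg hU hB; rewrite /E u0.
  rewrite -(cvg_lim (@Rhausdorff R) cv).
  have nd : nondecreasing_seq (fun P => \sum_(i < m) \sum_(k < P) k%:R * penergy (dfun (u i)) k).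
    apply/nondecreasing_seqP => P; apply: ler_sum => i _; rewrite big_ord_recr/= lerDl.
    by rewrite mulr_ge0// penergy_ge0.
  apply: le_trans (nondecreasing_cvgn_le nd (cvgP _ cv) N).
  by apply: ler_sum => i _; rewrite En_fsum.
pose q N := \sum_(i < m) Qform Z (fsum (u i) N) (fsum (u i) N).
rewrite -/q; suff H e : 0 < e -> exists N0, forall N, (N0 <= N)%N -> `|q N| <= 2 * e.
  apply/cvgrPdist_le => e e0; have [N0 h] := H (e / 2) (divr_gt0 e0 (ltr0Sn R 1)).
  by exists N0 => // N /= /h; rewrite sub0r normrN mulrCA divff ?mulr1// pnatr_eq0.
(* The errors of the [m] components then add up to at most [e]. *)
move=> e0; have e'0 : 0 < e / m.+1%:R by rewrite divr_gt0.
have [d d0 [N1 hd]] : exists2 d : R, 0 < d & exists N, forall i t N', `|t| <= t0 -> `|t| <= d -> (N <= N')%N ->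
    `|En (fsum (u i) N' \o psi t) - En (fsum (u i) N') - 2 * t * Qform Z (fsum (u i) N') (fsum (u i) N')| <= e / m.+1%:R * `|t|.
  apply: finite_uniform.
    move=> i a a' N N' aa NN h t P tt0 ta NP.
    by apply: h => //; [exact: le_trans aa|exact: leq_trans NP].
  by move=> i; exact: (flow_En_uniform sZ fl h6 (hU i) e'0).
have [d' d'0 hd'] := is_derive_littleo hE e0.
pose tau := Num.min t0 (Num.min d d').
have tau0 : 0 < tau by rewrite !lt_min t00 d0.
have key t : `|t| = tau -> exists N0, forall N, (N0 <= N)%N -> - (4 * (e * tau)) <= 2 * t * q N.
  move=> tt; have := lexx tau; rewrite -{1}tt {2}/tau !le_min => /and3P[tt0 td td'].
  have [N0 hN0] := lower t (e * tau) tt0 (mulr_gt0 e0 tau0).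
  exists (maxn N0 N1) => N; rewrite geq_max => /andP[NN0 NN1].
  apply: (@arith6 e tau _ (\sum_(i < m) En (fsum (u i) N \o psi t)) (\sum_(i < m) En (fsum (u i) N)) (E t) (E 0)).
  - exact: ltW.
  - by have := hd' t td'; rewrite mulr0 subr0 tt ler_norml => /andP[].
  - exact: hN0.
  - exact: upper.
  - rewrite /q mulr_sumr -!sumrB (le_trans (ler_norm_sum _ _ _))//.
    apply: (@le_trans _ _ (\sum_(i < m) e / m.+1%:R * tau)).
      by apply: ler_sum => i _; rewrite -tt; exact: hd.
    rewrite sumr_const card_ord -[leLHS]mulr_natr (mulrAC _ tau) ler_wpM2r ?(ltW tau0)//.
    by rewrite -mulrA ler_piMr ?(ltW e0)// mulrC ler_pdivrMr// mul1r ler_nat.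
have [N2 hN2] := key tau (ger0_norm (ltW tau0)).
have [N3 hN3] : exists N0, forall N, (N0 <= N)%N -> - (4 * (e * tau)) <= 2 * - tau * q N.
  by apply: key; rewrite normrN ger0_norm// ltW.
exists (maxn N2 N3) => N; rewrite geq_max => /andP[/hN2 h2 /hN3 h3].
rewrite ler_norml; apply/andP; split; rewrite -(ler_pM2r tau0).
  by move: (q N) h2 => z; lra.
by move: (q N) h3 => z; lra.
Qed.

Lemma Qform_dfun Z v : Qform Z v v = dfun (fun x => Lam v x * derive1 v x) Z.
Proof. by []. Qed.

Lemma SmoothS_Qdensity v : SmoothS v -> SmoothS (fun x => Lam v x * derive1 v x).
Proof. by move=> sv; apply: smoothS_mul; [exact: SmoothS_Lam|exact: smoothS_derive1]. Qed.

(** Replacing [Z] by a Fourier partial sum [fsum Z P] costs an error that tends to 0 with [P]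
    uniformly in [N], so the limit in [N] may be taken first, at fixed [P]. *)
Lemma stationary_Qform m (u : 'I_m -> R -> R) Z : H12 u -> stationary u -> SmoothS Z ->
  \sum_(i < m) Qform Z (fsum (u i) N) (fsum (u i) N) @[N --> \oo] --> 0.
Proof.
move=> hu st sZ; have hU i : L2S (u i) by have [] := hu i.
have sv i N : SmoothS (fsum (u i) N) by exact: SmoothS_psum.
pose q Y N := \sum_(i < m) Qform Y (fsum (u i) N) (fsum (u i) N).
rewrite -/(q Z).
have qP P : q (fsum Z P) N @[N --> \oo] --> 0.
  have E N : q (fsum Z P) N = \sum_(k < P) (fcos (dfun Z) k * q (trig k 0) N
      + fsin (dfun Z) k * q (trig k (pi / 2)) N).
    rewrite /q; under [RHS]eq_bigr do rewrite !mulr_sumr -big_split/=.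
    rewrite exchange_big; apply: eq_bigr => i _; rewrite Qform_dfun /fsum distr_psum//.
    by apply: Distr_dfun; apply: SmoothS_Intg; apply: SmoothS_Qdensity; exact: SmoothS_psum.
  have S0 : \sum_(k < P) (fcos (dfun Z) k * 0 + fsin (dfun Z) k * 0) = 0.
    by rewrite big1// => k _; rewrite !mulr0 addr0.
  apply: eq_cvgn E _; rewrite -[X in _ --> X]S0.
  by apply: cvgr_sum => k; apply: cvgD; apply: cvgn_scale; exact: stationary_trig.
have [e ce he] := fsum_cvg 6 sZ.
(* Independent of [N], since partial sums do not increase the L^2 norm. *)
pose K := \sum_(i < m) (Cop R + 1) * (2 * (2 * pi * intcirc (fun x => u i x ^+ 2))).
have dq P N : `|q Z N - q (fsum Z P) N| <= e P * K.
  have eP0 := Cbound_ge0 (he P).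
  rewrite /q -sumrB (le_trans (ler_norm_sum _ _ _))// /K mulr_sumr; apply: ler_sum => i _.
  have sP : SmoothS (fsum Z P) by exact: SmoothS_psum.
  have sD : SmoothS (fun x => Z x - fsum Z P x) by exact: smoothS_sub.
  have -> : Qform Z (fsum (u i) N) (fsum (u i) N) - Qform (fsum Z P) (fsum (u i) N) (fsum (u i) N)
      = Qform (fun x => Z x - fsum Z P x) (fsum (u i) N) (fsum (u i) N).
    rewrite !Qform_dfun distr_sub//.
    by apply: Distr_dfun; apply: SmoothS_Intg; apply: SmoothS_Qdensity; exact: sv.
  have hv := L2S_Hle0 (SmoothS_L2S (sv i N)).
  have := Qform_bound sD (sv i N) (sv i N) (he P) hv hv.
  set B := 2 * (2 * pi * intcirc _); set Q := Qform _ _ _.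
  set B' := 2 * (2 * pi * intcirc (fun x => u i x ^+ 2)) => hQ.
  have B0 : 0 <= B := Hle_ge0 hv.
  have BB : B <= B'.
    rewrite /B /B'; apply: ler_wpM2l => //; apply: ler_wpM2l; first exact: twopi_ge0.
    exact: intcirc_fsum_le.
  have : `|Q + Q| <= (Cop R + 1) * (e P * B).
    apply: sqr_le_bound; [exact: Cop_ge0|exact: mulr_ge0|].
    exact: arith8.
  have C0 : 0 <= Cop R + 1 by rewrite addr_ge0// Cop_ge0.
  move=> hQ2; apply: (@le_trans _ _ `|Q + Q|); first by rewrite -mulr2n normrMn mulr2n lerDl.
  apply: le_trans hQ2 _; rewrite [leRHS]mulrCA; apply: ler_wpM2l => //.
  exact: ler_wpM2l.
apply/cvgrPdist_le => d d0.
have ceK : e P * K @[P --> \oo] --> 0 by rewrite -(mul0r K); apply: cvgMl.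
have d2 : 0 < d / 2 by rewrite divr_gt0.
have /cvgrPdist_le /(_ _ d2)[P _ /(_ P (leqnn P))/=] := ceK.
rewrite sub0r normrN => /(le_trans (ler_norm _)) hP.
have /cvgrPdist_le /(_ _ d2)[N0 _ hN] := qP P.
exists N0 => // N /= /hN; rewrite /= !sub0r !normrN => hN'.
rewrite -[q Z N](subrK (q (fsum Z P) N)) (le_trans (ler_normD _ _))//.
by have := dq P N; lra.
Qed.

End StationaryFlow.

(** * The invariance hypothesis *)

Section Conformal.
Variable R : realType.
Implicit Types (f g h v w : R -> R) (t s x y th : R) (k N : nat).

Lemma Lam_cst c : Lam (fun=> c : R) = fun=> 0.
Proof.
have -> : (fun=> c) = fun x : R => c * trig 0 0 x.
  by apply/funext => x; rewrite /trig mul0r subr0 cos0 mulr1.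
rewrite LamZ; last exact: SmoothS_trig.
by rewrite Lam_trig; apply/funext => x; rewrite mul0r mulr0.
Qed.

Variables (m : nat) (X : R -> R) (phi : R -> R -> R).
Hypotheses (m1 : (1 <= m)%N) (sX : SmoothS X) (fl : is_flow X phi).
Hypothesis hinv : forall v : 'I_m -> R -> R, (forall i, smoothS (v i)) ->
    \forall t \near (0 : R), forall x : R,
      \sum_(i < m) v i (phi t x) * laplC 2^-1 (v i \o phi t) x =
      (\sum_(i < m) v i (phi t x) * laplC 2^-1 (v i) (phi t x))
        * derive1 (phi t) x.

(** The hypothesis is tested on a map with a single nonzero component, whose index exists because
    [m >= 1]. *)
Lemma conformal_scalar w : SmoothS w -> \forall t \near (0 : R), forall x,
  w (phi t x) * Lam (w \o phi t) x = w (phi t x) * Lam w (phi t x) * derive1 (phi t) x.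
Proof.
move=> sw; pose v (i : 'I_m) := if i == Ordinal m1 then w else fun=> 0.
have sv i : smoothS (v i).
  by apply/SmoothSP; rewrite /v; case: ifP => // _; exact: smoothS_cst.
have := hinv sv; apply: filterS => t ht x; have := ht x.
rewrite (bigD1 (Ordinal m1))//= [in X in _ = X](bigD1 (Ordinal m1))//=.
rewrite !big1 ?addr0; last 2 first.
- by move=> i /negbTE i0; rewrite /v i0 mul0r.
- by move=> i /negbTE i0; rewrite /v i0 mul0r.
rewrite /v eqxx !laplC_Lam//; exact: (SmoothS_flow fl t sw).
Qed.

(* Polarization: subtract the identities for [1 + w] and [w]. *)
Lemma Lam_conformal w : SmoothS w -> \forall t \near (0 : R), forall x,
  Lam (w \o phi t) x = Lam w (phi t x) * derive1 (phi t) x.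
Proof.
move=> sw; have s1 : SmoothS (fun=> 1 : R) by exact: smoothS_cst.
have sw1 : SmoothS (fun x => 1 + w x) by exact: smoothS_add.
apply: filterS2 (conformal_scalar sw) (conformal_scalar sw1) => t h1 h2 x.
have swt := SmoothS_flow fl t sw; have := h2 x.
have -> : (fun x => 1 + w x) \o phi t = fun x => 1 + (w \o phi t) x by [].
rewrite !LamD// Lam_cst !add0r !mulrDl !mul1r (h1 x).
by move=> /addIr.
Qed.

(** [Lam (trig k th)] is the derivative of the phase-shifted wave [W], so [Lam_conformal] reads L(w
    o phi_t) = (W o phi_t)'. Paired with [g], both operators move onto [g], leaving two integrals
    that [flow_intcirc_derive] differentiates at [t = 0]. *)
Lemma conformal_trig k th g : SmoothS g ->
  intcirc (fun x => derive1 (trig k th) x * X x * Lam g x) =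
  - intcirc (fun x => Lam (trig k th) x * X x * derive1 g x).
Proof.
move=> sg; have sw : SmoothS (trig k th : R -> R) by exact: SmoothS_trig.
have sLg := SmoothS_Lam sg; have sg' := smoothS_derive1 sg.
pose W x : R := - 1 * trig k (th - pi / 2) x.
have sW0 : SmoothS (trig k (th - pi / 2) : R -> R) by exact: SmoothS_trig.
have sW : SmoothS W by exact: smoothS_scale.
have dW : derive1 W = Lam (trig k th).
  rewrite /W derive1_scaleE; last by case: sW0.
  rewrite derive1_trig Lam_trig; apply/funext => x.
  by rewrite subrK mulN1r mulNr opprK -pmulrn.
have h1 := flow_intcirc_derive sX fl sw (SmoothS_continuous sLg).
have h2 := flow_intcirc_derive sX fl sW (SmoothS_continuous sg').
have h3 := is_derive1_comp (is_derive_affine (- 1) 0 _) h2.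
have E : \forall t \near (0 : R), intcirc (fun x => trig k th (phi t x) * Lam g x) =
    ((fun s => - 1 * s + 0) \o (fun t => intcirc (fun x => W (phi t x) * derive1 g x))) t.
  apply: filterS (Lam_conformal sw) => t ht /=.
  have swt := SmoothS_flow fl t sw; have sWt := SmoothS_flow fl t sW.
  rewrite -[LHS]/(dfun (trig k th \o phi t) (Lam g)) -dfun_Lam//.
  transitivity (intcirc (fun x => derive1 (W \o phi t) x * g x)).
    by apply: eq_intcirc => x _; rewrite ht (derive1_comp_flow fl)// dW.
  by rewrite intcirc_parts// mulN1r addr0.
have h4 := near_eq_is_derive E h1.
have e1 := @derive_val _ _ _ _ _ _ _ h4; have e2 := @derive_val _ _ _ _ _ _ _ h3.
by rewrite -e1 e2 mulN1r dW.
Qed.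

(** The difference of the two sides is a distribution in its first argument that vanishes on every
    trigonometric function. *)
Lemma conformal_psum a b N g : SmoothS g ->
  intcirc (fun x => derive1 (psum a b N) x * X x * Lam g x) =
  - intcirc (fun x => Lam (psum a b N) x * X x * derive1 g x).
Proof.
move=> sg; have sLg := SmoothS_Lam sg; have sg' := smoothS_derive1 sg.
have sA : SmoothS (fun x => X x * Lam g x) by exact: smoothS_mul.
have sB : SmoothS (fun x => X x * derive1 g x) by exact: smoothS_mul.
pose S : distr R := fun w => dfun (fun x => X x * derive1 g x) (Lam w)
  - dderiv (dfun (fun x => X x * Lam g x)) w.
have dS : Distr S.
  apply: Distr_sub; first exact/Distr_Lam/SmoothS_Intg.
  exact/Distr_dderiv/Distr_dfun/SmoothS_Intg.
have SE w : S w = intcirc (fun x => Lam w x * X x * derive1 g x)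
    + intcirc (fun x => derive1 w x * X x * Lam g x).
  rewrite /S /dderiv /dfun opprK; congr (_ + _); apply: eq_intcirc => x _.
    by rewrite mulrC mulrA.
  by rewrite mulrC mulrA.
have S0 k th : coef S th k = 0.
  by rewrite /coef SE conformal_trig// subrr.
have : S (psum a b N) = 0.
  by rewrite distr_psum// big1// => k _; rewrite !S0 !mulr0 addr0.
by rewrite SE => /eqP; rewrite addr_eq0 => /eqP ->; rewrite opprK.
Qed.

Definition Dform a b f : R := intcirc (fun x => (Lam a x * b x - Lam b x * a x) * f x).

(** Move L from [v' X] onto [v f], apply [conformal_psum] with [g = v f] and expand
    [(v f)' = v' f + v f']. The term [P2], which is [Qform] with field [X f], arises both here and
    from the second half of D, whence the factor 2. *)
Lemma Dform_conformal a b N f : SmoothS f -> let v := psum a b N in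
  Dform (fun x => derive1 v x * X x) v f =
  - intcirc (fun x => Lam v x * (v x * X x * derive1 f x)) - 2 * Qform (fun x => X x * f x) v v.
Proof.
move=> sf v; have sv : SmoothS v by exact: SmoothS_psum.
have sv' := smoothS_derive1 sv; have sL := SmoothS_Lam sv; have sf' := smoothS_derive1 sf.
have svX : SmoothS (fun x => derive1 v x * X x) by exact: smoothS_mul.
have svf : SmoothS (fun x => v x * f x) by exact: smoothS_mul.
pose P1 x := Lam (fun y => derive1 v y * X y) x * (v x * f x).
pose P2 x := Lam v x * derive1 v x * (X x * f x).
pose P3 x := Lam v x * (v x * X x * derive1 f x).
have s1 : SmoothS P1 by apply: smoothS_mul => //; exact: SmoothS_Lam.
have s2 : SmoothS P2 by apply: smoothS_mul; exact: smoothS_mul.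
have s3 : SmoothS P3 by apply: smoothS_mul => //; apply: smoothS_mul => //; exact: smoothS_mul.
have E1 : Dform (fun x => derive1 v x * X x) v f = intcirc P1 - intcirc P2.
  apply: etrans _ (intcirc_sub (SmoothS_Intg s1) (SmoothS_Intg s2)).
  apply: eq_intcirc => x _; rewrite /P1 /P2; move: (Lam _ x) (Lam _ x) (derive1 v x) => p q r.
  ring.
have E2 : intcirc P1 = - (intcirc P2 + intcirc P3).
  apply: etrans (dfun_Lam svX svf) _; apply: etrans (conformal_psum a b N svf) _; congr (- _).
  apply: etrans _ (intcirc_add (SmoothS_Intg s2) (SmoothS_Intg s3)).
  apply: eq_intcirc => x _; rewrite /P2 /P3.
  have -> : derive1 (fun x => v x * f x) x = derive1 v x * f x + v x * derive1 f x.
    by rewrite derive1_mulE//; [case: sv|case: sf].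
  rewrite -/v; move: (Lam _ x) (derive1 v x) (derive1 f x) => p q r.
  ring.
have R1 (p q : R) : - (p + q) - p = - q - 2 * p by ring.
by rewrite E1 E2; exact: R1.
Qed.

End Conformal.

(** * Limits in H^{1/2} and H^{-1/2} *)

Section SobolevLimits.
Variable R : realType.
Implicit Types (f g h v w : R -> R) (S T : distr R) (s x y th B : R) (n : int) (k N P : nat).

Lemma Hle_mono s (w : int -> R) (B B' : R) : B <= B' -> Hle s w B -> Hle s w B'.
Proof. by move=> BB h F uF; exact: le_trans (h F uF) BB. Qed.

Lemma Hle_pw_le s (w w' : int -> R) (B : R) : (forall n, w' n <= w n) -> Hle s w B -> Hle s w' B.
Proof.
move=> ww h F uF; apply: le_trans (h F uF); apply: ler_sum => n _.
by rewrite ler_wpM2l// wgt_ge0.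
Qed.

Lemma Hle_sub s S T (B B' : R) : Hle s (pw S) B -> Hle s (pw T) B' ->
  Hle s (pw (fun g => S g - T g)) (2 * (B + B')).
Proof.
move=> hS hT; apply: (@Hle_le _ s s (fun n => pw S n + pw T n)) (Hle_add hS hT) => //.
move=> n; rewrite mulrCA; apply: ler_wpM2l; first exact: wgt_ge0.
rewrite /pw /coef.
have h (a b : R) : (a - b) ^+ 2 <= 2 * (a ^+ 2 + b ^+ 2).
  by have := sqr_ge0 (a + b); nra.
by rewrite addrACA mulrDr; apply: lerD; exact: h.
Qed.

Lemma Hle_dfun_sub s f g T (B B' : R) : Intg f -> Intg g ->
  Hle s (pw (fun h => dfun f h - T h)) B -> Hle s (pw (fun h => dfun g h - T h)) B' ->
  Hle s (pw (dfun (fun x => f x - g x))) (2 * (B + B')).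
Proof.
move=> If Ig hf hg; apply: eq_Hle (Hle_sub hf hg) => n.
rewrite /pw !coef_dfun_sub// /coef.
have E (a b c : R) : a - c - (b - c) = a - b by ring.
by rewrite !E.
Qed.

Lemma cvgH_Hle s (f : nat -> R -> R) T (e : R) : cvgH s f T -> 0 < e ->
  exists K, forall k, (K <= k)%N -> Hle s (pw (fun g => dfun (f k) g - T g)) e.
Proof.
move=> c e0; have p0 : 0 < (2 * pi) ^+ 2 :> R by rewrite exprn_gt0// twopi_gt0.
pose d : R := ((2 * pi) ^+ 2)^-1 * e; have d0 : 0 < d by rewrite mulr_gt0// invr_gt0.
have := c _ (@nbhs_open_ereal_lt _ 0 (fun r => r + d) _); rewrite add0r => /(_ d0)[K _ h].
exists K => k /h/= /ltW hk; have -> : e = (2 * pi) ^+ 2 * d by rewrite mulrA divff ?mul1r// gt_eqF.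
exact/Hnorm2_Hle.
Qed.

Lemma Hle_cvgH s (f : nat -> R -> R) T (e : nat -> R) : e N @[N --> \oo] --> 0 ->
  (forall k, Hle s (pw (fun g => dfun (f k) g - T g)) (e k)) -> cvgH s f T.
Proof.
move=> e0 h; have p0 : 0 < (2 * pi) ^+ 2 :> R by rewrite exprn_gt0// twopi_gt0.
pose d k : R := ((2 * pi) ^+ 2)^-1 * e k.
have cd : d k @[k --> \oo] --> 0 by rewrite -(mulr0 ((2 * pi) ^+ 2)^-1); apply: cvgn_scale.
apply: (@squeeze_cvge _ _ _ _ (cst 0%E) _ (fun k => (d k)%:E)).
- apply: nearW => k; apply/andP; split.
    by apply: esum_ge0 => n _; rewrite lee_fin mulr_ge0 ?sqr_ge0 ?powR_ge0.
  by apply/Hnorm2_Hle; rewrite mulrA divff ?mul1r// gt_eqF.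
- exact: cvg_cst.
- by apply: cvg_comp cd _; exact: cvg_refl.
Qed.

Lemma wgt_half n : wgt (2^-1 : R) n ^+ 2 = 1 + n%:~R ^+ 2.
Proof.
have h : 0 <= 1 + n%:~R ^+ 2 :> R by rewrite addr_ge0 ?sqr_ge0.
by rewrite /wgt powR12_sqrt// sqr_sqrtr.
Qed.

Lemma wgt_half_shift n : wgt (- 2^-1 : R) n * n%:~R ^+ 2 <= wgt (2^-1) n.
Proof.
have := wgt_half n; have := wgtN (2^-1 : R) n; have := wgt_ge0 (- 2^-1 : R) n.
move: (wgt (- 2^-1) n) (wgt 2^-1 n) => b a b0 ab a2.
have -> : n%:~R ^+ 2 = a ^+ 2 - 1 by rewrite a2 addrAC subrr add0r.
by rewrite mulrBr mulr1 expr2 mulrA ab mul1r gerBl.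
Qed.

(** Loss of one derivative from H^{1/2} to H^{-1/2}; the hypothesis covers both d/dx and
    (-Delta)^{1/2}, which have the same modulus on each frequency. *)
Lemma Hle_derivative S T (B : R) : (forall n, pw S n = n%:~R ^+ 2 * pw T n) ->
  Hle 2^-1 (pw T) B -> Hle (- 2^-1) (pw S) B.
Proof.
move=> E h; rewrite -[B]mul1r; apply: Hle_le h => // n.
by rewrite mul1r E mulrA ler_wpM2r ?pw_ge0//; exact: wgt_half_shift.
Qed.

Lemma pw_dderiv T n : Distr T -> pw (dderiv T) n = n%:~R ^+ 2 * pw T n.
Proof.
move=> dT; rewrite /pw !coef_dderiv// add0r -splitr coef_pi// !exprMn sqrrN.
by rewrite mulrDr addrC.
Qed.

Lemma pw_abs S T n : (forall th, coef S th n = `|n%:~R| * coef T th n) ->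
  pw S n = n%:~R ^+ 2 * pw T n.
Proof. by move=> E; rewrite /pw !E !exprMn real_normK ?num_real// mulrDr. Qed.

Lemma fsum_coef w N th n : Intg w ->
  coef (dfun (fsum w N)) th n = if (`|n| < N)%N then coef (dfun w) th n else 0.
Proof.
move=> Iw; have sP : SmoothS (fsum w N) by exact: SmoothS_psum.
have nat_case (th' : R) k : coef (dfun (fsum w N)) th' k = if (k < N)%N then coef (dfun w) th' k else 0.
  case: ifPn => kN; first exact: (coef_psum_eq _ Iw).
  rewrite /coef dfunC /fsum distr_psum; last exact/Distr_dfun/SmoothS_Intg/SmoothS_trig.
  rewrite big1// => j _; rewrite !coef_trig.
  case: eqP => [jk|_]; last by rewrite !mulr0 addr0.
  by move: kN; rewrite -jk ltn_ord.
have [k [nE nk]] : exists k : nat, (n = k \/ n = - k%:Z) /\ `|n|%N = k.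
  by exists `|n|%N; split=> //; case: n => j; [left|right; rewrite NegzE].
by rewrite nk; case: nE => ->; rewrite ?coefNz; exact: nat_case.
Qed.

(** The bound is the remainder of a convergent series of nonnegative terms, doubled to include
    negative frequencies; its monotonicity makes it a Cauchy modulus. *)
Lemma Hle_tail s w (B : R) : Intg w -> Hle s (pw (dfun w)) B ->
  exists e : nat -> R, [/\ e N @[N --> \oo] --> 0, (forall N P, (N <= P)%N -> e P <= e N) &
    forall N, Hle s (pw (fun g => dfun (fsum w N) g - dfun w g)) (e N)].
Proof.
move=> Iw hB; have dw := Distr_dfun Iw.
pose t k := wgt s k * pw (dfun w) k.
have t0 k : 0 <= t k by rewrite mulr_ge0 ?wgt_ge0 ?pw_ge0.
pose S N := \sum_(k < N) t k.
have SB N : S N <= B by exact: (Hle_nat N (pw_ge0 _) hB).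
have nd : nondecreasing_seq S by apply/nondecreasing_seqP => N; rewrite /S big_ord_recr/= lerDl.
have cS : cvgn S by apply: nondecreasing_is_cvgn => //; exists B => _ [N _ <-].
exists (fun N => 2 * (limn S - S N)); split.
- rewrite -(mulr0 2) -(subrr (limn S)); apply: cvgn_scale; apply: cvgB; last exact: cS.
  exact: cvg_cst.
- by move=> N P NP; rewrite ler_wpM2l// lerB// nd.
move=> N; have pE n : pw (fun g => dfun (fsum w N) g - dfun w g) n =
    if (`|n| < N)%N then 0 else pw (dfun w) n.
  rewrite /pw /coef -!/(coef _ _ _) !fsum_coef//.
  by case: ifP => _; rewrite ?subrr ?expr0n/= ?addr0// !sub0r !sqrrN.
apply: Hle_of_nat => [n|n|P]; rewrite ?pE.
- by rewrite abszN pwN.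
- by case: ifP => // _; exact: pw_ge0.
have [PN|NP] := leqP P N.
  rewrite big1 ?subr_ge0; first exact: nondecreasing_cvgn_le.
  by move=> k _; rewrite pE/= (leq_trans (ltn_ord k) PN) mulr0.
rewrite -(big_mkord xpredT (fun k : nat => wgt s k * pw (fun g => dfun (fsum w N) g - dfun w g) k)).
rewrite (big_cat_nat (leq0n N) (ltnW NP))/= big_nat big1 ?add0r; last first.
  by move=> k /andP[_ kN]; rewrite pE/= kN mulr0.
rewrite lerBrDr addrC; apply: le_trans (nondecreasing_cvgn_le nd cS P).
rewrite /S -!(big_mkord xpredT t) (big_cat_nat (leq0n N) (ltnW NP))/= lerD2l.
rewrite big_nat [leRHS]big_nat; apply: ler_sum => k /andP[Nk _].
by rewrite pE/= ltnNge Nk.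
Qed.

Lemma distr_pairing_small T (B : R) : Distr T -> Hle (- 2^-1) (pw T) B ->
  forall e : R, 0 < e -> exists2 d : R, 0 < d & forall g, SmoothS g ->
    Hle 2^-1 (pw (dfun g)) d -> `|T g| <= e.
Proof.
move=> dT hB e e0; have B0 := Hle_ge0 hB.
exists (e ^+ 2 / (B + 1)); first by rewrite divr_gt0 ?exprn_gt0// ltr_wpDl.
move=> g sg hg; rewrite -(@ler_pXn2r _ 2)// ?nnegrE ?(ltW e0)// real_normK ?num_real//.
have := @distr_pairing_le _ T g (- 2^-1) _ _ dT sg hB; rewrite opprK => /(_ _ hg) h.
apply: le_trans h _; rewrite mulrCA ler_piMr ?sqr_ge0//.
by rewrite ler_pdivrMr ?mul1r ?lerDl// ltr_wpDl.
Qed.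

(** One sequence along which [T] converges is enough to make the choice in [pairing] meaningful: two
    approximations of [S] differ by a sequence tending to 0 in H^{1/2}, on which [T] is
    continuous. *)
Lemma pairing_cvg T S (B l : R) (g : nat -> R -> R) : Distr T -> Hle (- 2^-1) (pw T) B ->
  (forall k, SmoothS (g k)) -> cvgH 2^-1 g S -> T (g k) @[k --> \oo] --> l ->
  T (g k) @[k --> \oo] --> pairing T S.
Proof.
move=> dT hB sg cg cl.
suff H : [set l : R | forall f : nat -> R -> R,
    (forall k, smoothS (f k)) -> cvgH 2^-1 f S -> T (f k) @[k --> \oo] --> l] (pairing T S).
  by apply: H => // k; exact/SmoothSP.
apply: (@getPex _ [set l : R | _]); exists l => f sf0 cf.
have sf k : SmoothS (f k) by exact/SmoothSP.
suff D : (T (f k) - T (g k)) @[k --> \oo] --> 0.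
  rewrite -[l]add0r; apply: eq_cvgn (cvgD D cl) => k.
  by rewrite subrK.
apply/cvgrPdist_le => e e0; have [d d0 hd] := distr_pairing_small dT hB e0.
have d4 : 0 < d / 4 by rewrite divr_gt0.
have [K1 h1] := cvgH_Hle cf d4; have [K2 h2] := cvgH_Hle cg d4.
exists (maxn K1 K2) => // k /=; rewrite geq_max => /andP[/h1 hf /h2 hg].
rewrite sub0r normrN -distr_sub//; apply: hd; first exact: smoothS_sub.
have := Hle_dfun_sub (SmoothS_Intg (sf k)) (SmoothS_Intg (sg k)) hf hg.
by apply: Hle_mono; lra.
Qed.

Lemma distr_cvg_modulus T (B : R) (g : nat -> R -> R) (e : nat -> R) : Distr T ->
  Hle (- 2^-1) (pw T) B -> (forall k, SmoothS (g k)) -> e N @[N --> \oo] --> 0 ->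
  (forall N P, (N <= P)%N -> Hle 2^-1 (pw (dfun (fun x => g P x - g N x))) (e N)) ->
  T (g k) @[k --> \oo] --> lim (T (g k) @[k --> \oo]).
Proof.
move=> dT hB sg e0 he.
have H1 N P : (N <= P)%N -> `|T (g P) - T (g N)| <= Num.sqrt (B * e N).
  move=> NP; rewrite -sqrtr_sqr ler_sqrt; last first.
    by rewrite mulr_ge0 ?(Hle_ge0 hB)// (Hle_ge0 (he _ _ NP)).
  rewrite -distr_sub//; have sd := smoothS_sub (sg P) (sg N).
  have := @distr_pairing_le _ T (fun x => g P x - g N x) (- 2^-1) _ _ dT sd hB.
  by rewrite opprK; apply; exact: he.
have H2 : Num.sqrt (B * e N) @[N --> \oo] --> 0.
  rewrite -(sqrtr0 R); apply: (@cvg_comp _ _ _ _ Num.sqrt _ (nbhs (0 : R))); last first.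
    exact: sqrt_continuous.
  by rewrite -(mulr0 B); apply: cvgn_scale.
by have [] := cvg_of_modulus (u := fun k => T (g k)) H1 H2.
Qed.

End SobolevLimits.

(** * Passage to the limit in the pairing and in D *)

Section MainLimits.
Variable R : realType.
Implicit Types (f g h v w : R -> R) (S T : distr R) (s x y th : R) (n : int) (k N P : nat).

Let sv w N : SmoothS (fsum w N). Proof. exact: SmoothS_psum. Qed.

Lemma Hle_fsum s w N (B : R) : Intg w -> Hle s (pw (dfun w)) B -> Hle s (pw (dfun (fsum w N))) B.
Proof.
move=> Iw; apply: Hle_pw_le => n; rewrite /pw !fsum_coef//.
by case: ifP => // _; rewrite expr0n/= addr0 addr_ge0 ?sqr_ge0.
Qed.

(** With [g N = v_N X f], the integral is [<L w, g N> + <v_N - w, L (g N)>]. The first term tends to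
    the pairing; in the second, one factor tends to 0 in H^{1/2} and the other is bounded in
    H^{-1/2}. *)
Lemma pairing_fsum_cvg w X f (B : R) : Intg w -> Hle 2^-1 (pw (dfun w)) B ->
  SmoothS X -> SmoothS f ->
  intcirc (fun x => Lam (fsum w N) x * (fsum w N x * X x * f x)) @[N --> \oo] -->
    pairing (lapl 2^-1 (dfun w)) (dfun (fun x => w x * X x * f x)).
Proof.
move=> Iw hB sX sf; have [dL cL eL] := lapl_half Iw.
set L := lapl 2^-1 (dfun w) in dL cL eL *.
pose Y x := X x * f x; have sY : SmoothS Y by exact: smoothS_mul.
have [M YM] := smoothS_Cbound 6 sY; pose K := Cop R * M ^+ 2.
have K0 : 0 <= K by apply: mulr_ge0; [exact: Cop_ge0|exact: sqr_ge0].
have B0 := Hle_ge0 hB.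
have [e [e0 emono he]] := Hle_tail Iw hB.
pose g N x := fsum w N x * X x * f x.
have sg N : SmoothS (g N) by apply: smoothS_mul => //; exact: smoothS_mul.
have half1 : `|2^-1 : R| <= 1 by rewrite ger0_norm// invf_le1// ler1n.
pose D N : distr R := fun h => dfun (fsum w N) h - dfun w h.
have dD N : Distr (D N) by apply: Distr_sub; apply: Distr_dfun => //; exact: SmoothS_Intg.
have gE v h : dfun (fun x => v x * X x * f x) h = dmul (dfun v) Y h.
  by apply: eq_intcirc => x _; rewrite /Y !mulrA.
have hg N : Hle 2^-1 (pw (fun h => dfun (g N) h - dfun (fun x => w x * X x * f x) h)) (K * e N).
  apply: eq_Hle (Hle_dmul half1 (dD N) sY YM (he N)) => n.
  by rewrite /pw /coef /g !gE.
have hgB N : Hle 2^-1 (pw (dfun (g N))) (K * B).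
  apply: eq_Hle (Hle_dmul half1 (Distr_dfun (SmoothS_Intg (sv w N))) sY YM (Hle_fsum N Iw hB)) => n.
  by rewrite /pw /coef /g !gE.
have Ke0 : K * e N @[N --> \oo] --> 0 by rewrite -(mulr0 K); apply: cvgn_scale.
have cg := Hle_cvgH Ke0 hg.
have hL : Hle (- 2^-1) (pw L) B by apply: Hle_derivative hB => n; apply: pw_abs.
(* A Cauchy modulus for [g]: [2 * (K * e P + K * e N)] is at most [4 * (K * e N)] for [N <= P]. *)
have Ke4 : 4 * (K * e N) @[N --> \oo] --> 0 by rewrite -(mulr0 4); apply: cvgn_scale.
have cL1 := distr_cvg_modulus dL hL sg Ke4.
have {}cL1 : L (g k) @[k --> \oo] --> lim (L (g k) @[k --> \oo]).
  apply: cL1 => N P NP; have := Hle_dfun_sub (SmoothS_Intg (sg P)) (SmoothS_Intg (sg N)) (hg P) (hg N).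
  by apply: Hle_mono; have := ler_wpM2l K0 (emono _ _ NP); lra.
have cL2 := pairing_cvg dL hL sg cg cL1.
have d0 : D N (Lam (g N)) @[N --> \oo] --> 0.
  apply: (@cvg_dist_le _ _ (fun N => Num.sqrt (e N * (K * B)))); last first.
    rewrite -(sqrtr0 R); apply: (@cvg_comp _ _ _ _ Num.sqrt _ (nbhs (0 : R))); last first.
      exact: sqrt_continuous.
    by rewrite -(mul0r (K * B)); apply: cvgMl.
  move=> N; have sL := SmoothS_Lam (sg N).
  rewrite subr0 -sqrtr_sqr ler_sqrt; last by apply: mulr_ge0; [exact: Hle_ge0 (he N)|exact: mulr_ge0].
  apply: (@distr_pairing_le _ _ _ 2^-1) => //.
    exact: he.
  apply: Hle_derivative (hgB N) => n; apply: pw_abs => th; exact: coef_Lam.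
apply: (@eq_cvgn _ (fun N => L (g N) + D N (Lam (g N)))) => [N|]; last first.
  by have := cvgD cL2 d0; rewrite addr0; apply.
rewrite -[LHS]/(dfun (Lam (fsum w N)) (g N)) dfun_Lam// eL// /D.
by rewrite -[RHS]/(dfun w (Lam (g N)) + (dfun (fsum w N) (Lam (g N)) - dfun w (Lam (g N)))) addrC subrK.
Qed.

Lemma Hle_derive_mul w X (B M : R) : SmoothS w -> SmoothS X -> Cbound 6 X M ->
  Hle 2^-1 (pw (dfun w)) B ->
  Hle (- 2^-1) (pw (dfun (fun x => derive1 w x * X x))) (Cop R * M ^+ 2 * B).
Proof.
move=> sw sX XM hB; have sw' := smoothS_derive1 sw.
have half1 : `|- 2^-1 : R| <= 1 by rewrite normrN ger0_norm// invf_le1// ler1n.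
have h : Hle (- 2^-1) (pw (dderiv (dfun w))) B.
  by apply: Hle_derivative hB => n; apply: pw_dderiv; exact/Distr_dfun/SmoothS_Intg.
have dw' : Distr (dderiv (dfun w)) by exact/Distr_dderiv/Distr_dfun/SmoothS_Intg.
apply: eq_Hle (Hle_dmul half1 dw' sX XM h) => n.
have E th : coef (dfun (fun x => derive1 w x * X x)) th n = coef (dmul (dderiv (dfun w)) X) th n.
  rewrite /coef dfun_mul /dmul dfun_derive1//; apply: smoothS_mul => //.
  exact: SmoothS_trig.
by rewrite /pw !E.
Qed.

Lemma cvgH_derive_mul w X (B : R) : Intg w -> Hle 2^-1 (pw (dfun w)) B -> SmoothS X ->
  cvgH 2^-1 (fsum w) (dfun w) /\
  cvgH (- 2^-1) (fun N x => derive1 (fsum w N) x * X x) (dmul (dderiv (dfun w)) X).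
Proof.
move=> Iw hB sX; have [e [e0 _ he]] := Hle_tail Iw hB.
split; first exact: Hle_cvgH he.
have [M XM] := smoothS_Cbound 6 sX; pose K := Cop R * M ^+ 2.
have Ke0 : K * e N @[N --> \oo] --> 0 by rewrite -(mulr0 K); apply: cvgn_scale.
apply: Hle_cvgH Ke0 _ => N.
have half1 : `|- 2^-1 : R| <= 1 by rewrite normrN ger0_norm// invf_le1// ler1n.
pose D : distr R := fun h => dfun (fsum w N) h - dfun w h.
have dD : Distr D by apply: Distr_sub; apply: Distr_dfun => //; exact: SmoothS_Intg.
have hD : Hle (- 2^-1) (pw (dderiv D)) (e N).
  by apply: Hle_derivative (he N) => n; exact: pw_dderiv.
apply: eq_Hle (Hle_dmul half1 (Distr_dderiv dD) sX XM hD) => n.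
have E th : coef (fun h => dfun (fun x => derive1 (fsum w N) x * X x) h
    - dmul (dderiv (dfun w)) X h) th n = coef (dmul (dderiv D) X) th n.
  rewrite /coef dfun_mul /dmul dfun_derive1//; last first.
    by apply: smoothS_mul => //; exact: SmoothS_trig.
  by rewrite /dderiv /D opprB opprK addrC.
by rewrite /pw !E.
Qed.

Lemma SmoothS_Ddensity a b : SmoothS a -> SmoothS b ->
  SmoothS (fun x => Lam a x * b x - Lam b x * a x).
Proof.
by move=> sa sb; apply: smoothS_sub; apply: smoothS_mul => //; exact: SmoothS_Lam.
Qed.

Lemma dfun_DhalfC m (a b : 'I_m -> R -> R) f : (forall i, SmoothS (a i)) ->
  (forall i, SmoothS (b i)) -> SmoothS f ->
  dfun (DhalfC a b) f = \sum_(i < m) Dform (a i) (b i) f.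
Proof.
move=> sa sb sf.
have s i : SmoothS (fun x => (Lam (a i) x * b i x - Lam (b i) x * a i x) * f x).
  by apply: smoothS_mul => //; exact: SmoothS_Ddensity.
apply: etrans _ (intcirc_sum _ (fun i => SmoothS_Intg (s i))).
apply: eq_intcirc => x _; rewrite /DhalfC mulr_suml; apply: eq_bigr => i _.
by rewrite !laplC_Lam.
Qed.

Lemma Dform_diff a a' b b' f : SmoothS a -> SmoothS a' -> SmoothS b -> SmoothS b' -> SmoothS f ->
  Dform a b f - Dform a' b' f =
  Dform (fun x => a x - a' x) b f + Dform a' (fun x => b x - b' x) f.
Proof.
move=> sa sa' sb sb' sf.
have LamB p q : SmoothS p -> SmoothS q -> Lam (fun x => p x - q x) = fun x => Lam p x - Lam q x.
  move=> sp sq; have -> : (fun x => p x - q x) = fun x => p x + -1 * q x.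
    by apply/funext => x; rewrite mulN1r.
  rewrite LamD//; last exact: smoothS_scale.
  by rewrite LamZ//; apply/funext => x; rewrite mulN1r.
have I p q : SmoothS p -> SmoothS q -> Intg (fun x => (Lam p x * q x - Lam q x * p x) * f x).
  by move=> sp sq; apply: SmoothS_Intg; apply: smoothS_mul => //; exact: SmoothS_Ddensity.
apply: etrans (esym (intcirc_sub (I _ _ sa sb) (I _ _ sa' sb'))) _.
apply: etrans _ (intcirc_add (I _ _ (smoothS_sub sa sa') sb) (I _ _ sa' (smoothS_sub sb sb'))).
apply: eq_intcirc => x _; rewrite !LamB//.
move: (Lam a x) (Lam a' x) (Lam b x) (Lam b' x) (a x) (a' x) (b x) (b' x) (f x) => p1 p2 p3 p4 p5 p6 p7 p8 p9.
ring.
Qed.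

(** The bound is linear in the size [M] of the test function, which gives the limit functional
    continuity of order 6. *)
Lemma Dform_le a b f (M A B : R) : SmoothS a -> SmoothS b -> SmoothS f -> Cbound 6 f M ->
  Hle (- 2^-1) (pw (dfun a)) A -> Hle 2^-1 (pw (dfun b)) B ->
  `|Dform a b f| <= (Cop R * A * B + 1) * M.
Proof.
move=> sa sb sf fM hA hB; apply: sqr_le_bound.
- apply: mulr_ge0 (Hle_ge0 hB); apply: mulr_ge0 (Hle_ge0 hA); exact: Cop_ge0.
- exact: Cbound_ge0 fM.
apply: le_trans (Dform_bound sa sb sf fM hA hB) _; move: (Cop R) => C.
by have -> : C * M ^+ 2 * A * B = C * A * B * M ^+ 2 by ring.
Qed.

Let small (C A d e : R) : 0 <= C -> 0 <= A -> 0 < e -> 0 <= d -> d <= e ^+ 2 / (C * A + 1) -> C * d * A <= e ^+ 2.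
Proof.
move=> C0 A0 e0 d0; have p : 0 < C * A + 1 by rewrite ltr_wpDl// mulr_ge0.
by rewrite ler_pdivlMr// mulrDr mulr1 => h; rewrite mulrAC mulrC; lra.
Qed.

Lemma Dform_small f (A e : R) : SmoothS f -> 0 <= A -> 0 < e -> exists2 d : R, 0 < d &
  forall a b, SmoothS a -> SmoothS b ->
    (Hle (- 2^-1) (pw (dfun a)) d /\ Hle 2^-1 (pw (dfun b)) A) \/
    (Hle (- 2^-1) (pw (dfun a)) A /\ Hle 2^-1 (pw (dfun b)) d) -> `|Dform a b f| <= e.
Proof.
move=> sf A0 e0; have [M fM] := smoothS_Cbound 6 sf; pose C := Cop R * M ^+ 2.
have C0 : 0 <= C by apply: mulr_ge0; [exact: Cop_ge0|exact: sqr_ge0].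
have p : 0 < C * A + 1 by rewrite ltr_wpDl// mulr_ge0.
have dp : 0 < e ^+ 2 / (C * A + 1) by rewrite divr_gt0 ?exprn_gt0.
exists (e ^+ 2 / (C * A + 1)) => // a b sa sb h.
have := small C0 A0 e0 (ltW dp) (lexx _); set d := _ / _ in dp h * => h'.
rewrite -(@ler_pXn2r _ 2)// ?nnegrE ?(ltW e0)// real_normK ?num_real//.
case: h => -[hA hB]; apply: le_trans (Dform_bound sa sb sf fM hA hB) _; rewrite -/C//.
by rewrite mulrAC.
Qed.

End MainLimits.

(** * The identity of distributions *)

Theorem theorem4p1 (R : realType) (m : nat) (hm : (1 <= m)%N)
  (X : R -> R) (hX : smoothS X)
  (phi : R -> R -> R) (hphi : is_flow X phi)
  (hinv : forall v : 'I_m -> R -> R, (forall i, smoothS (v i)) ->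
    \forall t \near (0 : R), forall x : R,
      \sum_(i < m) v i (phi t x) * laplC 2^-1 (v i \o phi t) x =
      (\sum_(i < m) v i (phi t x) * laplC 2^-1 (v i) (phi t x))
        * derive1 (phi t) x)
  (u : 'I_m -> R -> R) (hu : H12 u) (hstat : stationary u) :
  eq_distr (dderiv (lapl_dot u X))
           (Dhalf (fun i => dmul (dderiv (dfun (u i))) X)
                  (fun i => dfun (u i))).
Proof.
have sX : SmoothS X by exact/SmoothSP.
have hU i : L2S (u i) by have [] := hu i.
have Iu i := L2S_Intg (hU i).
have /choice[B hB] := fun i => H12_Hle i hu.
pose v i N := fsum (u i) N.
have sv i N : SmoothS (v i N) by exact: SmoothS_psum.
pose a i N x := derive1 (v i N) x * X x.
have sa i N : SmoothS (a i N) by apply: smoothS_mul => //; exact: smoothS_derive1.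
have cv i := cvgH_derive_mul (Iu i) (hB i) sX.
pose F N f := dfun (DhalfC (fun i => a i N) (fun i => v i N)) f.
pose T := dderiv (lapl_dot u X).
have FE N f : SmoothS f -> F N f = \sum_(i < m) Dform (a i N) (v i N) f.
  by move=> sf; apply: dfun_DhalfC.
have Fcv f : SmoothS f -> F N f @[N --> \oo] --> T f.
  move=> sf; have sf' := smoothS_derive1 sf.
  have sXf : SmoothS (fun x => X x * f x) by exact: smoothS_mul.
  have c1 : \sum_(i < m) intcirc (fun x => Lam (v i N) x * (v i N x * X x * derive1 f x)) @[N --> \oo] -->
      lapl_dot u X (derive1 f).
    by apply: cvgr_sum => i; exact: pairing_fsum_cvg (hB i) _ _.
  have c2 := stationary_Qform hu hstat sXf.
  pose I1 N := \sum_(i < m) intcirc (fun x => Lam (v i N) x * (v i N x * X x * derive1 f x)).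
  pose I2 N := \sum_(i < m) Qform (fun x => X x * f x) (v i N) (v i N).
  apply: (@eq_cvgn _ (fun N => - I1 N - 2 * I2 N)) => [N|].
    rewrite FE// /I1 /I2 mulr_sumr -sumrN -sumrB; apply: eq_bigr => i _.
    exact: (Dform_conformal hm sX hphi hinv).
  have TE : - lapl_dot u X (derive1 f) - 2 * 0 = T f by rewrite mulr0 subr0.
  by rewrite -TE; apply: cvgB; [exact: cvgN|exact: cvgn_scale].
have [M XM] := smoothS_Cbound 6 sX.
pose A i := Cop R * M ^+ 2 * B i.
have hA i N : Hle (- 2^-1) (pw (dfun (a i N))) (A i).
  by apply: Hle_derive_mul => //; exact: Hle_fsum.
have hV i N : Hle 2^-1 (pw (dfun (v i N))) (B i) by exact: Hle_fsum.
have dF N : Distr (F N).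
  have sD : SmoothS (fun x => \sum_(i < m) (Lam (a i N) x * v i N x - Lam (v i N) x * a i N x)).
    by apply: smoothS_sum => i; exact: SmoothS_Ddensity.
  have -> : F N = dfun (fun x => \sum_(i < m) (Lam (a i N) x * v i N x - Lam (v i N) x * a i N x)).
    congr dfun; apply/funext => x; apply: eq_bigr => i _.
    by rewrite !laplC_Lam.
  exact/Distr_dfun/SmoothS_Intg.
(* Linearity and the order-6 bound are inherited from the functionals [F N], whose bounds do not
   depend on [N]. *)
have dT : is_distr T.
  split=> [c f g /SmoothSP sf /SmoothSP sg|].
    have sc : SmoothS (fun x => c * f x) by exact: smoothS_scale.
    apply: (cvg_unique (@Rhausdorff R) (Fcv _ (smoothS_add sc sg))).
    apply: (@eq_cvgn _ (fun N => c * F N f + F N g)) => [N|].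
      by rewrite (distr_add (dF N) sc sg) (distr_scale c (dF N) sf).
    by apply: cvgD; [apply: cvgn_scale; exact: Fcv|exact: Fcv].
  exists 6%N, (\sum_(i < m) (Cop R * A i * B i + 1)) => f K /SmoothSP sf fK.
  have hK : Cbound 6 f K by exact: MkCbound.
  have := cvg_norm (Fcv f sf); move=> /(_ _) cn; apply: (cvgn_le cn); apply: nearW => N.
  rewrite FE// (le_trans (ler_norm_sum _ _ _))// mulr_suml; apply: ler_sum => i _.
  exact: Dform_le.
(* Independence of the approximating sequences: by [Dform_diff] the difference from [F] is a sum of
   two terms, each with one argument tending to 0 and the other bounded. *)
have spec : forall an bn : 'I_m -> nat -> R -> R,
    (forall i k, smoothS (an i k)) -> (forall i k, smoothS (bn i k)) ->
    (forall i, cvgH (- 2^-1) (an i) (dmul (dderiv (dfun (u i))) X)) ->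
    (forall i, cvgH 2^-1 (bn i) (dfun (u i))) ->
    forall f : R -> R, smoothS f ->
      dfun (DhalfC (fun i => an i k) (fun i => bn i k)) f @[k --> \oo] --> T f.
  move=> an bn san' sbn' can cbn f /SmoothSP sf.
  have san i k : SmoothS (an i k) := (SmoothSP _).2 (san' i k).
  have sbn i k : SmoothS (bn i k) := (SmoothSP _).2 (sbn' i k).
  have d0 : \sum_(i < m) (Dform (an i k) (bn i k) f - Dform (a i k) (v i k) f) @[k --> \oo] --> 0.
    have S0 : \sum_(i < m) (0 : R) = 0 by rewrite big1.
    rewrite -[X in _ --> X]S0.
    apply: cvgr_sum => i; apply/cvgrPdist_le => e e0.
    have [cvi cai] := cv i; have e2 : 0 < e / 2 by rewrite divr_gt0.
    have B0 := Hle_ge0 (hB i); have A0 : 0 <= A i := Hle_ge0 (hA i 0%N).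
    (* A common bound for both fixed arguments: [A i] for [a i k], and [2 * (1 + B i)] for [bn i k],
       which is eventually within 1 of [u i] in the squared H^{1/2} norm measured by [Hle]. *)
    have A'0 : 0 <= A i + 2 * (1 + B i) by rewrite addr_ge0// mulr_ge0// addr_ge0.
    have [d d1 hd] := Dform_small sf A'0 e2.
    have d4 : 0 < d / 4 by rewrite divr_gt0.
    have [K1 h1] := cvgH_Hle (can i) d4; have [K2 h2] := cvgH_Hle cai d4.
    have [K3 h3] := cvgH_Hle (cbn i) d4; have [K4 h4] := cvgH_Hle cvi d4.
    have [K5 h5] := cvgH_Hle (cbn i) (@ltr01 R).
    exists (maxn K1 (maxn K2 (maxn K3 (maxn K4 K5)))) => // k /=.
    rewrite !geq_max => /and5P[/h1 k1 /h2 k2 /h3 k3 /h4 k4 /h5 k5].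
    rewrite sub0r normrN Dform_diff// (le_trans (ler_normD _ _))//.
    have dd : 2 * (d / 4 + d / 4) <= d by lra.
    have ka := Hle_mono dd (Hle_dfun_sub (SmoothS_Intg (san i k)) (SmoothS_Intg (sa i k)) k1 k2).
    have kb := Hle_mono dd (Hle_dfun_sub (SmoothS_Intg (sbn i k)) (SmoothS_Intg (sv i k)) k3 k4).
    have kN : Hle 2^-1 (pw (fun g => - dfun (u i) g)) (B i).
      by apply: eq_Hle (hB i) => n; rewrite /pw /coef !sqrrN.
    have kB : Hle 2^-1 (pw (dfun (bn i k))) (A i + 2 * (1 + B i)).
      have AB : 2 * (1 + B i) <= A i + 2 * (1 + B i) by rewrite lerDr.
      apply: (Hle_mono AB); apply: eq_Hle (Hle_sub k5 kN) => n.
      by rewrite /pw /coef !opprK !subrK.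
    have kA : Hle (- 2^-1) (pw (dfun (a i k))) (A i + 2 * (1 + B i)).
      by apply: Hle_mono (hA i k); rewrite lerDl mulr_ge0// addr_ge0.
    have E1 := hd _ _ (smoothS_sub (san i k) (sa i k)) (sbn i k) (or_introl (conj ka kB)).
    have E2 := hd _ _ (sa i k) (smoothS_sub (sbn i k) (sv i k)) (or_intror (conj kA kb)).
    by rewrite (splitr e); apply: lerD.
  apply: (@eq_cvgn _ (fun k => \sum_(i < m) (Dform (an i k) (bn i k) f - Dform (a i k) (v i k) f)
    + F k f)) => [k|].
    apply: etrans (dfun_DhalfC (fun i => san i k) (fun i => sbn i k) sf) _.
    by rewrite (FE k f sf) sumrB subrK.
  by rewrite -[T f]add0r; apply: cvgD => //; exact: Fcv.
move=> f sf'; have sf : SmoothS f by exact/SmoothSP.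
(* [T] shows that the set from which [Dhalf] chooses is inhabited; the chosen distribution is then
   evaluated along [a] and [v], where the limit is already known to be [T f]. *)
have [_ hget] : [set T : distr R | is_distr T /\
    forall an bn : 'I_m -> nat -> R -> R,
      (forall i k, smoothS (an i k)) -> (forall i k, smoothS (bn i k)) ->
      (forall i, cvgH (- 2^-1) (an i) (dmul (dderiv (dfun (u i))) X)) ->
      (forall i, cvgH 2^-1 (bn i) (dfun (u i))) ->
      forall f : R -> R, smoothS f ->
        dfun (DhalfC (fun i => an i k) (fun i => bn i k)) f @[k --> \oo]
          --> T f] (Dhalf (fun i => dmul (dderiv (dfun (u i))) X) (fun i => dfun (u i))).
  by apply: getPex; exists T.
apply: (cvg_unique (@Rhausdorff R) (Fcv f sf)).
exact: (hget a v (fun i k => (SmoothSP _).1 (sa i k)) (fun i k => (SmoothSP _).1 (sv i k))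
  (fun i => (cv i).2) (fun i => (cv i).1) f sf').
Qed.
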